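(* For $\lambda\mu x$-terms $M,N$: if $M=_xN$, then $[\![M]\!]_a\approx[\![N]\!]_a$.
   Context: $\lambda\mu x$-terms: $M,N ::= x\mid\lambda x.M\mid MN\mid M\langle x:=N\rangle\mid\mu\alpha.[\beta]M\mid M\langle\alpha:=N\cdot\gamma\rangle$ (explicit substitutions may also be attached to commands $C=[\beta]M$). $\to_x$ is the closure under all contexts of: $(\lambda x.M)N\to M\langle x:=N\rangle$; $(\mu\alpha.C)N\to\mu\gamma.(C\langle\alpha:=N\cdot\gamma\rangle)$ ($\gamma$ fresh); $\mu\beta.[\beta]M\to M$ ($\beta\notin\mathrm{fn}(M)$); $[\beta]\mu\gamma.C\to C[\beta/\gamma]$; $x\langle x:=N\rangle\to N$; $M\langle x:=N\rangle\to M$ ($x\notin\mathrm{fv}(M)$); $(\lambda y.M)\langle x:=N\rangle\to\lambda y.(M\langle x:=N\rangle)$; $(PQ)\langle x:=N\rangle\to(P\langle x:=N\rangle)(Q\langle x:=N\rangle)$; $(\mu\alpha.[\beta]M)\langle x:=N\rangle\to\mu\alpha.[\beta](M\langle x:=N\rangle)$; $(\mu\delta.C)\langle\alpha:=N\cdot\gamma\rangle\to\mu\delta.(C\langle\alpha:=N\cdot\gamma\rangle)$; $([\alpha]M)\langle\alpha:=N\cdot\gamma\rangle\to[\gamma](M\langle\alpha:=N\cdot\gamma\rangle)N$; $([\beta]M)\langle\alpha:=N\cdot\gamma\rangle\to[\beta](M\langle\alpha:=N\cdot\gamma\rangle)$ ($\alpha\ne\beta$); $M\langle\alpha:=N\cdot\gamma\rangle\to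 M$ ($\alpha\notin\mathrm{fn}(M)$); $(\lambda x.M)\langle\alpha:=N\cdot\gamma\rangle\to\lambda x.(M\langle\alpha:=N\cdot\gamma\rangle)$; $(PQ)\langle\alpha:=N\cdot\gamma\rangle\to(P\langle\alpha:=N\cdot\gamma\rangle)(Q\langle\alpha:=N\cdot\gamma\rangle)$. $=_x$ is the congruence generated by $\to_x$. $\pi$-calculus with pairing: data $p::=a\mid\langle a,b\rangle$; processes $P ::= 0\mid P|Q\mid!P\mid(\nu a)P\mid a(x).P\mid\overline a\langle p\rangle.P\mid\mathrm{let}\ \langle x,y\rangle=p\ \mathrm{in}\ P$; $a(y,z).P$ abbreviates $a(x).\mathrm{let}\ \langle y,z\rangle=x\ \mathrm{in}\ P$; forwarder $a\to b$ is $a(x).\overline b\langle x\rangle$. Structural congruence: least congruence with $P|0\equiv P$, commutativity/associativity of $|$, $!P\equiv P|!P$, $(\nu n)0\equiv0$, $(\nu m)(\nu n)P\equiv(\nu n)(\nu m)P$, $(\nu n)(P|Q)\equiv P|(\nu n)Q$ ($n\notin\mathrm{fn}(P)$), $\mathrm{let}\ \langle x,y\rangle=\langle a,b\rangle\ \mathrm{in}\ P\equiv P[a/x,b/y]$. Reduction: $\overline a\langle p\rangle.P\mid a(x).Q\to P\mid Q[p/x]$, closed under restriction, $|$ and $\equiv$. Output (input) barb on $n$: $P\equiv(\nu\vec b)(\overline n\langle p\rangle.Q\mid R)$ (resp. $n(x).Q$), $n\notin\vec b$; weak barb: after some reductions. Barbed bisimilarity $\sim$: largest symmetric relation where barbs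 of $P$ are weak barbs of $Q$ and $P\to^*P'$ is matched by $Q\to^*Q'$ with $P'\sim Q'$. $P\approx Q$ iff $C[P]\sim C[Q]$ for all contexts $C$. Interpretation ($u,b,c,v,d,w$ fresh): $[\![x]\!]_a=x(u).!(u\to a)$; $[\![\lambda x.M]\!]_a=(\nu xb)([\![M]\!]_b\mid\overline a\langle x,b\rangle)$; $[\![MN]\!]_a=(\nu c)([\![M]\!]_c\mid!c(v,d).([\![v:=N]\!]\mid!(d\to a)))$; $[\![M\langle x:=N\rangle]\!]_a=(\nu x)([\![M]\!]_a\mid[\![x:=N]\!])$; $[\![x:=N]\!]=!(\nu w)(\overline x\langle w\rangle.[\![N]\!]_w)$; $[\![\mu\gamma.[\beta]M]\!]_a=[\![M]\!]_\beta[a/\gamma]$; $[\![M\langle\alpha:=N\cdot\gamma\rangle]\!]_a=(\nu\alpha)([\![M]\!]_a\mid!\alpha(v,d).([\![v:=N]\!]\mid!(d\to\gamma)))$. *)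

(* Defs.v *)
From Stdlib Require Import Relations.

Set Implicit Arguments.

(** Everything is considered up to alpha-conversion, so both calculi are given in
    de Bruijn style.  Lambda-mu terms have two independent index spaces (term
    variables and mu-names); processes have a single one (channels). *)

Definition scons {A : Type} (a : A) (f : nat -> A) (n : nat) : A :=
  match n with 0 => a | S m => f m end.

Definition up (f : nat -> nat) : nat -> nat := scons 0 (fun n => S (f n)).

Definition swap01 (n : nat) : nat :=
  match n with 0 => 1 | 1 => 0 | S (S m) => S (S m) end.

Definition idn (n : nat) : nat := n.

(** * The calculus lambda-mu-x *)

Inductive term : Type :=
| Var  (x : nat)
| Lam  (M : term)                            (* binds variable 0 *)
| App  (M N : term)
| Sub  (M N : term)                          (* M<x:=N>: variable 0 bound in M only *)
| Mu   (C : cmd)                             (* binds name 0 *)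
| MSub (M N : term) (g : nat)                (* M<alpha:=N.g>: name 0 bound in M only *)
with cmd : Type :=
| Named (b : nat) (M : term)                 (* [b]M *)
| CSub  (C : cmd) (N : term)                 (* C<x:=N> *)
| CMSub (C : cmd) (N : term) (g : nat).      (* C<alpha:=N.g> *)

(** Renaming of variables by [f] and of mu-names by [h]. *)
Fixpoint tren (f h : nat -> nat) (M : term) : term :=
  match M with
  | Var x => Var (f x)
  | Lam M => Lam (tren (up f) h M)
  | App M N => App (tren f h M) (tren f h N)
  | Sub M N => Sub (tren (up f) h M) (tren f h N)
  | Mu C => Mu (cren f (up h) C)
  | MSub M N g => MSub (tren f (up h) M) (tren f h N) (h g)
  end
with cren (f h : nat -> nat) (C : cmd) : cmd :=
  match C with
  | Named b M => Named (h b) (tren f h M)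
  | CSub C N => CSub (cren (up f) h C) (tren f h N)
  | CMSub C N g => CMSub (cren f (up h) C) (tren f h N) (h g)
  end.

(** Weakenings.  A side condition "x not free in M" is expressed by M being a
    weakening. *)
Definition shv : term -> term := tren S idn.
Definition shn : term -> term := tren idn S.

Inductive red : term -> term -> Prop :=
| red_beta M N : red (App (Lam M) N) (Sub M N)
  (* on the right, alpha is name 0 and the fresh gamma is name 1 of the command *)
| red_mu C N :
    red (App (Mu C) N) (Mu (CMSub (cren idn (up S) C) (shn N) 0))
| red_erase M : red (Mu (Named 0 (shn M))) M
| red_sub_var N : red (Sub (Var 0) N) N
| red_sub_gc M N : red (Sub (shv M) N) M
| red_sub_lam M N :
    red (Sub (Lam M) N) (Lam (Sub (tren swap01 idn M) (shv N)))
| red_sub_app P Q N : red (Sub (App P Q) N) (App (Sub P N) (Sub Q N))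
| red_sub_mu b M N :
    red (Sub (Mu (Named b M)) N) (Mu (Named b (Sub M (shn N))))
| red_msub_mu C N g :
    red (MSub (Mu C) N g) (Mu (CMSub (cren idn swap01 C) (shn N) (S g)))
| red_msub_gc M N g : red (MSub (shn M) N g) M
| red_msub_lam M N g : red (MSub (Lam M) N g) (Lam (MSub M (shv N) g))
| red_msub_app P Q N g :
    red (MSub (App P Q) N g) (App (MSub P N g) (MSub Q N g))
| red_ctx_lam M M' : red M M' -> red (Lam M) (Lam M')
| red_ctx_appl M M' N : red M M' -> red (App M N) (App M' N)
| red_ctx_appr M N N' : red N N' -> red (App M N) (App M N')
| red_ctx_subl M M' N : red M M' -> red (Sub M N) (Sub M' N)
| red_ctx_subr M N N' : red N N' -> red (Sub M N) (Sub M N')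
| red_ctx_mu C C' : credu C C' -> red (Mu C) (Mu C')
| red_ctx_msubl M M' N g : red M M' -> red (MSub M N g) (MSub M' N g)
| red_ctx_msubr M N N' g : red N N' -> red (MSub M N g) (MSub M N' g)
with credu : cmd -> cmd -> Prop :=
| credu_rename b C : credu (Named b (Mu C)) (cren idn (scons b idn) C)
| credu_msub_same M N g :
    credu (CMSub (Named 0 M) N g) (Named g (App (MSub M N g) N))
| credu_msub_other b M N g :
    credu (CMSub (Named (S b) M) N g) (Named b (MSub M N g))
| credu_ctx_named b M M' : red M M' -> credu (Named b M) (Named b M')
| credu_ctx_subl C C' N : credu C C' -> credu (CSub C N) (CSub C' N)
| credu_ctx_subr C N N' : red N N' -> credu (CSub C N) (CSub C N')
| credu_ctx_msubl C C' N g : credu C C' -> credu (CMSub C N g) (CMSub C' N g)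
| credu_ctx_msubr C N N' g : red N N' -> credu (CMSub C N g) (CMSub C N' g).

(** [red] is closed under contexts, so the congruence it generates is its
    equivalence closure. *)
Definition eqx : relation term := clos_refl_sym_trans term red.

(** * The pi-calculus with (non-recursive) pairing *)

Inductive data : Type :=
| DName (a : nat)
| DPair (a b : nat).

Inductive proc : Type :=
| Nil
| Par  (P Q : proc)
| Repl (P : proc)
| Nu   (P : proc)                            (* binds channel 0 *)
| Inp   (a : nat) (P : proc)                  (* a(x).P: x is channel 0 of P *)
| Out  (a : nat) (p : data) (P : proc)
| Let  (p : data) (P : proc).                (* let <x,y> = p in P: x is 0, y is 1 *)

Definition dren (f : nat -> nat) (p : data) : data :=
  match p with
  | DName a => DName (f a)
  | DPair a b => DPair (f a) (f b)
  end.

Fixpoint pren (f : nat -> nat) (P : proc) : proc :=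
  match P with
  | Nil => Nil
  | Par P Q => Par (pren f P) (pren f Q)
  | Repl P => Repl (pren f P)
  | Nu P => Nu (pren (up f) P)
  | Inp a P => Inp (f a) (pren (up f) P)
  | Out a p P => Out (f a) (dren f p) (pren f P)
  | Let p P => Let (dren f p) (pren (up (up f)) P)
  end.

Definition psh : proc -> proc := pren S.

(** Substitution of data for names.  When a pair replaces a name, the result may
    fall outside the grammar:
    - a prefix whose subject becomes a pair can never fire: it becomes [Nil];
    - a pair with a component that is itself a pair does not exist: the
      substitution is undefined. *)
Definition dup (s : nat -> data) : nat -> data :=
  scons (DName 0) (fun n => dren S (s n)).

Definition dsubst (s : nat -> data) (p : data) : option data :=
  match p with
  | DName a => Some (s a)
  | DPair a b =>
      match s a, s b with
      | DName a', DName b' => Some (DPair a' b')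
      | _, _ => None
      end
  end.

Fixpoint psubst (s : nat -> data) (P : proc) : option proc :=
  match P with
  | Nil => Some Nil
  | Par P Q =>
      match psubst s P, psubst s Q with
      | Some P', Some Q' => Some (Par P' Q')
      | _, _ => None
      end
  | Repl P => option_map Repl (psubst s P)
  | Nu P => option_map Nu (psubst (dup s) P)
  | Inp a P =>
      match s a with
      | DName a' => option_map (Inp a') (psubst (dup s) P)
      | DPair _ _ => Some Nil
      end
  | Out a p P =>
      match s a with
      | DName a' =>
          match dsubst s p, psubst s P with
          | Some p', Some P' => Some (Out a' p' P')
          | _, _ => None
          end
      | DPair _ _ => Some Nil
      end
  | Let p P =>
      match dsubst s p, psubst (dup (dup s)) P with
      | Some p', Some P' => Some (Let p' P')
      | _, _ => None
      end
  end.

(** P[p/x] where x is channel 0 of P. *)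
Definition psubst0 (p : data) (P : proc) : option proc :=
  psubst (scons p DName) P.

Inductive scong : proc -> proc -> Prop :=
| sc_par_nil P : scong (Par P Nil) P
| sc_par_comm P Q : scong (Par P Q) (Par Q P)
| sc_par_assoc P Q R : scong (Par (Par P Q) R) (Par P (Par Q R))
| sc_repl P : scong (Repl P) (Par P (Repl P))
| sc_nu_nil : scong (Nu Nil) Nil
| sc_nu_nu P : scong (Nu (Nu P)) (Nu (Nu (pren swap01 P)))
| sc_nu_par P Q : scong (Nu (Par (psh P) Q)) (Par P (Nu Q))
| sc_let a b P : scong (Let (DPair a b) P) (pren (scons a (scons b idn)) P)
| sc_refl P : scong P P
| sc_sym P Q : scong P Q -> scong Q P
| sc_trans P Q R : scong P Q -> scong Q R -> scong P R
| sc_ctx_par P P' Q Q' : scong P P' -> scong Q Q' -> scong (Par P Q) (Par P' Q')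
| sc_ctx_repl P P' : scong P P' -> scong (Repl P) (Repl P')
| sc_ctx_nu P P' : scong P P' -> scong (Nu P) (Nu P')
| sc_ctx_in a P P' : scong P P' -> scong (Inp a P) (Inp a P')
| sc_ctx_out a p P P' : scong P P' -> scong (Out a p P) (Out a p P')
| sc_ctx_let p P P' : scong P P' -> scong (Let p P) (Let p P').

Inductive step : proc -> proc -> Prop :=
| step_comm a p P Q Q' :
    psubst0 p Q = Some Q' ->
    step (Par (Out a p P) (Inp a Q)) (Par P Q')
| step_nu P P' : step P P' -> step (Nu P) (Nu P')
| step_par P P' Q : step P P' -> step (Par P Q) (Par P' Q)
| step_scong P P1 P1' P' :
    scong P P1 -> step P1 P1' -> scong P1' P' -> step P P'.

Definition steps : relation proc := clos_refl_trans proc step.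

(** Below [k] restrictions the channel [n] is [k + n], which is thus not one of
    the restricted ones. *)
Definition out_barb (P : proc) (n : nat) : Prop :=
  exists k p Q R, scong P (Nat.iter k Nu (Par (Out (k + n) p Q) R)).

Definition in_barb (P : proc) (n : nat) : Prop :=
  exists k Q R, scong P (Nat.iter k Nu (Par (Inp (k + n) Q) R)).

Definition weak_out_barb (P : proc) (n : nat) : Prop :=
  exists P', steps P P' /\ out_barb P' n.

Definition weak_in_barb (P : proc) (n : nat) : Prop :=
  exists P', steps P P' /\ in_barb P' n.

Definition barbed_bisimulation (R : relation proc) : Prop :=
  symmetric proc R /\
  forall P Q, R P Q ->
    (forall n, out_barb P n -> weak_out_barb Q n) /\
    (forall n, in_barb P n -> weak_in_barb Q n) /\
    (forall P', steps P P' -> exists Q', steps Q Q' /\ R P' Q').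

Definition barbed_bisimilar (P Q : proc) : Prop :=
  exists R, barbed_bisimulation R /\ R P Q.

(** One-hole contexts; filling the hole does not shift, so binders of the context
    capture. *)
Inductive pctx : Type :=
| KHole
| KParL (K : pctx) (Q : proc)
| KParR (P : proc) (K : pctx)
| KRepl (K : pctx)
| KNu   (K : pctx)
| KIn   (a : nat) (K : pctx)
| KOut  (a : nat) (p : data) (K : pctx)
| KLet  (p : data) (K : pctx).

Fixpoint fill (K : pctx) (P : proc) : proc :=
  match K with
  | KHole => P
  | KParL K Q => Par (fill K P) Q
  | KParR Q K => Par Q (fill K P)
  | KRepl K => Repl (fill K P)
  | KNu K => Nu (fill K P)
  | KIn a K => Inp a (fill K P)
  | KOut a p K => Out a p (fill K P)
  | KLet p K => Let p (fill K P)
  end.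

Definition pi_equiv (P Q : proc) : Prop :=
  forall K : pctx, barbed_bisimilar (fill K P) (fill K Q).

(** * The interpretation *)

(** a(y,z).P = a(x).let <y,z> = x in P, where y, z are the channels 0, 1 of P. *)
Definition Inp2 (a : nat) (P : proc) : proc :=
  Inp a (Let (DName 0) (pren (up (up S)) P)).

(** The forwarder a -> b. *)
Definition fwd (a b : nat) : proc := Inp a (Out (S b) (DName 0) Nil).

(** [[x:=N]] = !(nu w)(x<w>.[[N]]_w), where [N_w] is [[N]]_w with w as channel 0. *)
Definition subst_server (x : nat) (N_w : proc) : proc :=
  Repl (Nu (Out (S x) (DName 0) N_w)).

(** !c(v,d).([[v:=N]] | !(d -> a)), where [N_w] lives below v, d and w. *)
Definition stack_server (c a : nat) (N_w : proc) : proc :=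
  Repl (Inp2 c (Par (subst_server 0 N_w) (Repl (fwd 1 (2 + a))))).

(** Lambda-mu variables and names are themselves pi-calculus channels; [e] and [h]
    say which channel each index denotes in the current scope. *)
Definition shift_env (k : nat) (e : nat -> nat) (n : nat) : nat := k + e n.

Fixpoint interp (e h : nat -> nat) (M : term) (a : nat) : proc :=
  match M with
  | Var x => Inp (e x) (Repl (fwd 0 (1 + a)))
  | Lam M =>                                 (* x is channel 1, b is channel 0 *)
      Nu (Nu (Par (interp (scons 1 (shift_env 2 e)) (shift_env 2 h) M 0)
                  (Out (2 + a) (DPair 1 0) Nil)))
  | App M N =>
      Nu (Par (interp (shift_env 1 e) (shift_env 1 h) M 0)
              (stack_server 0 (1 + a)
                 (interp (shift_env 4 e) (shift_env 4 h) N 0)))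
  | Sub M N =>
      Nu (Par (interp (scons 0 (shift_env 1 e)) (shift_env 1 h) M (1 + a))
              (subst_server 0 (interp (shift_env 2 e) (shift_env 2 h) N 0)))
  | Mu C =>                                  (* [[C]] with gamma as channel 0, then [a/gamma] *)
      pren (scons a idn) (cinterp (shift_env 1 e) (scons 0 (shift_env 1 h)) C)
  | MSub M N g =>
      Nu (Par (interp (shift_env 1 e) (scons 0 (shift_env 1 h)) M (1 + a))
              (stack_server 0 (1 + h g)
                 (interp (shift_env 4 e) (shift_env 4 h) N 0)))
  end
with cinterp (e h : nat -> nat) (C : cmd) : proc :=
  match C with
  | Named b M => interp e h M (h b)
  | CSub C N =>
      Nu (Par (cinterp (scons 0 (shift_env 1 e)) (shift_env 1 h) C)
              (subst_server 0 (interp (shift_env 2 e) (shift_env 2 h) N 0)))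
  | CMSub C N g =>
      Nu (Par (cinterp (shift_env 1 e) (scons 0 (shift_env 1 h)) C)
              (stack_server 0 (1 + h g)
                 (interp (shift_env 4 e) (shift_env 4 h) N 0)))
  end.

(** The free variables and the free mu-names of a term are pairwise distinct
    channels. *)
Definition var_chan (x : nat) : nat := 2 * x.
Definition name_chan (n : nat) : nat := 2 * n + 1.

Definition interpretation (M : term) (a : nat) : proc :=
  interp var_chan name_chan M a.

(* Main.v *)
Require Import Defs.
From Stdlib Require Import Relations Lia Arith FunctionalExtensionality Setoid Morphisms.
From Stdlib Require Import List Permutation.

(** Each explicit substitution is interpreted by a private replicated server: an output
    [!(nu w)(x<w>.[[N]]_w)] for [<x:=N>], an input [!c(v,d).(...)] for an application or for
    [<alpha:=N.gamma>], and a forwarder [!b(x).a<x>] when a result is returned.  The clients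
    only receive on the first kind of channel, and only send on the second one, without
    continuation; they never transmit it.  An interaction with such a server is therefore
    deterministic and invisible, and the server can be eliminated by performing all these
    interactions in advance, also below prefixes: [(nu c)(P | server)] is equivalent to [link]
    applied to [P], which substitutes the server for [c].  After this elimination the two
    sides of every reduction rule become structurally congruent.

    Elimination is proved by a bisimulation up to contexts and structural congruence on a
    labelled transition system.  As input contexts may replace a free channel by a pair, the
    candidate relation has to be closed under such substitutions. *)

(** The difficulty lies in substituting data. This operation is partial: pairs do not nest, and a
    prefix whose subject becomes a pair disappears, so two processes might be told apart by whether
    a datum can be received at all. Kinds of channels settle this: they record which free channels
    may still become pairs, and every substitution that respects them is defined on well-kinded
    processes. For the same reason a forwarder whose target has become a pair must count as a
    server: it is then [!b(x).0], and the outputs on [b] are erased with it.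

    The two directions of the bisimulation are unlike. Interactions with the server are answered by
    the linked process with no move. Conversely, a transition of the linked process may presuppose
    interactions that [link] has anticipated; the other process performs them first, at one head
    after the other along the path to the prefix that acts, while those below prefixes wait until
    the prefix is consumed.

    A single law covers all servers: for a forwarder it is a change of result channel, for a server
    without clients it is garbage collection, and nested eliminations compose into one
    substitution. *)

(** * Renamings of processes *)

Ltac fext :=
  let n := fresh "n" in
  extensionality n; destruct n as [|[|[|n]]]; simpl; try reflexivity.

Lemma up_comp f g : (fun n => up f (up g n)) = up (fun n => f (g n)).
Proof. fext. Qed.

Lemma up_id : up (fun n => n) = fun n => n.
Proof. fext. Qed.

Lemma dren_comp f g p : dren f (dren g p) = dren (fun n => f (g n)) p.
Proof. destruct p; reflexivity. Qed.

Lemma dren_id p : dren (fun n => n) p = p.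
Proof. destruct p; reflexivity. Qed.

Lemma pren_id P : pren (fun n => n) P = P.
Proof.
  induction P; simpl; rewrite ?up_id, ?dren_id; congruence.
Qed.

Lemma pren_comp P : forall f g, pren f (pren g P) = pren (fun n => f (g n)) P.
Proof.
  induction P; intros; simpl; rewrite ?dren_comp, ?IHP, ?IHP1, ?IHP2, ?up_comp; auto.
Qed.

(** * Substituting servers for channels *)

(** What a channel can be replaced with: a datum; [LS N], a server
    [!(nu w)(x<w>.N)] (in [N], [w] is channel 0) absorbed by the inputs on [x]; or
    [LL X], a server [!c(v,d).X] ([v], [d] are channels 0, 1 of [X]) absorbed by the
    outputs on [c]. *)
Inductive lk : Type :=
| LD (d : data)
| LS (N : proc)
| LL (X : proc).

Definition lren (f : nat -> nat) (v : lk) : lk :=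
  match v with
  | LD d => LD (dren f d)
  | LS N => LS (pren (up f) N)
  | LL X => LL (pren (up (up f)) X)
  end.

Definition lup (r : nat -> lk) : nat -> lk :=
  scons (LD (DName 0)) (fun n => lren S (r n)).

Definition pay (r : nat -> lk) (p : data) : option data :=
  match p with
  | DName a => match r a with LD d => Some d | _ => None end
  | DPair a b =>
      match r a, r b with
      | LD (DName a'), LD (DName b') => Some (DPair a' b')
      | _, _ => None
      end
  end.

(** The instance of the body of an input server. As in [link], a literal pair is resolved at once;
    only a single name leaves a [Let] behind. *)
Definition letx (p : data) (X : proc) : proc :=
  match p with
  | DName c => Let (DName c) X
  | DPair a b => pren (scons a (scons b idn)) X
  end.

(** Unlike [psubst], [link] is total and also resolves every [Let] whose argument is a
    pair: [psubst] may be undefined on a process but defined on a structurally congruent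
    one, in which such a [Let] has been resolved. *)
Fixpoint link (r : nat -> lk) (P : proc) : proc :=
  match P with
  | Nil => Nil
  | Par P Q => Par (link r P) (link r Q)
  | Repl P => Repl (link r P)
  | Nu P => Nu (link (lup r) P)
  | Inp a P =>
      match r a with
      | LD (DName b) => Inp b (link (lup r) P)
      | LS N => Nu (Par N (link (lup r) P))
      | _ => Nil
      end
  | Out a p P =>
      match r a with
      | LD (DName b) =>
          match pay r p with Some q => Out b q (link r P) | None => Nil end
      | LL X =>
          match pay r p with Some q => letx q X | None => Nil end
      | _ => Nil
      end
  | Let (DPair a b) P => link (scons (r a) (scons (r b) r)) P
  | Let (DName c) P =>
      match r c with
      | LD (DPair a b) => link (scons (LD (DName a)) (scons (LD (DName b)) r)) P
      | LD (DName b) => Let (DName b) (link (lup (lup r)) P)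
      | _ => Nil
      end
  end.

(** Where a sent datum would be undefined, [link] silently returns [Nil]; [dfd] excludes this for
    the outputs whose subject stays a name. It resolves [Let] in the same way as [link], which makes
    it invariant under structural congruence. It matters for substitutions of data, since these
    decide whether a communication exists. *)
Fixpoint dfd (r : nat -> lk) (P : proc) : Prop :=
  match P with
  | Nil => True
  | Par P Q => dfd r P /\ dfd r Q
  | Repl P => dfd r P
  | Nu P => dfd (lup r) P
  | Inp a P =>
      match r a with LD (DName _) => dfd (lup r) P | _ => True end
  | Out a p P =>
      match r a with LD (DName _) => pay r p <> None /\ dfd r P | _ => True end
  | Let (DPair a b) P => dfd (scons (r a) (scons (r b) r)) P
  | Let (DName c) P =>
      match r c with
      | LD (DPair a b) => dfd (scons (LD (DName a)) (scons (LD (DName b)) r)) P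
      | LD (DName b) => dfd (lup (lup r)) P
      | _ => True
      end
  end.

Definition lname (f : nat -> nat) (n : nat) : lk := LD (DName (f n)).

Lemma lren_comp f g v : lren f (lren g v) = lren (fun n => f (g n)) v.
Proof. destruct v; simpl; rewrite ?dren_comp, ?pren_comp, ?up_comp; auto. Qed.

Lemma lren_id v : lren (fun n => n) v = v.
Proof. destruct v; simpl; rewrite ?up_id, ?dren_id, ?pren_id; auto. Qed.

Lemma lup_pre r f : (fun n => lup r (up f n)) = lup (fun n => r (f n)).
Proof. extensionality n; destruct n; reflexivity. Qed.

Lemma lup_post r f : (fun n => lren (up f) (lup r n)) = lup (fun n => lren f (r n)).
Proof.
  extensionality n; destruct n; simpl; auto. rewrite !lren_comp. reflexivity.
Qed.

Lemma lup_lname f : lup (lname f) = lname (up f).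
Proof. extensionality n; destruct n; reflexivity. Qed.

Lemma scons_post f a r :
  (fun n => lren f (scons a r n)) = scons (lren f a) (fun n => lren f (r n)).
Proof. extensionality n; destruct n; reflexivity. Qed.

Lemma scons_up {A : Type} (a : A) r f :
  (fun n => scons a r (up f n)) = scons a (fun n => r (f n)).
Proof. extensionality n; destruct n; reflexivity. Qed.

Lemma pay_pre r f p : pay r (dren f p) = pay (fun n => r (f n)) p.
Proof. destruct p; reflexivity. Qed.

Lemma pay_post r f p :
  pay (fun n => lren f (r n)) p = option_map (dren f) (pay r p).
Proof.
  destruct p; simpl; [destruct (r a)|destruct (r a) as [[]| |], (r b) as [[]| |]]; reflexivity.
Qed.

Lemma link_pren P : forall f r, link r (pren f P) = link (fun n => r (f n)) P.
Proof.
  induction P; intros; simpl;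
    rewrite ?IHP, ?IHP1, ?IHP2, ?lup_pre, ?pay_pre; auto.
  destruct p; simpl; rewrite ?IHP, ?lup_pre, ?scons_up; auto.
  destruct (r (f a)) as [[]| |]; rewrite ?IHP, ?lup_pre, ?scons_up; auto.
Qed.

Lemma pren_letx f q X : pren f (letx q X) = letx (dren f q) (pren (up (up f)) X).
Proof.
  destruct q; simpl; auto. rewrite !pren_comp. f_equal. fext.
Qed.

Lemma pren_link P : forall f r, pren f (link r P) = link (fun n => lren f (r n)) P.
Proof.
  induction P; intros; simpl; rewrite ?pay_post.
  - auto.
  - rewrite IHP1, IHP2; auto.
  - rewrite IHP; auto.
  - rewrite IHP, lup_post; auto.
  - destruct (r a) as [[]| |]; simpl; rewrite ?IHP, ?lup_post; auto.
  - destruct (r a) as [[]| |]; simpl; auto; destruct (pay r p); simpl;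
      rewrite ?IHP, ?pren_letx; auto.
  - destruct p; simpl.
    + destruct (r a) as [[]| |]; simpl; rewrite ?IHP, ?lup_post, ?scons_post; auto.
    + rewrite ?IHP, ?scons_post; auto.
Qed.

Lemma dfd_pren P : forall f r, dfd r (pren f P) = dfd (fun n => r (f n)) P.
Proof.
  induction P; intros; simpl;
    rewrite ?IHP, ?IHP1, ?IHP2, ?lup_pre, ?pay_pre; auto.
  destruct p; simpl; rewrite ?IHP, ?lup_pre, ?scons_up; auto.
  destruct (r (f a)) as [[]| |]; rewrite ?IHP, ?lup_pre, ?scons_up; auto.
Qed.

Lemma dfd_post P : forall f r, dfd (fun n => lren f (r n)) P <-> dfd r P.
Proof.
  induction P; intros; simpl; rewrite ?pay_post, <- ?lup_post; try tauto.
  - rewrite IHP1, IHP2; tauto.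
  - auto.
  - auto.
  - destruct (r a) as [[]| |]; simpl; try tauto; auto.
  - destruct (r a) as [[]| |]; simpl; try tauto.
    rewrite IHP. destruct (pay r p); simpl; intuition congruence.
  - destruct p; simpl.
    + destruct (r a) as [[]| |]; simpl; try tauto.
      * auto.
      * rewrite <- (IHP f (scons _ (scons _ r))), !scons_post. simpl. tauto.
    + rewrite <- (IHP f (scons _ (scons _ r))), !scons_post. simpl. tauto.
Qed.

(** * Channel usage *)

(** [Any]: an input-bound channel, which may be replaced with a pair; [Nam]: a channel
    that stays a name; [Rcv], [Snd]: a name never sent, and used only as the subject of
    inputs, resp. of outputs without continuation. *)
Inductive kind : Type := Any | Nam | Rcv | Snd.

Definition plain (k : kind) : Prop := k = Any \/ k = Nam.

(** An [Any] channel could be replaced with a pair, and pairs do not nest; hence the components of a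
    pair have to be [Nam]. *)
Definition okd (V : nat -> kind) (p : data) : Prop :=
  match p with
  | DName a => plain (V a)
  | DPair a b => V a = Nam /\ V b = Nam
  end.

(** Restricted channels and components of a received pair are names, whereas a received datum may
    itself be a pair. A [Let] on a literal pair is excluded, so that [link] at names is exactly a
    renaming. *)
Fixpoint ok (V : nat -> kind) (P : proc) : Prop :=
  match P with
  | Nil => True
  | Par P Q => ok V P /\ ok V Q
  | Repl P => ok V P
  | Nu P => ok (scons Nam V) P
  | Inp a P => V a <> Snd /\ ok (scons Any V) P
  | Out a p P =>
      (plain (V a) \/ V a = Snd /\ P = Nil) /\ okd V p /\ ok V P
  | Let (DName a) P => plain (V a) /\ ok (scons Nam (scons Nam V)) P
  | Let (DPair a b) P => False
  end.

(** A [Snd] channel may become a pair: its outputs are then erased. This is the elimination of a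
    forwarder whose target has been replaced with a pair. *)
Definition okl (k : kind) (V : nat -> kind) (v : lk) : Prop :=
  match k, v with
  | Nam, LD (DName m) => V m = Nam
  | Any, LD d => okd V d
  | Rcv, LD (DName m) => V m <> Snd
  | Rcv, LS N => ok (scons Nam V) N
  | Snd, LD (DName m) => V m <> Rcv
  | Snd, LD (DPair _ _) => True
  | Snd, LL X => ok (scons Nam (scons Nam V)) X
  | _, _ => False
  end.

Definition adm (V : nat -> kind) (r : nat -> lk) (V' : nat -> kind) : Prop :=
  forall n, okl (V n) V' (r n).

(** This is [adm V (lname f) V'], unfolded. A [Rcv] or [Snd] channel may become plain, but the two
    must not be confused with one another. *)
Definition radm (V : nat -> kind) (f : nat -> nat) (V' : nat -> kind) : Prop :=
  forall n, match V n with
            | Any => plain (V' (f n))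
            | Nam => V' (f n) = Nam
            | Rcv => V' (f n) <> Snd
            | Snd => V' (f n) <> Rcv
            end.

Lemma radm_up V f V' k : radm V f V' -> radm (scons k V) (up f) (scons k V').
Proof.
  intros H [|n]; simpl; [destruct k; unfold plain; auto; discriminate|exact (H n)].
Qed.

Lemma radm_plain V f V' n : radm V f V' -> plain (V n) -> plain (V' (f n)).
Proof. intros H [E|E]; specialize (H n); rewrite E in H; unfold plain; auto. Qed.

Lemma radm_okd V f V' p : radm V f V' -> okd V p -> okd V' (dren f p).
Proof.
  intros H; destruct p; simpl; [eauto using radm_plain|].
  intros [E E']; split; [specialize (H a); rewrite E in H|specialize (H b); rewrite E' in H]; auto.
Qed.

Lemma radm_neq V f V' a : radm V f V' -> V a <> Snd -> V' (f a) <> Snd.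
Proof.
  intros H; specialize (H a); destruct (V a); unfold plain in *; intuition congruence.
Qed.

Lemma ok_pren P : forall V f V', radm V f V' -> ok V P -> ok V' (pren f P).
Proof.
  induction P; intros V f V' H; simpl; auto.
  - intuition eauto.
  - eauto.
  - eauto using radm_up.
  - intros []; split; eauto using radm_up, radm_neq.
  - intros (H1 & H2 & H3); repeat split; eauto using radm_okd.
    destruct H1 as [H1|[H1 ->]]; eauto using radm_plain.
    specialize (H a); rewrite H1 in H.
    destruct (V' (f a)); unfold plain; simpl; auto; congruence.
  - destruct p; simpl; [|tauto].
    intros []; split; eauto using radm_up, radm_plain.
Qed.

Lemma radm_S k V : radm V S (scons k V).
Proof. intros n; simpl; destruct (V n); unfold plain; auto; discriminate. Qed.

Lemma adm_lup V r V' k : adm V r V' -> adm (scons k V) (lup r) (scons k V').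
Proof.
  intros H [|n]; simpl.
  - destruct k; simpl; unfold plain; auto; congruence.
  - specialize (H n). destruct (V n), (r n) as [[]| |]; simpl in *; auto;
      (eapply ok_pren; [|eassumption]); auto using radm_up, radm_S.
Qed.

(** For an absorbed input: the datum that it would receive is the private name [w] of the server, so
    its kind improves from [Any] to [Nam]. *)
Lemma adm_any V r V' : adm V r V' -> adm (scons Any V) (lup r) (scons Nam V').
Proof.
  intros H [|n]; simpl; [unfold plain; auto|].
  exact (adm_lup V r V' Nam H (S n)).
Qed.

(** Well-kinded data mention no [Rcv] or [Snd] channel, so no server is ever transmitted; components
    of pairs stay names, so no pair gets nested. *)
Lemma adm_pay V r V' p : adm V r V' -> okd V p -> exists q, pay r p = Some q /\ okd V' q.
Proof.
  intros H; destruct p; simpl.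
  - specialize (H a). intros [E|E]; rewrite E in H; simpl in H;
      destruct (r a) as [[]| |]; simpl in *; try tauto; eexists; split; eauto; simpl;
        unfold plain; auto.
  - intros [E1 E2]. generalize (H a), (H b). rewrite E1, E2.
    destruct (r a) as [[]| |]; simpl; try tauto.
    destruct (r b) as [[]| |]; simpl; try tauto.
    intros; eexists; split; [reflexivity|]; simpl; auto.
Qed.

Lemma ok_letx V q X : okd V q -> ok (scons Nam (scons Nam V)) X -> ok V (letx q X).
Proof.
  destruct q; simpl; auto. intros [Ha Hb] H. eapply ok_pren; [|eassumption].
  intros [|[|n]]; simpl; auto. unfold idn, plain; destruct (V n); auto; discriminate.
Qed.

Lemma ok_link P : forall V r V', adm V r V' -> ok V P -> ok V' (link r P).
Proof.
  induction P; intros V r V' H; simpl; auto.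
  - intuition eauto.
  - eauto.
  - intros; eapply IHP; [apply adm_lup|]; eauto.
  - intros [H1 H2]. generalize (H a).
    destruct (r a) as [[]| |] eqn:E; simpl; auto.
    + intros H3; split.
      * destruct (V a); simpl in H3; unfold plain in H3; intuition congruence.
      * eapply IHP; [apply adm_lup|]; eauto.
    + intros H3; split.
      * destruct (V a); simpl in H3; tauto.
      * eapply IHP; [apply adm_any|]; eauto.
  - intros (H1 & H2 & H3). destruct (adm_pay V r V' p H H2) as (q & -> & Hq).
    generalize (H a). destruct (r a) as [[]| |] eqn:E; simpl; auto.
    + intros H4; repeat split; eauto.
      destruct H1 as [[H1|H1]|[H1 ->]]; rewrite H1 in H4; simpl in H4; unfold plain; auto.
      destruct (V' a0); simpl; auto; congruence.
    + intros H4. apply ok_letx; auto. destruct (V a); simpl in H4; tauto.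
  - destruct p; simpl; [|tauto]. intros [H1 H2]. generalize (H a).
    destruct (r a) as [[]| |] eqn:E; simpl; auto.
    + intros H3; split; [|eapply IHP; [do 2 apply adm_lup|]; eauto].
      destruct H1 as [H1|H1]; rewrite H1 in H3; simpl in H3; unfold plain; auto.
    + intros H3. destruct H1 as [H1|H1]; rewrite H1 in H3; simpl in H3; try tauto.
      eapply IHP; eauto. intros [|[|n]]; simpl; try tauto. apply H.
Qed.

(** Equality holds because [ok] forbids the literal pairs that [link] would resolve; in general
    there is only the congruence [link_names_scong]. *)
Lemma link_lname P : forall V f, ok V P -> link (lname f) P = pren f P.
Proof.
  induction P; intros V f; simpl; auto; rewrite ?lup_lname.
  - intros []; f_equal; eauto.
  - intros; f_equal; eauto.
  - intros; f_equal; eauto.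
  - intros []; f_equal; eauto.
  - intros (_ & _ & H). replace (pay (lname f) p) with (Some (dren f p)) by (destruct p; auto).
    f_equal; eauto.
  - destruct p; simpl; [|tauto]. intros []; f_equal; eauto.
Qed.

Lemma ok_dfd P : forall V r V', ok V P -> adm V r V' -> dfd r P.
Proof.
  induction P; intros V r V'; simpl; auto.
  - intuition eauto.
  - eauto.
  - intros; eapply IHP; eauto; apply adm_lup; eauto.
  - intros [H1 H2] H. destruct (r a) as [[]| |]; auto.
    eapply IHP; eauto; apply adm_lup; eauto.
  - intros (H1 & H2 & H3) H. destruct (r a) as [[]| |]; auto. split; eauto.
    destruct (adm_pay V r V' p H H2) as (q & -> & _); discriminate.
  - destruct p; simpl; [|tauto]. intros [H1 H2] H. generalize (H a).
    destruct (r a) as [[]| |]; simpl; auto.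
    + intros _; eapply IHP; eauto. do 2 apply adm_lup. eauto.
    + intros H3. destruct H1 as [H1|H1]; rewrite H1 in H3; simpl in H3; try tauto.
      apply (IHP _ _ V' H2). intros [|[|n]]; simpl; try tauto. apply H.
Qed.

(** * Composition of substitutions *)

(** When a component of a pair does not become a name the composite is undefined, and the unchanged
    pair is a default value; [composable] avoids this case. *)
Definition lcomp (r : nat -> lk) (v : lk) : lk :=
  match v with
  | LD (DName m) => r m
  | LD (DPair a b) =>
      match r a, r b with
      | LD (DName a'), LD (DName b') => LD (DPair a' b')
      | _, _ => LD (DPair a b)
      end
  | LS N => LS (link (lup r) N)
  | LL X => LL (link (lup (lup r)) X)
  end.

Definition isname (v : lk) : Prop := exists m, v = LD (DName m).

(** Any pair that [r1] can produce, either directly or by renaming a pair of [Nam] channels in the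
    process, must still consist of names after [r2]. *)
Definition composable (V : nat -> kind) (r1 r2 : nat -> lk) : Prop :=
  forall n,
    (V n = Nam -> exists m, r1 n = LD (DName m) /\ isname (r2 m)) /\
    (forall a b, r1 n = LD (DPair a b) -> isname (r2 a) /\ isname (r2 b)).

Lemma isname_lren v : isname v -> isname (lren S v).
Proof. intros [m ->]; eexists; reflexivity. Qed.

Lemma composable_lup V r1 r2 k :
  composable V r1 r2 -> composable (scons k V) (lup r1) (lup r2).
Proof.
  intros H [|n]; simpl; split.
  - intros _; exists 0; split; auto. exists 0; auto.
  - discriminate.
  - intros E; destruct (proj1 (H n) E) as (m & -> & H2). exists (S m); split; auto.
    simpl. auto using isname_lren.
  - intros a b E. destruct (r1 n) as [[]| |] eqn:E1; try discriminate.
    injection E; intros <- <-. destruct (proj2 (H n) _ _ E1).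
    simpl; auto using isname_lren.
Qed.

Lemma lcomp_lren r f v :
  (forall a b, v = LD (DPair a b) -> isname (r (f a)) /\ isname (r (f b))) ->
  lcomp r (lren f v) = lcomp (fun n => r (f n)) v.
Proof.
  intros H. destruct v as [[]| |]; simpl; rewrite ?link_pren, ?lup_pre; auto.
  destruct (H _ _ eq_refl) as [[x ->] [y ->]]; auto.
Qed.

Lemma lcomp_lup r1 r2 :
  (fun n => lcomp (lup r2) (lup r1 n)) = lup (fun n => lcomp r2 (r1 n)).
Proof.
  extensionality n; destruct n as [|n]; simpl; auto.
  destruct (r1 n) as [[]| |]; simpl; auto.
  - destruct (r2 a) as [[]| |], (r2 b) as [[]| |]; simpl; auto.
  - rewrite pren_link, link_pren, lup_post, lup_pre; auto.
  - rewrite pren_link, link_pren, !lup_post, !lup_pre; auto.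
Qed.

(** The second disjunct is the trace of the default value in [lcomp]: [p] is a single name that [r1]
    replaces with a pair, and [r2] destroys this pair. The inner [match] only expresses that [p] is
    a name. *)
Lemma pay_comp r1 r2 p :
  pay (fun n => lcomp r2 (r1 n)) p =
  match pay r1 p with Some q => pay r2 q | None => None end \/
  exists a b, pay r1 p = Some (DPair a b) /\ p = DName (match p with DName n => n | _ => 0 end)
              /\ ~ (isname (r2 a) /\ isname (r2 b)).
Proof.
  destruct p as [n|n n']; simpl.
  - destruct (r1 n) as [[]| |]; simpl; auto.
    assert (D : isname (r2 a) /\ isname (r2 b) \/ ~ (isname (r2 a) /\ isname (r2 b))).
    { destruct (r2 a) as [[]| |]; [|right; intros [[? ?] _]; discriminate ..].
      destruct (r2 b) as [[]| |]; [|right; intros [_ [? ?]]; discriminate ..].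
      left; split; eexists; eauto. }
    destruct D as [[[x ->] [y ->]]|D]; auto. right; eauto.
  - left. destruct (r1 n) as [[]| |], (r1 n') as [[]| |]; simpl; auto;
      try (destruct (r2 a) as [[]| |]; auto; destruct (r2 b) as [[]| |]; auto);
      destruct (r2 a0) as [[]| |]; auto;  destruct (r2 b) as [[]| |]; auto.
Qed.

Lemma link_letx r q X :
  (forall a b, q = DPair a b -> isname (r a) /\ isname (r b)) ->
  link r (letx q X) =
  match pay r q with Some q' => letx q' (link (lup (lup r)) X) | None => Nil end.
Proof.
  intros H. destruct q; simpl.
  - destruct (r a) as [[]| |]; simpl; auto.
    rewrite pren_link; f_equal. extensionality n; destruct n as [|[|n]]; simpl; auto.
    rewrite !lren_comp, lren_id; auto.
  - destruct (H _ _ eq_refl) as [[x E] [y E']]. rewrite E, E'. simpl.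
    rewrite link_pren, pren_link; f_equal. extensionality n; destruct n as [|[|n]]; simpl; auto.
    rewrite !lren_comp, lren_id; auto.
Qed.

(** The substitution lemma. It makes the elimination of a server commute with substitutions of data
    and with receptions, and it merges two nested eliminations into one. *)
Lemma link_link P : forall V r1 r2, ok V P -> composable V r1 r2 ->
  link r2 (link r1 P) = link (fun n => lcomp r2 (r1 n)) P.
Proof.
  induction P; intros V r1 r2; simpl; auto.
  - intros [Ha Hb] H; f_equal; eauto.
  - intros; f_equal; eauto.
  - intros; rewrite <- lcomp_lup; f_equal; eauto using composable_lup.
  - intros [H1 H2] H. rewrite <- lcomp_lup.
    destruct (r1 a) as [[]| |] eqn:E; simpl; auto.
    + destruct (r2 a0) as [[]| |]; auto; erewrite IHP; eauto using composable_lup.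
    + destruct (proj2 (H a) _ _ E) as [[x ->] [y ->]]; auto.
    + erewrite IHP; eauto using composable_lup.
  - intros (H1 & H2 & H3) H.
    assert (Hq : forall a b, pay r1 p = Some (DPair a b) -> isname (r2 a) /\ isname (r2 b)).
    { intros x y. destruct p as [n|n n']; simpl.
      - destruct (r1 n) as [[]| |] eqn:E; try discriminate.
        intros [= <- <-]. eapply (proj2 (H n)); eauto.
      - destruct H2 as [E1 E2].
        destruct (proj1 (H n) E1) as (m & -> & ?). destruct (proj1 (H n') E2) as (m' & -> & ?).
        intros [= <- <-]; auto. }
    destruct (pay_comp r1 r2 p) as [->|(x & y & E & _ & N)]; [|exfalso; eauto].
    destruct (r1 a) as [[]| |] eqn:E; simpl; auto.
    + destruct (pay r1 p); simpl.
      * destruct (r2 a0) as [[]| |]; auto. destruct (pay r2 d); auto. f_equal; eauto.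
      * destruct (r2 a0) as [[]| |]; auto.
    + destruct (proj2 (H a) _ _ E) as [[x ->] [y ->]]; auto.
    + destruct (pay r1 p); simpl; auto. apply link_letx. intros x y ->; auto.
  - destruct p; simpl; [|tauto]. intros [H1 H2] H.
    destruct (r1 a) as [[]| |] eqn:E; simpl; auto.
    + destruct (r2 a0) as [[]| |] eqn:E2; simpl; auto.
      * rewrite <- !lcomp_lup. f_equal; eauto using composable_lup.
      * rewrite (IHP (scons Nam (scons Nam V))); auto.
        -- f_equal. extensionality n; destruct n as [|[|n]]; simpl; auto.
           rewrite lren_comp, lcomp_lren; auto. intros; eapply (proj2 (H n)); eauto.
        -- intros [|[|n]]; simpl; split; try discriminate;
             try (intros _; eexists; split; [reflexivity|]; simpl; eexists; reflexivity).
           ++ intros E'; destruct (proj1 (H n) E') as (m & -> & ?). simpl; eauto.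
           ++ intros x y. destruct (r1 n) as [[]| |] eqn:E3; try discriminate.
              intros [= <- <-]; simpl. eapply (proj2 (H n)); eauto.
    + destruct (proj2 (H a) _ _ E) as [[x Ex] [y Ey]]. rewrite Ex, Ey.
      rewrite (IHP (scons Nam (scons Nam V))); auto.
      * f_equal. extensionality n; destruct n as [|[|n]]; simpl; auto.
      * intros [|[|n]]; simpl; split; try discriminate;
          try (intros _; eexists; split; [reflexivity|]; eexists; eassumption); apply H.
Qed.

(** * Structural congruence *)

Infix "==" := scong (at level 70).

#[export] Instance scong_equiv : Equivalence scong.
Proof. split; [exact sc_refl|exact sc_sym|exact sc_trans]. Qed.
#[export] Instance Par_scong : Proper (scong ==> scong ==> scong) Par.
Proof. repeat intro; apply sc_ctx_par; auto. Qed.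
#[export] Instance Repl_scong : Proper (scong ==> scong) Repl.
Proof. repeat intro; apply sc_ctx_repl; auto. Qed.
#[export] Instance Nu_scong : Proper (scong ==> scong) Nu.
Proof. repeat intro; apply sc_ctx_nu; auto. Qed.
#[export] Instance Inp_scong a : Proper (scong ==> scong) (Inp a).
Proof. repeat intro; apply sc_ctx_in; auto. Qed.
#[export] Instance Out_scong a p : Proper (scong ==> scong) (Out a p).
Proof. repeat intro; apply sc_ctx_out; auto. Qed.
#[export] Instance Let_scong p : Proper (scong ==> scong) (Let p).
Proof. repeat intro; apply sc_ctx_let; auto. Qed.

(** * Rearranging parallel compositions by reflection *)

Definition pars (l : list proc) : proc := fold_right Par Nil l.

Lemma pars_app l l' : pars (l ++ l') == Par (pars l) (pars l').
Proof.
  induction l; simpl.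
  - rewrite sc_par_comm, sc_par_nil; reflexivity.
  - rewrite IHl, sc_par_assoc; reflexivity.
Qed.

Lemma pars_perm l l' : Permutation l l' -> pars l == pars l'.
Proof.
  induction 1; simpl.
  - reflexivity.
  - rewrite IHPermutation; reflexivity.
  - rewrite <- !sc_par_assoc, (sc_par_comm y x); reflexivity.
  - etransitivity; eauto.
Qed.

Inductive ptree : Type := PNil | PAtom (P : proc) | PNode (s t : ptree).

Fixpoint pden (t : ptree) : proc :=
  match t with PNil => Nil | PAtom P => P | PNode s t => Par (pden s) (pden t) end.

Fixpoint pflat (t : ptree) : list proc :=
  match t with PNil => nil | PAtom P => P :: nil | PNode s t => pflat s ++ pflat t end.

Lemma pflat_correct t : pden t == pars (pflat t).
Proof.
  induction t; simpl.
  - reflexivity.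
  - rewrite sc_par_nil; reflexivity.
  - rewrite pars_app, <- IHt1, <- IHt2; reflexivity.
Qed.

Lemma ptree_perm s t : Permutation (pflat s) (pflat t) -> pden s == pden t.
Proof. intros; rewrite !pflat_correct; apply pars_perm; auto. Qed.

Ltac ptree_of P :=
  match P with
  | Nil => constr:(PNil)
  | Par ?A ?B => let a := ptree_of A in let b := ptree_of B in constr:(PNode a b)
  | _ => constr:(PAtom P)
  end.

Ltac lsplit x l k :=
  match l with
  | x :: ?l' => k (@nil proc) l'
  | ?y :: ?l' => lsplit x l' ltac:(fun a b => k (y :: a) b)
  end.

Ltac perm :=
  match goal with
  | |- Permutation nil nil => apply perm_nil
  | |- Permutation (?x :: ?l) ?m =>
      lsplit x m ltac:(fun a b => apply (Permutation_cons_app a b x)); simpl; perm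
  end.

Ltac pac :=
  match goal with
  | |- ?A == ?B =>
      let a := ptree_of A in let b := ptree_of B in
      change (pden a == pden b); apply ptree_perm; simpl; perm
  end.

Lemma swap01_swap01 n : swap01 (swap01 n) = n.
Proof. destruct n as [|[|n]]; reflexivity. Qed.

Lemma pren_swap01 P : pren swap01 (pren swap01 P) = P.
Proof.
  rewrite pren_comp.
  transitivity (pren (fun n => n) P); [f_equal|apply pren_id].
  extensionality n; apply swap01_swap01.
Qed.

Lemma nu_par_r P Q : Nu (Par P (psh Q)) == Par (Nu P) Q.
Proof. rewrite sc_par_comm, sc_nu_par, sc_par_comm; reflexivity. Qed.

Lemma scong_pren P Q : P == Q -> forall f, pren f P == pren f Q.
Proof.
  induction 1; intros; simpl.
  - apply sc_par_nil.
  - apply sc_par_comm.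
  - apply sc_par_assoc.
  - apply sc_repl.
  - apply sc_nu_nil.
  - rewrite sc_nu_nu, !pren_comp.
    match goal with |- Nu (Nu (pren ?f _)) == Nu (Nu (pren ?g _)) => replace f with g by fext end.
    reflexivity.
  - unfold psh; rewrite pren_comp. change (fun n => up f (S n)) with (fun n => S (f n)).
    rewrite <- pren_comp. apply sc_nu_par.
  - rewrite sc_let, !pren_comp.
    match goal with |- pren ?f _ == pren ?g _ => replace f with g by fext end.
    reflexivity.
  - reflexivity.
  - symmetry; auto.
  - etransitivity; eauto.
  - rewrite IHscong1, IHscong2; reflexivity.
  - rewrite IHscong; reflexivity.
  - rewrite IHscong; reflexivity.
  - rewrite IHscong; reflexivity.
  - rewrite IHscong; reflexivity.
  - rewrite IHscong; reflexivity.
Qed.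

#[export] Instance pren_scong f : Proper (scong ==> scong) (pren f).
Proof. repeat intro; apply scong_pren; auto. Qed.
#[export] Instance psh_scong : Proper (scong ==> scong) psh.
Proof. repeat intro; apply scong_pren; auto. Qed.

Lemma link_swap r P :
  link (lup (lup r)) (pren swap01 P) = pren swap01 (link (lup (lup r)) P).
Proof.
  rewrite link_pren, pren_link. f_equal.
  extensionality n; destruct n as [|[|n]]; simpl; auto.
  rewrite !lren_comp; reflexivity.
Qed.

Lemma link_psh r P : link (lup r) (psh P) = psh (link r P).
Proof. unfold psh. rewrite link_pren, pren_link. reflexivity. Qed.

Lemma scong_link P Q : P == Q -> forall r, link r P == link r Q.
Proof.
  induction 1; intros; simpl.
  - apply sc_par_nil.
  - apply sc_par_comm.
  - apply sc_par_assoc.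
  - apply sc_repl.
  - apply sc_nu_nil.
  - rewrite link_swap. apply sc_nu_nu.
  - rewrite link_psh. apply sc_nu_par.
  - rewrite link_pren.
    match goal with |- link ?f _ == link ?g _ => replace f with g; [reflexivity|] end.
    fext.
  - reflexivity.
  - symmetry; auto.
  - etransitivity; eauto.
  - rewrite IHscong1, IHscong2; reflexivity.
  - rewrite IHscong; reflexivity.
  - rewrite IHscong; reflexivity.
  - destruct (r a) as [[]| |]; rewrite ?IHscong; reflexivity.
  - destruct (r a) as [[]| |]; try reflexivity. destruct (pay r p); rewrite ?IHscong; reflexivity.
  - destruct p; [destruct (r a) as [[]| |]|]; rewrite ?IHscong; reflexivity.
Qed.

#[export] Instance link_scong r : Proper (scong ==> scong) (link r).
Proof. repeat intro; apply scong_link; auto. Qed.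

Lemma scong_dfd P Q : P == Q -> forall r, dfd r P <-> dfd r Q.
Proof.
  induction 1; intros; simpl; try tauto.
  - rewrite dfd_pren, <- (dfd_post P swap01).
    match goal with |- dfd ?f _ <-> dfd ?g _ => replace f with g; [tauto|] end.
    extensionality n; destruct n as [|[|n]]; simpl; auto.
    rewrite !lren_comp; reflexivity.
  - unfold psh; rewrite dfd_pren. simpl. rewrite (dfd_post P S). tauto.
  - rewrite dfd_pren.
    match goal with |- dfd ?f _ <-> dfd ?g _ => replace f with g; [tauto|] end.
    fext.
  - symmetry; auto.
  - etransitivity; eauto.
  - rewrite IHscong1, IHscong2; tauto.
  - auto.
  - auto.
  - destruct (r a) as [[]| |]; try tauto; auto.
  - destruct (r a) as [[]| |]; try tauto. rewrite IHscong; tauto.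
  - destruct p; [destruct (r a) as [[]| |]|]; try tauto; auto.
Qed.

(** * The partial substitution of communications compared with [link] *)

Definition lsub (s : nat -> data) (n : nat) : lk := LD (s n).

Lemma lup_lsub s : lup (lsub s) = lsub (dup s).
Proof. extensionality n; destruct n; reflexivity. Qed.

Lemma pay_lsub s p : pay (lsub s) p = dsubst s p.
Proof. destruct p; reflexivity. Qed.

(** The only discrepancy is a [Let] on a pair, which [psubst] keeps and [link] resolves. *)
Lemma psubst_link P : forall s P',
  psubst s P = Some P' -> dfd (lsub s) P /\ P' == link (lsub s) P.
Proof.
  induction P; intros s P' E; simpl in *; rewrite ?lup_lsub, ?pay_lsub.
  - injection E as <-. split; auto; reflexivity.
  - destruct (psubst s P1) eqn:E1, (psubst s P2) eqn:E2; try discriminate. injection E as <-.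
    destruct (IHP1 _ _ E1) as [? ->], (IHP2 _ _ E2) as [? ->]. split; auto; reflexivity.
  - destruct (psubst s P) eqn:E1; try discriminate. injection E as <-.
    destruct (IHP _ _ E1) as [? ->]. split; auto; reflexivity.
  - destruct (psubst (dup s) P) eqn:E1; try discriminate. injection E as <-.
    destruct (IHP _ _ E1) as [? ->]. split; auto; reflexivity.
  - change (lsub s a) with (LD (s a)) in *. destruct (s a) eqn:Ea; [|injection E as <-; split;
      auto; reflexivity].
    destruct (psubst (dup s) P) eqn:E1; try discriminate. injection E as <-.
    destruct (IHP _ _ E1) as [? ->]. split; auto; reflexivity.
  - change (lsub s a) with (LD (s a)) in *. destruct (s a) eqn:Ea; [|injection E as <-; split;
      auto; reflexivity].
    destruct (dsubst s p), (psubst s P) eqn:E1; try discriminate. injection E as <-.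
    destruct (IHP _ _ E1) as [? ->]. repeat split; auto; try discriminate; reflexivity.
  - destruct (dsubst s p) as [q|] eqn:E0; try discriminate.
    destruct (psubst (dup (dup s)) P) eqn:E1; try discriminate. injection E as <-.
    destruct (IHP _ _ E1) as [H1 H2].
    assert (G : forall a b, q = DPair a b ->
      dfd (scons (LD (DName a)) (scons (LD (DName b)) (lsub s))) P /\
      Let q p0 == link (scons (LD (DName a)) (scons (LD (DName b)) (lsub s))) P).
    { intros a b ->.
      replace (scons (LD (DName a)) (scons (LD (DName b)) (lsub s)))
        with (fun n => lren (scons a (scons b idn)) (lsub (dup (dup s)) n)).
      - rewrite dfd_post, sc_let, H2, pren_link. split; auto; reflexivity.
      - extensionality n; destruct n as [|[|n]]; simpl; auto.
        unfold lsub; simpl. rewrite !dren_comp, dren_id; auto. }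
    destruct p; simpl in E0; try injection E0 as <-.
    + change (lsub s a) with (LD (s a)) in *. destruct (s a); [rewrite ?lup_lsub, H2; split;
        auto; reflexivity|auto].
    + change (lsub s a) with (LD (s a)) in *; change (lsub s b) with (LD (s b)) in *.
      destruct (s a), (s b); try discriminate. injection E0 as <-; auto.
Qed.

(** [psubst] can fail on a process whose [link] is harmless, but then it succeeds on a congruent
    [P1] in which every literal [Let] is resolved. The renaming [f] accumulates the instantiations
    due to the [Let] constructs removed so far. *)
Lemma link_psubst P : forall f s,
  dfd (fun n => lsub s (f n)) P ->
  exists P1 P', pren f P == P1 /\ psubst s P1 = Some P' /\
                P' == link (fun n => lsub s (f n)) P.
Proof.
  induction P; intros f s H; simpl in *.
  - exists Nil, Nil; repeat split; reflexivity.
  - destruct H as [Ha Hb].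
    destruct (IHP1 _ _ Ha) as (A & A' & HA & EA & HA'), (IHP2 _ _ Hb) as (B & B' & HB & EB & HB').
    exists (Par A B), (Par A' B'); simpl; rewrite EA, EB; repeat split;
      rewrite ?HA, ?HB, ?HA', ?HB'; reflexivity.
  - destruct (IHP _ _ H) as (A & A' & HA & EA & HA').
    exists (Repl A), (Repl A'); simpl; rewrite EA; repeat split; rewrite ?HA, ?HA'; reflexivity.
  - rewrite <- lup_pre, lup_lsub in *. destruct (IHP _ _ H) as (A & A' & HA & EA & HA').
    exists (Nu A), (Nu A'); simpl; rewrite EA; repeat split; rewrite ?HA, ?HA'; reflexivity.
  - rewrite <- lup_pre, lup_lsub in *. change (lsub s (f a)) with (LD (s (f a))) in *.
    destruct (s (f a)) eqn:Ea.
    + destruct (IHP _ _ H) as (A & A' & HA & EA & HA').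
      exists (Inp (f a) A), (Inp a0 A'); simpl; rewrite Ea, EA; repeat split; rewrite ?HA, ?HA';
        reflexivity.
    + exists (Inp (f a) (pren (up f) P)), Nil; simpl; rewrite Ea; repeat split; reflexivity.
  - change (lsub s (f a)) with (LD (s (f a))) in *. rewrite <- (pay_pre (lsub s)), pay_lsub in *.
    destruct (s (f a)) eqn:Ea.
    + destruct H as [H0 H]. destruct (IHP _ _ H) as (A & A' & HA & EA & HA').
      destruct (dsubst s (dren f p)) as [q|] eqn:Eq; [|congruence].
      exists (Out (f a) (dren f p) A), (Out a0 q A'); simpl; rewrite Ea, Eq, EA; repeat split;
        rewrite ?HA, ?HA'; reflexivity.
    + exists (Out (f a) (dren f p) (pren f P)), Nil; simpl; rewrite Ea; repeat split; reflexivity.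
  - destruct p; simpl in *.
    + rewrite <- (lup_pre (lsub s) f), <- (lup_pre (lup (lsub s))), !lup_lsub in *.
      change (lsub s (f a)) with (LD (s (f a))) in *.
      destruct (s (f a)) eqn:Ea.
      * destruct (IHP _ _ H) as (A & A' & HA & EA & HA').
        exists (Let (DName (f a)) A), (Let (DName a0) A'); simpl; rewrite Ea, EA; repeat split;
          rewrite ?HA, ?HA'; reflexivity.
      * assert (E : scons (LD (DName a0)) (scons (LD (DName b)) (fun n => lsub s (f n)))
          = fun n => lren (scons a0 (scons b idn)) (lsub (dup (dup s)) (up (up f) n))).
        { extensionality n; destruct n as [|[|n]]; simpl; auto.
          unfold lsub; simpl. rewrite !dren_comp, dren_id; auto. }
        rewrite E in *. rewrite dfd_post in H.
        destruct (IHP _ _ H) as (A & A' & HA & EA & HA').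
        exists (Let (DName (f a)) A), (Let (DPair a0 b) A'); simpl; rewrite Ea, EA.
        repeat split; [rewrite HA; reflexivity|]. rewrite sc_let, HA', pren_link; reflexivity.
    + assert (E : scons (lsub s (f a)) (scons (lsub s (f b)) (fun n => lsub s (f n)))
          = fun n => lsub s (scons (f a) (scons (f b) f) n)) by fext.
      rewrite E in *. destruct (IHP _ _ H) as (A & A' & HA & EA & HA').
      exists A, A'; repeat split; auto. rewrite sc_let, pren_comp, <- HA.
      match goal with |- pren ?f _ == pren ?g _ => replace f with g; [reflexivity|] end. fext.
Qed.

Definition nus (k : nat) (P : proc) : proc := Nat.iter k Nu P.

#[export] Instance nus_scong k : Proper (scong ==> scong) (nus k).
Proof. intros P Q H. induction k; simpl; auto. unfold nus in *; simpl. rewrite IHk; reflexivity.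
Qed.

Lemma nus_S k P : nus (S k) P = Nu (nus k P).
Proof. reflexivity. Qed.

Lemma nus_par k P Q : nus k (Par P (pren (Nat.add k) Q)) == Par (nus k P) Q.
Proof.
  revert Q; induction k; intros Q.
  - change (pren (Nat.add 0) Q) with (pren (fun n => n) Q). rewrite pren_id. reflexivity.
  - rewrite !nus_S, <- nu_par_r, <- IHk.
    unfold psh; rewrite pren_comp.
    replace (fun n => k + S n) with (Nat.add (S k)) by (extensionality n; simpl; lia).
    reflexivity.
Qed.

(** * Labelled transitions *)

Definition rcv (p : data) : nat -> lk := scons (LD p) (lname idn).

(** [P] becomes the abstraction [F] by an input on [a]: the datum is channel 0 of [F]. *)
Inductive inp : proc -> nat -> proc -> Prop :=
| inp_in a P : inp (Inp a P) a P
| inp_parl P Q a F : inp P a F -> inp (Par P Q) a (Par F (psh Q))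
| inp_parr P Q a F : inp Q a F -> inp (Par P Q) a (Par (psh P) F)
| inp_nu P a F : inp P (S a) F -> inp (Nu P) a (Nu (pren swap01 F))
| inp_repl P a F : inp P a F -> inp (Repl P) a (Par F (psh (Repl P)))
| inp_let a b P c F :
    inp (pren (scons a (scons b idn)) P) c F -> inp (Let (DPair a b) P) c F.

(** [P] outputs on [a] to the abstraction [F], which yields [R].  Having the receiver in
    the judgement avoids manipulating bound outputs. *)
Inductive outs : proc -> nat -> proc -> proc -> Prop :=
| outs_out a p P F : dfd (rcv p) F -> outs (Out a p P) a F (Par P (link (rcv p) F))
| outs_parl P Q a F R : outs P a F R -> outs (Par P Q) a F (Par R Q)
| outs_parr P Q a F R : outs Q a F R -> outs (Par P Q) a F (Par P R)
| outs_nu P a F R : outs P (S a) (pren (up S) F) R -> outs (Nu P) a F (Nu R)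
| outs_repl P a F R : outs P a F R -> outs (Repl P) a F (Par R (Repl P))
| outs_let a b P c F R :
    outs (pren (scons a (scons b idn)) P) c F R -> outs (Let (DPair a b) P) c F R.

Inductive tau : proc -> proc -> Prop :=
| tau_io P Q a F R : inp P a F -> outs Q a F R -> tau (Par P Q) R
| tau_oi P Q a F R : outs P a F R -> inp Q a F -> tau (Par P Q) R
| tau_parl P Q R : tau P R -> tau (Par P Q) (Par R Q)
| tau_parr P Q R : tau Q R -> tau (Par P Q) (Par P R)
| tau_nu P R : tau P R -> tau (Nu P) (Nu R)
| tau_repl P R : tau P R -> tau (Repl P) (Par R (Repl P))
| tau_repl_io P a F R : inp P a F -> outs P a F R -> tau (Repl P) (Par R (Repl P))
| tau_let a b P R :
    tau (pren (scons a (scons b idn)) P) R -> tau (Let (DPair a b) P) R.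

Lemma rcv_pren f p F : link (rcv (dren f p)) (pren (up f) F) = pren f (link (rcv p) F).
Proof. rewrite link_pren, pren_link; f_equal. fext. Qed.

Lemma dfd_rcv_pren f p F : dfd (rcv (dren f p)) (pren (up f) F) <-> dfd (rcv p) F.
Proof.
  rewrite dfd_pren, <- (dfd_post F f (rcv p)).
  replace (fun n => rcv (dren f p) (up f n)) with (fun n => lren f (rcv p n)); [tauto|fext].
Qed.

Lemma link_names_scong P : forall f, link (lname f) P == pren f P.
Proof.
  induction P; intros f; simpl; rewrite ?lup_lname.
  - reflexivity.
  - rewrite IHP1, IHP2; reflexivity.
  - rewrite IHP; reflexivity.
  - rewrite IHP; reflexivity.
  - rewrite IHP; reflexivity.
  - replace (pay (lname f) p) with (Some (dren f p)) by (destruct p; auto).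
    rewrite IHP; reflexivity.
  - destruct p; simpl; [rewrite IHP; reflexivity|].
    change (lname f a) with (LD (DName (f a))). change (lname f b) with (LD (DName (f b))).
    replace (scons (LD (DName (f a))) (scons (LD (DName (f b))) (lname f)))
      with (lname (scons (f a) (scons (f b) f))) by fext.
    rewrite IHP, sc_let, pren_comp.
    match goal with |- pren ?f _ == pren ?g _ => replace f with g; [reflexivity|] end. fext.
Qed.

Lemma dfd_names P : forall f, dfd (lname f) P.
Proof.
  induction P; intros f; simpl; rewrite ?lup_lname; auto.
  - split; auto. destruct p; discriminate.
  - destruct p; simpl; auto.
    change (lname f a) with (LD (DName (f a))). change (lname f b) with (LD (DName (f b))).
    replace (scons (LD (DName (f a))) (scons (LD (DName (f b))) (lname f)))
      with (lname (scons (f a) (scons (f b) f))) by fext. auto.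
Qed.

Lemma rcv_psh p P : link (rcv p) (psh P) == P.
Proof.
  unfold psh; rewrite link_pren. change (fun n => rcv p (S n)) with (lname (fun n => n)).
  rewrite link_names_scong, pren_id. reflexivity.
Qed.

Lemma dfd_rcv_psh p P : dfd (rcv p) (psh P).
Proof.
  unfold psh; rewrite dfd_pren. change (fun n => rcv p (S n)) with (lname (fun n => n)).
  apply dfd_names.
Qed.

(** ** Transitions and renaming *)

Lemma pren_inst f a b P :
  pren f (pren (scons a (scons b idn)) P) =
  pren (scons (f a) (scons (f b) idn)) (pren (up (up f)) P).
Proof. rewrite !pren_comp; f_equal; fext. Qed.

Lemma pren_psh f P : pren (up f) (psh P) = psh (pren f P).
Proof. unfold psh; rewrite !pren_comp; reflexivity. Qed.

Lemma pren_nu_swap f F :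
  pren (up f) (Nu (pren swap01 F)) = Nu (pren swap01 (pren (up (up f)) F)).
Proof. simpl; rewrite !pren_comp; do 2 f_equal; fext. Qed.

Lemma inp_pren f P a F : inp P a F -> inp (pren f P) (f a) (pren (up f) F).
Proof.
  intros H; revert f; induction H; intros f; simpl pren; rewrite ?pren_psh.
  - constructor.
  - constructor; auto.
  - constructor; auto.
  - change (Nu (pren (up (up f)) (pren swap01 F))) with (pren (up f) (Nu (pren swap01 F))).
    rewrite pren_nu_swap. constructor. apply (IHinp (up f)).
  - apply inp_repl; auto.
  - constructor. rewrite <- pren_inst; auto.
Qed.

Lemma outs_pren f P a F R : outs P a F R ->
  outs (pren f P) (f a) (pren (up f) F) (pren f R).
Proof.
  intros H; revert f; induction H; intros f; simpl pren; try (constructor; auto; fail).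
  - rewrite <- rcv_pren. constructor. apply dfd_rcv_pren; auto.
  - constructor. specialize (IHouts (up f)). rewrite pren_comp in *.
    replace (fun n => up S (up f n)) with (fun n => up (up f) (up S n)) by fext. exact IHouts.
  - constructor. rewrite <- pren_inst; auto.
Qed.

Lemma tau_pren f P R : tau P R -> tau (pren f P) (pren f R).
Proof.
  intros H; revert f; induction H; intros f; simpl pren; try (econstructor;
    eauto using inp_pren, outs_pren; fail).
  constructor. rewrite <- pren_inst; auto.
Qed.

Ltac inv H := inversion H; subst; clear H.

Lemma inp_pren_inv X b G : inp X b G -> forall f P, X = pren f P ->
  exists a F, b = f a /\ G = pren (up f) F /\ inp P a F.
Proof.
  induction 1; intros f P0 E; destruct P0; simpl in E; inv E.
  - eexists _, _; repeat split; constructor.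
  - destruct (IHinp _ _ eq_refl) as (c & F' & -> & -> & H').
    exists c, (Par F' (psh P0_2)); simpl; rewrite pren_psh; repeat split; constructor; auto.
  - destruct (IHinp _ _ eq_refl) as (c & F' & -> & -> & H').
    exists c, (Par (psh P0_1) F'); simpl; rewrite pren_psh; repeat split; constructor; auto.
  - destruct (IHinp _ _ eq_refl) as (c & F' & E & -> & H').
    destruct c as [|c]; [discriminate|]. injection E as ->.
    exists c, (Nu (pren swap01 F')); rewrite pren_nu_swap; repeat split; constructor; auto.
  - destruct (IHinp _ _ eq_refl) as (c & F' & -> & -> & H').
    exists c, (Par F' (psh (Repl P0))); simpl; rewrite pren_psh; repeat split; constructor; auto.
  - destruct p; simpl in *; inv H1. rewrite <- pren_inst in *.
    destruct (IHinp _ _ eq_refl) as (d & F' & -> & -> & H').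
    eexists _, _; repeat split; constructor; auto.
Qed.

Lemma inp_psh_inv P b G : inp (psh P) b G ->
  exists a F, b = S a /\ G = pren (up S) F /\ inp P a F.
Proof. intros H; eapply inp_pren_inv; eauto. Qed.

(** Injectivity is essential here and for [tau]: identifying two channels may connect a sender with
    a receiver that it could not reach before. *)
Lemma outs_pren_inv X b G R : outs X b G R ->
  forall f P a F, (forall m n, f m = f n -> m = n) ->
  X = pren f P -> b = f a -> G = pren (up f) F -> exists R', R = pren f R' /\ outs P a F R'.
Proof.
  assert (inj_up : forall f : nat -> nat, (forall m n, f m = f n -> m = n) ->
                   forall m n, up f m = up f n -> m = n).
  { intros f H [|m] [|n]; simpl; auto; discriminate. }
  induction 1; intros f P0 a0 F0 Hf E Eb EG; destruct P0; simpl in E; inv E.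
  - match goal with H : f _ = f _ |- _ => apply Hf in H; subst end.
    rewrite rcv_pren. exists (Par P0 (link (rcv p0) F0)).
    split; auto. constructor. apply (dfd_rcv_pren f); auto.
  - destruct (IHouts _ _ _ _ Hf eq_refl eq_refl eq_refl) as (R' & -> & ?).
    eexists (Par _ _); split; [reflexivity|constructor; auto].
  - destruct (IHouts _ _ _ _ Hf eq_refl eq_refl eq_refl) as (R' & -> & ?).
    eexists (Par _ _); split; [reflexivity|constructor; auto].
  - destruct (IHouts (up f) P0 (S a0) (pren (up S) F0)) as (R' & -> & ?).
    + apply inj_up; auto.
    + reflexivity.
    + reflexivity.
    + rewrite !pren_comp; f_equal; fext.
    + eexists (Nu _); split; [reflexivity|constructor; auto].
  - destruct (IHouts _ _ _ _ Hf eq_refl eq_refl eq_refl) as (R' & -> & ?).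
    eexists (Par _ (Repl _)); split; [reflexivity|constructor; auto].
  - destruct p; simpl in *; inv H1. rewrite <- pren_inst in *.
    destruct (IHouts _ _ _ _ Hf eq_refl eq_refl eq_refl) as (R' & -> & ?).
    eexists; split; [reflexivity|constructor; auto].
Qed.

Lemma tau_pren_inv X R : tau X R -> forall f P, (forall m n, f m = f n -> m = n) ->
  X = pren f P -> exists R', R = pren f R' /\ tau P R'.
Proof.
  assert (inj_up : forall f : nat -> nat, (forall m n, f m = f n -> m = n) ->
                   forall m n, up f m = up f n -> m = n).
  { intros f H [|m] [|n]; simpl; auto; discriminate. }
  induction 1; intros f P0 Hf E; destruct P0; simpl in E; inv E.
  - destruct (inp_pren_inv _ _ _ H f _ eq_refl) as (c & F' & -> & -> & H').
    destruct (outs_pren_inv _ _ _ _ H0 f _ _ _ Hf eq_refl eq_refl eq_refl) as (R' & -> & ?).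
    eexists; split; [reflexivity|eapply tau_io; eauto].
  - destruct (inp_pren_inv _ _ _ H0 f _ eq_refl) as (c & F' & -> & -> & H').
    destruct (outs_pren_inv _ _ _ _ H f _ _ _ Hf eq_refl eq_refl eq_refl) as (R' & -> & ?).
    eexists; split; [reflexivity|eapply tau_oi; eauto].
  - destruct (IHtau _ _ Hf eq_refl) as (R' & -> & ?).
    eexists (Par _ _); split; [reflexivity|constructor; auto].
  - destruct (IHtau _ _ Hf eq_refl) as (R' & -> & ?).
    eexists (Par _ _); split; [reflexivity|constructor; auto].
  - destruct (IHtau _ _ (inj_up _ Hf) eq_refl) as (R' & -> & ?).
    eexists (Nu _); split; [reflexivity|constructor; auto].
  - destruct (IHtau _ _ Hf eq_refl) as (R' & -> & ?).
    eexists (Par _ (Repl _)); split; [reflexivity|constructor; auto].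
  - destruct (inp_pren_inv _ _ _ H f _ eq_refl) as (c & F' & -> & -> & H').
    destruct (outs_pren_inv _ _ _ _ H0 f _ _ _ Hf eq_refl eq_refl eq_refl) as (R' & -> & ?).
    eexists (Par _ (Repl _)); split; [reflexivity|eapply tau_repl_io; eauto].
  - destruct p; simpl in *; inv H1. rewrite <- pren_inst in *.
    destruct (IHtau _ _ Hf eq_refl) as (R' & -> & ?).
    eexists; split; [reflexivity|constructor; auto].
Qed.

(** ** Outputs and the receiving context *)

Lemma outs_scong P a F R : outs P a F R ->
  forall F', F == F' -> exists R', outs P a F' R' /\ R == R'.
Proof.
  induction 1; intros F' E.
  - exists (Par P (link (rcv p) F')); split; [|rewrite E; reflexivity].
    constructor. eapply scong_dfd; [symmetry|]; eauto.
  - destruct (IHouts _ E) as (R' & H' & E'). eexists; split; [constructor; eauto|].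
    rewrite E'; reflexivity.
  - destruct (IHouts _ E) as (R' & H' & E'). eexists; split; [apply outs_parr; eauto|].
    rewrite E'; reflexivity.
  - destruct (IHouts (pren (up S) F')) as (R' & H' & E'); [rewrite E; reflexivity|].
    eexists; split; [constructor; eauto|]. rewrite E'; reflexivity.
  - destruct (IHouts _ E) as (R' & H' & E'). eexists; split; [constructor; eauto|].
    rewrite E'; reflexivity.
  - destruct (IHouts _ E) as (R' & H' & E'). eexists; split; [constructor; eauto|]; auto.
Qed.

(** A process beside the receiver is left alone by the communication. Associativity of parallel
    composition relies on this, since [inp_parl] and [inp_parr] put the neighbours of an input into
    its abstraction. *)
Lemma outs_frame P a F R : outs P a F R ->
  forall Q, exists R', outs P a (Par F (psh Q)) R' /\ R' == Par R Q.
Proof.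
  induction 1; intros Q0.
  - eexists; split; [constructor; simpl; split; auto; apply dfd_rcv_psh|].
    simpl; rewrite rcv_psh. pac.
  - destruct (IHouts Q0) as (R' & H' & E'). eexists; split; [constructor; eauto|].
    rewrite E'; pac.
  - destruct (IHouts Q0) as (R' & H' & E'). eexists; split; [apply outs_parr; eauto|].
    rewrite E'; pac.
  - destruct (IHouts (psh Q0)) as (R' & H' & E').
    exists (Nu R'); split; [constructor; simpl; rewrite pren_psh; auto|].
    rewrite E', nu_par_r; reflexivity.
  - destruct (IHouts Q0) as (R' & H' & E'). eexists; split; [constructor; eauto|].
    rewrite E'; pac.
  - destruct (IHouts Q0) as (R' & H' & E'). eexists; split; [constructor; eauto|]; auto.
Qed.

Lemma outs_unframe P a G R : outs P a G R ->
  forall F Q, G = Par F (psh Q) -> exists R', outs P a F R' /\ R == Par R' Q.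
Proof.
  induction 1; intros F0 Q0 E.
  - subst. destruct H. eexists; split; [constructor; auto|].
    simpl; rewrite rcv_psh. pac.
  - destruct (IHouts _ _ E) as (R' & H' & E'). eexists; split; [constructor; eauto|].
    rewrite E'; pac.
  - destruct (IHouts _ _ E) as (R' & H' & E'). eexists; split; [apply outs_parr; eauto|].
    rewrite E'; pac.
  - destruct (IHouts (pren (up S) F0) (psh Q0)) as (R' & H' & E').
    { rewrite E; simpl; rewrite pren_psh; auto. }
    exists (Nu R'); split; [constructor; auto|].
    rewrite E', nu_par_r; reflexivity.
  - destruct (IHouts _ _ E) as (R' & H' & E'). eexists; split; [constructor; eauto|].
    rewrite E'; pac.
  - destruct (IHouts _ _ E) as (R' & H' & E'). eexists; split; [constructor; eauto|]; auto.
Qed.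

Lemma rcv_nu_swap p F :
  link (rcv p) (Nu (pren swap01 F)) = Nu (link (rcv (dren S p)) F) /\
  (dfd (rcv p) (Nu (pren swap01 F)) <-> dfd (rcv (dren S p)) F).
Proof.
  assert (E : (fun n => lup (rcv p) (swap01 n)) = rcv (dren S p)) by fext.
  simpl. rewrite link_pren, dfd_pren, E. tauto.
Qed.

Lemma nu_nu_swap R : Nu (Nu (pren swap01 R)) == Nu (Nu R).
Proof. symmetry; apply sc_nu_nu. Qed.

(** Scope extrusion on the side of the receiver: the restriction that [inp_nu] leaves above an
    abstraction (hence [swap01]) moves out over the sender, which is shifted. *)
Lemma outs_nu_abs P a G R : outs P a G R ->
  forall F, G = Nu (pren swap01 F) -> exists R', outs (psh P) (S a) F R' /\ R == Nu R'.
Proof.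
  induction 1; intros F0 E.
  - subst. destruct (rcv_nu_swap p F0) as [E1 E2]. rewrite E1.
    eexists; split; [constructor; apply E2; auto|].
    change (pren S P) with (psh P). rewrite sc_nu_par; reflexivity.
  - destruct (IHouts _ E) as (R' & H' & E'). eexists; split; [apply outs_parl; eauto|].
    rewrite E'. change (pren S Q) with (psh Q). rewrite nu_par_r; reflexivity.
  - destruct (IHouts _ E) as (R' & H' & E'). eexists; split; [apply outs_parr; eauto|].
    rewrite E'. change (pren S P) with (psh P). rewrite sc_nu_par; reflexivity.
  - subst. rewrite pren_nu_swap in *.
    destruct (IHouts _ eq_refl) as (R' & H' & E').
    apply (outs_pren swap01) in H'.
    exists (Nu (pren swap01 R')); split; [|rewrite E', nu_nu_swap; reflexivity].
    unfold psh in H'. rewrite !pren_comp in H'.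
    change (psh (Nu P)) with (Nu (pren (up S) P)). constructor.
    replace (pren (up S) P) with (pren (fun n => swap01 (S n)) P) by (f_equal; fext).
    replace (pren (up S) F0) with (pren (fun n => up swap01 (up (up S) n)) F0) by (f_equal; fext).
    exact H'.
  - destruct (IHouts _ E) as (R' & H' & E'). exists (Par R' (psh (Repl P))).
    split; [apply (outs_repl (psh P)); auto|].
    rewrite E', nu_par_r; reflexivity.
  - destruct (IHouts _ E) as (R' & H' & E'). eexists; split; [|eauto].
    constructor. unfold psh in H'; rewrite pren_inst in H'. exact H'.
Qed.

(** The converse is generalized over a permutation [g] that moves the restricted channel
    below the binders that are crossed. *)
Lemma outs_abs_nu_gen X b F R : outs X b F R ->
  forall P g g', (forall n, g (g' n) = n) -> (forall n, g' (g n) = n) ->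
  X = pren g (psh P) ->
  exists a R', b = g (S a) /\ outs P a (Nu (pren swap01 (pren (up g') F))) R' /\
               R' == Nu (pren g' R).
Proof.
  induction 1; intros P0 g g' Hg Hg' E; destruct P0; simpl in E; inv E.
  - unfold psh in *. eexists _, _; split; [reflexivity|].
    destruct (rcv_nu_swap p0 (pren (up g') F)) as [E1 E2].
    assert (E3 : dren S p0 = dren g' (dren g (dren S p0))).
    { rewrite !dren_comp. f_equal. extensionality n. rewrite Hg'; auto. }
    rewrite E3, rcv_pren in E1. rewrite E3, dfd_rcv_pren in E2.
    split; [constructor; apply E2; auto|].
    simpl pren. rewrite E1.
    replace (pren g' (pren g (pren S P0))) with (psh P0).
    + symmetry; apply sc_nu_par.
    + unfold psh; rewrite !pren_comp; f_equal. extensionality n; rewrite Hg'; auto.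
  - destruct (IHouts _ _ _ Hg Hg' eq_refl) as (c & R' & -> & H' & E').
    eexists _, _; repeat split; [constructor; eauto|]. rewrite E'; simpl.
    replace (pren g' (pren g (pren S P0_2))) with (psh P0_2).
    + symmetry; apply nu_par_r.
    + unfold psh; rewrite !pren_comp; f_equal. extensionality n; rewrite Hg'; auto.
  - destruct (IHouts _ _ _ Hg Hg' eq_refl) as (c & R' & -> & H' & E').
    eexists _, _; repeat split; [apply outs_parr; eauto|]. rewrite E'; simpl.
    replace (pren g' (pren g (pren S P0_1))) with (psh P0_1).
    + symmetry; apply sc_nu_par.
    + unfold psh; rewrite !pren_comp; f_equal. extensionality n; rewrite Hg'; auto.
  - destruct (IHouts P0 (fun n => up g (swap01 n)) (fun n => swap01 (up g' n)))
      as (c & R' & E & H' & E').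
    + intros [|n]; simpl; auto. destruct (g' n) eqn:E; simpl; rewrite <- E, Hg; auto.
    + intros [|[|n]]; simpl; auto; rewrite Hg'; auto.
    + unfold psh; rewrite !pren_comp; f_equal; fext.
    + destruct c as [|c]; [discriminate|]. simpl in E. injection E as ->.
      eexists c, (Nu R'); repeat split.
      * constructor.
        replace (pren (up S) (Nu (pren swap01 (pren (up g') F))))
          with (Nu (pren swap01 (pren (up (fun n => swap01 (up g' n))) (pren (up S) F)))); auto.
        simpl; rewrite !pren_comp; do 2 f_equal.
        extensionality n; destruct n as [|n]; simpl; auto. destruct (g' n) as [|[|k]]; auto.
      * rewrite E', <- pren_comp, nu_nu_swap. reflexivity.
  - destruct (IHouts _ _ _ Hg Hg' eq_refl) as (c & R' & -> & H' & E').
    eexists _, _; repeat split; [constructor; eauto|]. rewrite E'; simpl.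
    replace (pren g' (pren g (pren S P0))) with (psh P0).
    + change (Repl (psh P0)) with (psh (Repl P0)). symmetry; apply nu_par_r.
    + unfold psh; rewrite !pren_comp; f_equal. extensionality n; rewrite Hg'; auto.
  - destruct p; simpl in *; inv H1.
    destruct (IHouts (pren (scons a0 (scons b0 idn)) P0) g g' Hg Hg') as (c' & R' & -> & H' & E').
    { unfold psh; rewrite !pren_inst; auto. }
    eexists _, _; repeat split; [constructor; eauto|]; auto.
Qed.

Lemma outs_abs_nu P b F R : outs (psh P) b F R ->
  exists a R', b = S a /\ outs P a (Nu (pren swap01 F)) R' /\ R' == Nu R.
Proof.
  intros H. destruct (outs_abs_nu_gen _ _ _ _ H P (fun n => n) (fun n => n))
    as (a & R' & E & H' & E'); auto.
  - rewrite pren_id; auto.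
  - rewrite up_id, !pren_id in *. eauto.
Qed.

(** ** Structural congruence is a strong bisimulation *)

Definition sim (P Q : proc) : Prop :=
  (forall a F, inp P a F -> exists F', inp Q a F' /\ F == F') /\
  (forall a F R, outs P a F R -> exists R', outs Q a F R' /\ R == R') /\
  (forall R, tau P R -> exists R', tau Q R' /\ R == R').

Ltac inve :=
  match goal with
  | H : inp (Par _ _) _ _ |- _ => inv H
  | H : inp (Repl _) _ _ |- _ => inv H
  | H : inp (Nu _) _ _ |- _ => inv H
  | H : inp Nil _ _ |- _ => inv H
  | H : outs (Par _ _) _ _ _ |- _ => inv H
  | H : outs (Repl _) _ _ _ |- _ => inv H
  | H : outs (Nu _) _ _ _ |- _ => inv H
  | H : outs Nil _ _ _ |- _ => inv H
  | H : tau (Par _ _) _ |- _ => inv H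
  | H : tau (Repl _) _ |- _ => inv H
  | H : tau (Nu _) _ |- _ => inv H
  | H : tau Nil _ |- _ => inv H
  end.

Lemma sim_refl P : sim P P.
Proof. repeat split; intros; eexists; split; eauto; reflexivity. Qed.

Lemma sim_trans P Q R : sim P Q -> sim Q R -> sim P R.
Proof.
  intros (A1 & A2 & A3) (B1 & B2 & B3); repeat split.
  - intros a F H. destruct (A1 _ _ H) as (F' & H' & E). destruct (B1 _ _ H') as (F2 & H2 & E2).
    exists F2; split; auto. etransitivity; eauto.
  - intros a F X H. destruct (A2 _ _ _ H) as (F' & H' & E).
    destruct (B2 _ _ _ H') as (F2 & H2 & E2).
    exists F2; split; auto. etransitivity; eauto.
  - intros X H. destruct (A3 _ H) as (F' & H' & E). destruct (B3 _ H') as (F2 & H2 & E2).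
    exists F2; split; auto. etransitivity; eauto.
Qed.

Lemma psh_par P Q : psh (Par P Q) = Par (psh P) (psh Q).
Proof. reflexivity. Qed.

Lemma psh_repl P : psh (Repl P) = Repl (psh P).
Proof. reflexivity. Qed.

Lemma outs_unframe_l P a F Q R : outs P a (Par (psh Q) F) R ->
  exists R', outs P a F R' /\ R == Par R' Q.
Proof.
  intros H. destruct (outs_scong _ _ _ _ H (Par F (psh Q))) as (R1 & H1 & E1); [pac|].
  destruct (outs_unframe _ _ _ _ H1 _ _ eq_refl) as (R' & H' & E').
  exists R'; split; auto. rewrite E1; auto.
Qed.

Lemma outs_frame_l Q P a F R : outs P a F R ->
  exists R', outs P a (Par (psh Q) F) R' /\ R' == Par R Q.
Proof.
  intros H. destruct (outs_frame _ _ _ _ H Q) as (R1 & H1 & E1).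
  destruct (outs_scong _ _ _ _ H1 (Par (psh Q) F)) as (R' & H' & E'); [pac|].
  exists R'; split; auto. rewrite <- E'; auto.
Qed.

Lemma outs_unframe_r P a F Q R : outs P a (Par F (psh Q)) R ->
  exists R', outs P a F R' /\ R == Par R' Q.
Proof. intros H; eapply outs_unframe; eauto. Qed.

Lemma outs_nu_abs_r P a F R : outs P a (Nu (pren swap01 F)) R ->
  exists R', outs (psh P) (S a) F R' /\ R == Nu R'.
Proof. intros H; eapply outs_nu_abs; eauto. Qed.

Lemma outs_frame_r Q P a F R : outs P a F R ->
  exists R', outs P a (Par F (psh Q)) R' /\ R' == Par R Q.
Proof. intros H; eapply outs_frame; eauto. Qed.

Lemma S_inj m n : S m = S n -> m = n.
Proof. congruence. Qed.

Lemma outs_psh_inv P a F R : outs (psh P) (S a) (pren (up S) F) R ->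
  exists R', R = psh R' /\ outs P a F R'.
Proof. intros H; eapply outs_pren_inv; eauto using S_inj. Qed.

Lemma tau_psh_inv P R : tau (psh P) R -> exists R', R = psh R' /\ tau P R'.
Proof. intros H; eapply tau_pren_inv; eauto using S_inj. Qed.

Lemma sim_par_nil_l P : sim (Par P Nil) P.
Proof.
  repeat split.
  - intros a F H; inv H; [|inve]. eexists; split; eauto. apply sc_par_nil.
  - intros a F R H; inv H; [|inve]. eexists; split; eauto. apply sc_par_nil.
  - intros R H; inv H; [inve|inve| |inve]. eexists; split; eauto. apply sc_par_nil.
Qed.

Lemma sim_par_nil_r P : sim P (Par P Nil).
Proof.
  repeat split.
  - intros a F H. eexists; split; [apply inp_parl; eauto|]. symmetry; apply sc_par_nil.
  - intros a F R H. eexists; split; [apply outs_parl; eauto|]. symmetry; apply sc_par_nil.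
  - intros R H. eexists; split; [apply tau_parl; eauto|]. symmetry; apply sc_par_nil.
Qed.

Lemma sim_par_comm P Q : sim (Par P Q) (Par Q P).
Proof.
  repeat split.
  - intros a F H; inv H; eexists; split;
      [apply inp_parr; eauto|pac|apply inp_parl; eauto|pac].
  - intros a F R H; inv H; eexists; split;
      [apply outs_parr; eauto|pac|apply outs_parl; eauto|pac].
  - intros R H; inv H; eexists; split;
      [eapply tau_oi; eauto|pac|eapply tau_io; eauto|pac|apply tau_parr; eauto|pac
      |apply tau_parl; eauto|pac].
Qed.

Lemma sim_par_assoc P Q R : sim (Par (Par P Q) R) (Par P (Par Q R)).
Proof.
  repeat split.
  - intros a F H; inv H; [inve|]; eexists; (split; [|rewrite ?psh_par]).
    + apply inp_parl; eauto.
    + rewrite psh_par; pac.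
    + apply inp_parr, inp_parl; eauto.
    + pac.
    + apply inp_parr, inp_parr; eauto.
    + pac.
  - intros a F X H; inv H; [inve|]; eexists; split.
    + apply outs_parl; eauto.
    + pac.
    + apply outs_parr, outs_parl; eauto.
    + pac.
    + apply outs_parr, outs_parr; eauto.
    + pac.
  - intros X H; inv H.
    + inve.
      * edestruct outs_unframe_r as (X' & H' & E'); [eassumption|].
        eexists; split; [eapply tau_io; [eauto|apply outs_parr; eauto]|]. rewrite E'; pac.
      * edestruct outs_unframe_l as (X' & H' & E'); [eassumption|].
        eexists; split; [eapply tau_parr, tau_io; eauto|]. rewrite E'; pac.
    + inve.
      * edestruct (outs_frame_l Q) as (X' & H' & E'); [eassumption|].
        eexists; split; [eapply tau_oi; [eauto|apply inp_parr; eauto]|]. rewrite E'; pac.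
      * eexists; split; [eapply tau_parr, tau_oi; eauto|]. pac.
    + inve.
      * eexists; split; [eapply tau_io; [eauto|apply outs_parl; eauto]|]. pac.
      * edestruct (outs_frame_r R) as (X' & H' & E'); [eassumption|].
        eexists; split; [eapply tau_oi; [eauto|apply inp_parl; eauto]|]. rewrite E'; pac.
      * eexists; split; [apply tau_parl; eauto|]. pac.
      * eexists; split; [apply tau_parr, tau_parl; eauto|]. pac.
    + eexists; split; [apply tau_parr, tau_parr; eauto|]. pac.
Qed.

Lemma sim_par_assoc_r P Q R : sim (Par P (Par Q R)) (Par (Par P Q) R).
Proof.
  eapply sim_trans; [apply sim_par_comm|].
  eapply sim_trans; [apply sim_par_assoc|].
  eapply sim_trans; [apply sim_par_comm|].
  eapply sim_trans; [apply sim_par_assoc|].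
  apply sim_par_comm.
Qed.

Lemma sim_repl_l P : sim (Repl P) (Par P (Repl P)).
Proof.
  repeat split.
  - intros a F H; inv H; eexists; split; [apply inp_parl; eauto|reflexivity].
  - intros a F R H; inv H; eexists; split; [apply outs_parl; eauto|reflexivity].
  - intros R H; inv H; eexists; split;
      [apply tau_parl; eauto|reflexivity|eapply tau_io; [eauto|apply outs_repl; eauto]|reflexivity].
Qed.

Lemma repl_absorb P R : Par P (Par R (Repl P)) == Par R (Repl P).
Proof. rewrite (sc_repl P) at 2; pac. Qed.

Lemma sim_repl_r P : sim (Par P (Repl P)) (Repl P).
Proof.
  repeat split.
  - intros a F H; inv H; [|inve]; eexists; (split; [apply inp_repl; eauto|]).
    + reflexivity.
    + rewrite psh_repl. apply repl_absorb.
  - intros a F R H; inv H; [|inve]; eexists; (split; [apply outs_repl; eauto|]).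
    + reflexivity.
    + apply repl_absorb.
  - intros R H; inv H.
    + inve. eexists; split; [eapply tau_repl_io; eauto|reflexivity].
    + inve. edestruct outs_unframe_r as (X' & H' & E'); [eassumption|].
      eexists; split; [eapply tau_repl_io; eauto|auto].
    + eexists; split; [eapply tau_repl; eauto|reflexivity].
    + inve; eexists; split;
        [eapply tau_repl; eauto|apply repl_absorb|eapply tau_repl_io; eauto|apply repl_absorb].
Qed.

Lemma sim_nu_nu P : sim (Nu (Nu P)) (Nu (Nu (pren swap01 P))).
Proof.
  repeat split.
  - intros a F H; inv H; inve. eexists; split.
    + do 2 apply inp_nu. eapply (inp_pren swap01 _ (S (S a))); eassumption.
    + simpl; rewrite !pren_comp, sc_nu_nu, pren_comp.
      match goal with |- Nu (Nu (pren ?f _)) == Nu (Nu (pren ?g _)) => replace f with g by fext end.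
      reflexivity.
  - intros a F R H; inv H; inve. eexists; split.
    + do 2 apply outs_nu.
      replace (pren (up S) (pren (up S) F)) with (pren (up swap01) (pren (up S) (pren (up S) F)))
        by (rewrite !pren_comp; f_equal; fext).
      eapply (outs_pren swap01 _ (S (S a))); eassumption.
    + apply sc_nu_nu.
  - intros R H; inv H; inve. eexists; split; [do 2 apply tau_nu; apply tau_pren; eauto|].
    apply sc_nu_nu.
Qed.

Lemma psh_nu P : psh (Nu P) = Nu (pren swap01 (psh P)).
Proof. unfold psh; simpl; rewrite pren_comp; do 2 f_equal; fext. Qed.

Lemma swap_psh_psh P : pren swap01 (psh (psh P)) = psh (psh P).
Proof. unfold psh; rewrite !pren_comp; f_equal. Qed.

Lemma swap_up_S P : pren swap01 (pren (up S) P) = psh P.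
Proof. unfold psh; rewrite !pren_comp; f_equal; fext. Qed.

Lemma sim_nu_par_l P Q : sim (Nu (Par (psh P) Q)) (Par P (Nu Q)).
Proof.
  repeat split.
  - intros a F H; inv H; inve.
    + match goal with H : inp (psh _) _ _ |- _ => destruct (inp_psh_inv _ _ _ H)
        as (c & F' & E & -> & H') end.
      injection E as <-.
      eexists; split; [apply inp_parl; eauto|].
      simpl. rewrite swap_up_S, sc_nu_par, psh_nu; reflexivity.
    + eexists; split; [apply inp_parr, inp_nu; eauto|].
      simpl. rewrite swap_psh_psh, sc_nu_par; reflexivity.
  - intros a F R H; inv H; inve.
    + match goal with H : outs (psh _) _ _ _ |- _ => destruct (outs_psh_inv _ _ _ _ H)
        as (R' & -> & H') end.
      eexists; split; [apply outs_parl; eauto|]. apply (sc_nu_par R').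
    + eexists; split; [apply outs_parr, outs_nu; eauto|]. apply sc_nu_par.
  - intros R H; inv H; inve.
    + match goal with H : inp (psh _) _ _ |- _ => destruct (inp_psh_inv _ _ _ H)
        as (c & F' & -> & -> & H') end.
      eexists; split; [eapply tau_io; [eauto|apply outs_nu; eauto]|reflexivity].
    + match goal with H : outs (psh _) _ _ _ |- _ => destruct (outs_abs_nu _ _ _ _ H)
        as (c & R' & -> & H' & E') end.
      eexists; split; [eapply tau_oi; [eauto|apply inp_nu; eauto]|symmetry; auto].
    + match goal with H : tau (psh _) _ |- _ => destruct (tau_psh_inv _ _ H) as (R' & -> & H') end.
      eexists; split; [apply tau_parl; eauto|]. apply (sc_nu_par R').
    + eexists; split; [apply tau_parr, tau_nu; eauto|]. apply sc_nu_par.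
Qed.

Lemma sim_nu_par_r P Q : sim (Par P (Nu Q)) (Nu (Par (psh P) Q)).
Proof.
  repeat split.
  - intros a F H; inv H.
    + eexists; split; [apply inp_nu, inp_parl; apply (inp_pren S); eassumption|].
      simpl. rewrite swap_up_S, sc_nu_par, psh_nu; reflexivity.
    + inve. eexists; split; [apply inp_nu, inp_parr; eauto|].
      simpl. rewrite swap_psh_psh, sc_nu_par; reflexivity.
  - intros a F R H; inv H.
    + eexists; split; [apply outs_nu, outs_parl; apply (outs_pren S); eassumption|].
      symmetry; apply (sc_nu_par R0).
    + inve. eexists; split; [apply outs_nu, outs_parr; eauto|]. symmetry; apply sc_nu_par.
  - intros R H; inv H.
    + inve. eexists; split; [|reflexivity].
      apply tau_nu; eapply tau_io; [apply (inp_pren S); eassumption|eauto].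
    + inve. edestruct outs_nu_abs_r as (R' & H' & E'); [eassumption|].
      eexists; split; [eapply tau_nu, tau_oi; eauto|auto].
    + eexists; split; [apply tau_nu, tau_parl; apply (tau_pren S); eassumption|].
      symmetry; apply (sc_nu_par R0).
    + inve. eexists; split; [apply tau_nu, tau_parr; eauto|]. symmetry; apply sc_nu_par.
Qed.

Lemma sim_let a b P : sim (Let (DPair a b) P) (pren (scons a (scons b idn)) P).
Proof.
  repeat split.
  - intros c F H; inv H. eexists; split; eauto; reflexivity.
  - intros c F R H; inv H. eexists; split; eauto; reflexivity.
  - intros R H; inv H. eexists; split; eauto; reflexivity.
Qed.

Lemma sim_let_r a b P : sim (pren (scons a (scons b idn)) P) (Let (DPair a b) P).
Proof.
  repeat split.
  - intros c F H. eexists; split; [constructor; eauto|reflexivity].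
  - intros c F R H. eexists; split; [constructor; eauto|reflexivity].
  - intros R H. eexists; split; [constructor; eauto|reflexivity].
Qed.

Lemma sim_par P P' Q Q' : P == P' -> Q == Q' -> sim P P' -> sim Q Q' ->
  sim (Par P Q) (Par P' Q').
Proof.
  intros E1 E2 (A1 & A2 & A3) (B1 & B2 & B3); repeat split.
  - intros a F H; inv H.
    + edestruct A1 as (F' & H' & E'); [eassumption|]. eexists; split; [apply inp_parl; eauto|].
      rewrite E', E2; reflexivity.
    + edestruct B1 as (F' & H' & E'); [eassumption|]. eexists; split; [apply inp_parr; eauto|].
      rewrite E', E1; reflexivity.
  - intros a F R H; inv H.
    + edestruct A2 as (F' & H' & E'); [eassumption|]. eexists; split; [apply outs_parl; eauto|].
      rewrite E', E2; reflexivity.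
    + edestruct B2 as (F' & H' & E'); [eassumption|]. eexists; split; [apply outs_parr; eauto|].
      rewrite E', E1; reflexivity.
  - intros R H; inv H.
    + edestruct A1 as (F' & H' & E'); [eassumption|]. edestruct B2 as (R' & H1 & E3);
        [eassumption|].
      destruct (outs_scong _ _ _ _ H1 _ E') as (R2 & H5 & E5).
      eexists; split; [eapply tau_io; eauto|]. rewrite E3; auto.
    + edestruct B1 as (F' & H' & E'); [eassumption|]. edestruct A2 as (R' & H1 & E3);
        [eassumption|].
      destruct (outs_scong _ _ _ _ H1 _ E') as (R2 & H5 & E5).
      eexists; split; [eapply tau_oi; eauto|]. rewrite E3; auto.
    + edestruct A3 as (F' & H' & E'); [eassumption|]. eexists; split; [apply tau_parl; eauto|].
      rewrite E', E2; reflexivity.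
    + edestruct B3 as (F' & H' & E'); [eassumption|]. eexists; split; [apply tau_parr; eauto|].
      rewrite E', E1; reflexivity.
Qed.

Lemma sim_repl P P' : P == P' -> sim P P' -> sim (Repl P) (Repl P').
Proof.
  intros E1 (A1 & A2 & A3); repeat split.
  - intros a F H; inv H. edestruct A1 as (F' & H' & E'); [eassumption|].
    eexists; split; [apply inp_repl; eauto|]. rewrite E', E1; reflexivity.
  - intros a F R H; inv H. edestruct A2 as (F' & H' & E'); [eassumption|].
    eexists; split; [apply outs_repl; eauto|]. rewrite E', E1; reflexivity.
  - intros R H; inv H.
    + edestruct A3 as (F' & H' & E'); [eassumption|]. eexists; split; [apply tau_repl; eauto|].
      rewrite E', E1; reflexivity.
    + edestruct A1 as (F' & H' & E'); [eassumption|]. edestruct A2 as (R' & H3 & E3);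
        [eassumption|].
      destruct (outs_scong _ _ _ _ H3 _ E') as (R2 & H5 & E5).
      eexists; split; [eapply tau_repl_io; eauto|]. rewrite E3, E5, E1; reflexivity.
Qed.

Lemma sim_nu P P' : sim P P' -> sim (Nu P) (Nu P').
Proof.
  intros (A1 & A2 & A3); repeat split.
  - intros a F H; inv H. edestruct A1 as (F' & H' & E'); [eassumption|].
    eexists; split; [apply inp_nu; eauto|]. rewrite E'; reflexivity.
  - intros a F R H; inv H. edestruct A2 as (F' & H' & E'); [eassumption|].
    eexists; split; [apply outs_nu; eauto|]. rewrite E'; reflexivity.
  - intros R H; inv H. edestruct A3 as (F' & H' & E'); [eassumption|].
    eexists; split; [apply tau_nu; eauto|]. rewrite E'; reflexivity.
Qed.

(** The renaming is generalized because a [Let] on a pair runs an instance of its body, so the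
    hypothesis on the bodies is needed at an instantiation. Both directions are carried along for
    the symmetry rule. *)
Lemma scong_sim_pren P Q : P == Q ->
  forall f, sim (pren f P) (pren f Q) /\ sim (pren f Q) (pren f P).
Proof.
  induction 1; intros f; simpl.
  - split; [apply sim_par_nil_l|apply sim_par_nil_r].
  - split; apply sim_par_comm.
  - split; [apply sim_par_assoc|apply sim_par_assoc_r].
  - split; [apply sim_repl_l|apply sim_repl_r].
  - repeat split; intros; repeat match goal with
      | H : inp _ _ _ |- _ => inv H | H : outs _ _ _ _ |- _ => inv H | H : tau _ _ |- _ =>
        inv H end.
  - replace (pren (up (up f)) (pren swap01 P)) with (pren swap01 (pren (up (up f)) P))
      by (rewrite !pren_comp; f_equal; fext).
    split; [apply sim_nu_nu|].
    rewrite <- (pren_swap01 (pren (up (up f)) P)) at 2. apply sim_nu_nu.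
  - rewrite pren_psh. split; [apply sim_nu_par_l|apply sim_nu_par_r].
  - rewrite pren_inst. split; [apply sim_let|apply sim_let_r].
  - split; apply sim_refl.
  - destruct (IHscong f); auto.
  - destruct (IHscong1 f), (IHscong2 f); split; eapply sim_trans; eauto.
  - destruct (IHscong1 f), (IHscong2 f); split; apply sim_par; auto;
      apply scong_pren; auto; symmetry; auto.
  - destruct (IHscong f); split; apply sim_repl; auto; apply scong_pren; auto; symmetry; auto.
  - destruct (IHscong (up f)); split; apply sim_nu; auto.
  - repeat split; intros; try (inv H0; fail); inv H0; eexists; (split; [constructor|]);
      rewrite H; reflexivity.
  - repeat split; intros; try (inv H0; fail); inv H0; eexists; (split; [constructor; auto|]);
      rewrite H; reflexivity.
  - destruct p; simpl.
    + repeat split; intros; inv H0.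
    + destruct (IHscong (fun n => scons (f a) (scons (f b) idn) (up (up f) n))) as [A B].
      rewrite <- 2!(pren_comp _ (scons (f a) (scons (f b) idn)) (up (up f))) in A, B.
      split; (eapply sim_trans; [apply sim_let|]; eapply sim_trans; [|apply sim_let_r]); auto.
Qed.

Lemma scong_sim P Q : P == Q -> sim P Q.
Proof.
  intros H. destruct (scong_sim_pren P Q H (fun n => n)) as [A _]. rewrite !pren_id in A; auto.
Qed.

Lemma inp_cong P Q a F : P == Q -> inp P a F -> exists F', inp Q a F' /\ F == F'.
Proof. intros E; apply (scong_sim P Q E). Qed.

Lemma outs_cong P Q a F R : P == Q -> outs P a F R -> exists R', outs Q a F R' /\ R == R'.
Proof. intros E; apply (scong_sim P Q E). Qed.

Lemma tau_cong P Q R : P == Q -> tau P R -> exists R', tau Q R' /\ R == R'.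
Proof. intros E; apply (scong_sim P Q E). Qed.

(** ** Reductions and barbs *)

Lemma step_cong P P' Q Q' : P == Q -> P' == Q' -> step P P' -> step Q Q'.
Proof. intros H H' H1. eapply step_scong; [symmetry; eauto|eauto|auto]. Qed.

Lemma step_tau P P' : step P P' -> exists P'', tau P P'' /\ P' == P''.
Proof.
  induction 1.
  - destruct (psubst_link _ _ _ H) as [H1 H2].
    replace (lsub (scons p DName)) with (rcv p) in * by fext.
    eexists; split; [eapply tau_oi; [apply outs_out; eauto|constructor]|].
    rewrite H2; reflexivity.
  - destruct IHstep as (P2 & H1 & E). eexists; split; [apply tau_nu; eauto|].
    rewrite E; reflexivity.
  - destruct IHstep as (P2 & H1 & E). eexists; split; [apply tau_parl; eauto|].
    rewrite E; reflexivity.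
  - destruct IHstep as (P2 & H2 & E).
    destruct (tau_cong _ P _ (sc_sym H) H2) as (P3 & H3 & E3).
    exists P3; split; auto. rewrite <- H1, E; auto.
Qed.

(** The substitution may be undefined on [F] itself; the reduction first passes to the congruent
    process given by [link_psubst]. *)
Lemma step_out a p P F : dfd (rcv p) F -> step (Par (Out a p P) (Inp a F)) (Par P (link (rcv p) F)).
Proof.
  intros H.
  destruct (link_psubst F (fun n => n) (scons p DName)) as (F1 & F' & E1 & E2 & E3).
  { replace (fun n => lsub (scons p DName) n) with (rcv p) by fext. auto. }
  replace (fun n => lsub (scons p DName) n) with (rcv p) in * by fext.
  rewrite pren_id in E1.
  eapply step_scong; [rewrite E1; reflexivity|apply step_comm; exact E2|rewrite E3; reflexivity].
Qed.

Lemma outs_step P a F R : outs P a F R -> step (Par P (Inp a F)) R.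
Proof.
  induction 1.
  - apply step_out; auto.
  - eapply step_cong; [| |apply (step_par Q IHouts)]; pac.
  - eapply step_cong; [| |apply (step_par P IHouts)]; pac.
  - eapply step_cong; [| |apply (step_nu IHouts)]; [|reflexivity].
    change (Inp (S a) (pren (up S) F)) with (psh (Inp a F)). apply nu_par_r.
  - eapply step_cong; [| |apply (step_par (Repl P) IHouts)].
    + rewrite (sc_repl P) at 2. pac.
    + reflexivity.
  - eapply step_cong; [| |apply IHouts]; [rewrite sc_let; reflexivity|reflexivity].
Qed.

Lemma inp_outs_step P a F : inp P a F -> forall Q R, outs Q a F R -> step (Par P Q) R.
Proof.
  induction 1; intros Q0 R H'.
  - eapply step_cong; [| |apply (outs_step _ _ _ _ H')]; pac.
  - edestruct outs_unframe_r as (R' & H1 & E1); [eassumption|].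
    eapply step_cong; [| |apply (step_par Q (IHinp _ _ H1))]; [pac|symmetry; auto].
  - destruct (outs_unframe_l _ _ _ _ _ H') as (R' & H1 & E1).
    eapply step_cong; [| |apply (step_par P (IHinp _ _ H1))]; [pac|symmetry; auto].
  - destruct (outs_nu_abs _ _ _ _ H' _ eq_refl) as (R' & H1 & E1).
    eapply step_cong; [| |apply (step_nu (IHinp _ _ H1))]; [apply nu_par_r|symmetry; auto].
  - edestruct outs_unframe_r as (R' & H1 & E1); [eassumption|].
    eapply step_cong; [| |apply (step_par (Repl P) (IHinp _ _ H1))]; [|symmetry; auto].
    rewrite (sc_repl P) at 2; pac.
  - eapply step_cong; [| |apply (IHinp _ _ H')]; [rewrite sc_let; reflexivity|reflexivity].
Qed.

Lemma tau_step P R : tau P R -> step P R.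
Proof.
  induction 1.
  - eapply inp_outs_step; eauto.
  - eapply step_cong; [| |eapply inp_outs_step; eauto]; [pac|reflexivity].
  - apply step_par; auto.
  - eapply step_cong; [| |apply (step_par P IHtau)]; pac.
  - apply step_nu; auto.
  - eapply step_cong; [| |apply (step_par (Repl P) IHtau)]; [|reflexivity].
    symmetry; apply sc_repl.
  - eapply step_cong; [| |eapply step_par, inp_outs_step; eauto]; [|reflexivity].
    symmetry; transitivity (Par P (Repl P)); [apply sc_repl|].
    rewrite (sc_repl P) at 1; pac.
  - eapply step_cong; [| |apply IHtau]; [rewrite sc_let; reflexivity|reflexivity].
Qed.

Lemma outs_barb P a F R : outs P a F R -> out_barb P a.
Proof.
  unfold out_barb. change (fun k : nat => Nat.iter k Nu) with nus.
  induction 1; fold nus in *.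
  - exists 0, p, P, Nil. simpl. symmetry; apply sc_par_nil.
  - destruct IHouts as (k & p & P1 & P2 & E). exists k, p, P1, (Par P2 (pren (Nat.add k) Q)).
    rewrite E. change (Par (nus k (Par (Out (k + a) p P1) P2)) Q ==
                       nus k (Par (Out (k + a) p P1) (Par P2 (pren (Nat.add k) Q)))).
    rewrite <- nus_par, sc_par_assoc; reflexivity.
  - destruct IHouts as (k & p & P1 & P2 & E). exists k, p, P1, (Par P2 (pren (Nat.add k) P)).
    rewrite E. change (Par P (nus k (Par (Out (k + a) p P1) P2)) ==
                       nus k (Par (Out (k + a) p P1) (Par P2 (pren (Nat.add k) P)))).
    rewrite sc_par_comm, <- nus_par, sc_par_assoc; reflexivity.
  - destruct IHouts as (k & p & P1 & P2 & E). exists (S k), p, P1, P2.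
    rewrite E. rewrite Nat.add_succ_r. reflexivity.
  - destruct IHouts as (k & p & P1 & P2 & E).
    exists k, p, P1, (Par P2 (pren (Nat.add k) (Repl P))).
    transitivity (Par P (Repl P)); [apply sc_repl|]. rewrite E at 1.
    change (Par (nus k (Par (Out (k + a) p P1) P2)) (Repl P) ==
                       nus k (Par (Out (k + a) p P1) (Par P2 (pren (Nat.add k) (Repl P))))).
    rewrite <- nus_par, sc_par_assoc; reflexivity.
  - destruct IHouts as (k & p & P1 & P2 & E). exists k, p, P1, P2. rewrite sc_let; auto.
Qed.

Lemma inp_barb P a F : inp P a F -> in_barb P a.
Proof.
  unfold in_barb. induction 1.
  - exists 0, P, Nil. simpl. symmetry; apply sc_par_nil.
  - destruct IHinp as (k & P1 & P2 & E). exists k, P1, (Par P2 (pren (Nat.add k) Q)).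
    rewrite E. change (Par (nus k (Par (Inp (k + a) P1) P2)) Q ==
                       nus k (Par (Inp (k + a) P1) (Par P2 (pren (Nat.add k) Q)))).
    rewrite <- nus_par, sc_par_assoc; reflexivity.
  - destruct IHinp as (k & P1 & P2 & E). exists k, P1, (Par P2 (pren (Nat.add k) P)).
    rewrite E. change (Par P (nus k (Par (Inp (k + a) P1) P2)) ==
                       nus k (Par (Inp (k + a) P1) (Par P2 (pren (Nat.add k) P)))).
    rewrite sc_par_comm, <- nus_par, sc_par_assoc; reflexivity.
  - destruct IHinp as (k & P1 & P2 & E). exists (S k), P1, P2.
    rewrite E. rewrite Nat.add_succ_r. reflexivity.
  - destruct IHinp as (k & P1 & P2 & E).
    exists k, P1, (Par P2 (pren (Nat.add k) (Repl P))).
    transitivity (Par P (Repl P)); [apply sc_repl|]. rewrite E at 1.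
    change (Par (nus k (Par (Inp (k + a) P1) P2)) (Repl P) ==
                       nus k (Par (Inp (k + a) P1) (Par P2 (pren (Nat.add k) (Repl P))))).
    rewrite <- nus_par, sc_par_assoc; reflexivity.
  - destruct IHinp as (k & P1 & P2 & E). exists k, P1, P2. rewrite sc_let; auto.
Qed.

Lemma barb_outs P a : out_barb P a -> exists R, outs P a Nil R.
Proof.
  intros (k & p & Q & R & E).
  assert (H : exists X, outs (nus k (Par (Out (k + a) p Q) R)) a Nil X).
  { clear E. revert a. induction k; intros a.
    - eexists. apply outs_parl, outs_out. exact I.
    - destruct (IHk (S a)) as [X H]. rewrite nus_S. exists (Nu X). apply outs_nu.
      rewrite Nat.add_succ_r in H. exact H. }
  destruct H as [X H]. destruct (outs_cong _ P _ _ _ (sc_sym E) H) as (X' & H' & _); eauto.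
Qed.

Lemma barb_inp P a : in_barb P a -> exists F, inp P a F.
Proof.
  intros (k & Q & R & E).
  assert (H : exists X, inp (nus k (Par (Inp (k + a) Q) R)) a X).
  { clear E. revert a. induction k; intros a.
    - eexists. apply inp_parl, inp_in.
    - destruct (IHk (S a)) as [X H]. rewrite nus_S. eexists. apply inp_nu.
      rewrite Nat.add_succ_r in H. exact H. }
  destruct H as [X H]. destruct (inp_cong _ P _ _ (sc_sym E) H) as (X' & H' & _); eauto.
Qed.

(** * Bisimulation up to contexts and structural congruence *)

(** Weak moves with congruence allowed anywhere, which makes them easy to compose; [wt_steps]
    restores a reduction sequence followed by one congruence. *)
Inductive wt : proc -> proc -> Prop :=
| wt_cong P Q : P == Q -> wt P Q
| wt_tau P Q : tau P Q -> wt P Q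
| wt_trans P Q R : wt P Q -> wt Q R -> wt P R.

Lemma wt_refl P : wt P P.
Proof. apply wt_cong; reflexivity. Qed.

#[export] Instance wt_scong : Proper (scong ==> scong ==> iff) wt.
Proof.
  intros P P' E Q Q' E'; split; intros H.
  - eapply wt_trans; [apply wt_cong; symmetry; eauto|].
    eapply wt_trans; [eauto|apply wt_cong; auto].
  - eapply wt_trans; [apply wt_cong; eauto|].
    eapply wt_trans; [eauto|apply wt_cong; symmetry; auto].
Qed.

Lemma wt_parl P P' Q : wt P P' -> wt (Par P Q) (Par P' Q).
Proof.
  induction 1.
  - apply wt_cong; rewrite H; reflexivity.
  - apply wt_tau, tau_parl; auto.
  - eapply wt_trans; eauto.
Qed.

Lemma wt_par P P' Q Q' : wt P P' -> wt Q Q' -> wt (Par P Q) (Par P' Q').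
Proof.
  intros H H'. eapply wt_trans; [apply wt_parl; eauto|].
  rewrite (sc_par_comm P' Q), (sc_par_comm P' Q'). apply wt_parl; auto.
Qed.

Lemma wt_nu P P' : wt P P' -> wt (Nu P) (Nu P').
Proof.
  induction 1.
  - apply wt_cong; rewrite H; reflexivity.
  - apply wt_tau, tau_nu; auto.
  - eapply wt_trans; eauto.
Qed.

Lemma wt_steps P Q : wt P Q -> exists Q', steps P Q' /\ Q' == Q.
Proof.
  induction 1.
  - exists P; split; auto. apply rt_refl.
  - exists Q; split; [apply rt_step, tau_step; auto|reflexivity].
  - destruct IHwt1 as (Q1 & S1 & E1), IHwt2 as (R1 & S2 & E2).
    (* The congruence between the two sequences is absorbed by the first step of the second one, or
       kept at the end if there is no such step. *)
    clear H H0. apply clos_rt_rt1n in S2. destruct S2 as [|Q2 R2 S2 S3].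
    + exists Q1; split; auto. etransitivity; eauto.
    + exists R2; split; auto. eapply rt_trans; [eauto|].
      eapply rt_trans; [apply rt_step|apply clos_rt1n_rt; eauto].
      eapply step_cong; [symmetry; eauto|reflexivity|auto].
Qed.

(** Contexts are arbitrary and may contain literal pairs, even of [Any] channels; the bound channels
    then inherit the kinds of the components. *)
Definition letk (V : nat -> kind) (p : data) : nat -> kind :=
  match p with
  | DName _ => scons Nam (scons Nam V)
  | DPair a b => scons (V a) (scons (V b) V)
  end.

Definition prel : Type := (nat -> kind) -> proc -> proc -> Prop.

(** Indexing the relation by kinds makes it closed under the substitutions that a
    communication can perform: at top level every channel is a name. *)
Inductive cl (B : prel) : prel :=
| cl_nil V : cl B V Nil Nil
| cl_par V P P' Q Q' : cl B V P P' -> cl B V Q Q' -> cl B V (Par P Q) (Par P' Q')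
| cl_repl V P P' : cl B V P P' -> cl B V (Repl P) (Repl P')
| cl_nu V P P' : cl B (scons Nam V) P P' -> cl B V (Nu P) (Nu P')
| cl_inp V a P P' : cl B (scons Any V) P P' -> cl B V (Inp a P) (Inp a P')
| cl_out V a p P P' : cl B V P P' -> cl B V (Out a p P) (Out a p P')
| cl_let V p P P' : cl B (letk V p) P P' -> cl B V (Let p P) (Let p P')
| cl_base V P Q : B V P Q -> cl B V P Q.

Definition clc (B : prel) (V : nat -> kind) (P Q : proc) : Prop :=
  exists P1 Q1, P == P1 /\ cl B V P1 Q1 /\ Q1 == Q.

Definition plainv (V : nat -> kind) : Prop := forall n, plain (V n).

Definition names : nat -> kind := fun _ => Nam.

(** Definedness has to agree on related processes: otherwise, as receivers, one of them could accept
    a datum that the other cannot. *)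
Record stable (B : prel) : Prop := {
  pg_sym : forall V P Q, B V P Q -> B V Q P;
  pg_pren : forall V P Q f V', plainv V -> plainv V' -> radm V f V' ->
    B V P Q -> B V' (pren f P) (pren f Q);
  pg_link : forall V P Q r V', plainv V -> plainv V' -> adm V r V' ->
    B V P Q -> (dfd r P <-> dfd r Q) /\ B V' (link r P) (link r Q)
}.

(** Since the receiver is part of an output transition, outputs are compared against two related
    receivers [F] and [F']. Transitions are considered only at [names], as no reception is pending
    at top level. *)
Record progressing (B : prel) : Prop := {
  pg_stable :> stable B;
  pg_inp : forall P Q a F, B names P Q -> inp P a F ->
    exists Q1 F', wt Q Q1 /\ inp Q1 a F' /\ clc B (scons Any names) F F';
  pg_outs : forall P Q a F F' R, B names P Q -> outs P a F R ->
    cl B (scons Any names) F F' ->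
    exists Q1 R', wt Q Q1 /\ outs Q1 a F' R' /\ clc B names R R';
  pg_tau : forall P Q R, B names P Q -> tau P R ->
    exists R', wt Q R' /\ clc B names R R'
}.

#[export] Hint Resolve pg_stable : core.

Lemma names_S : scons Nam names = names.
Proof. extensionality n; destruct n; reflexivity. Qed.

Lemma plainv_scons k V : plain k -> plainv V -> plainv (scons k V).
Proof. intros H H' [|n]; simpl; auto. Qed.

Lemma plain_Any : plain Any. Proof. left; auto. Qed.
Lemma plain_Nam : plain Nam. Proof. right; auto. Qed.
#[export] Hint Resolve plainv_scons plain_Any plain_Nam : core.

Lemma plainv_letk V p : plainv V -> plainv (letk V p).
Proof. intros H; destruct p; simpl; auto. Qed.
#[export] Hint Resolve plainv_letk : core.

Lemma plainv_names : plainv names.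
Proof. intros n; right; auto. Qed.
#[export] Hint Resolve plainv_names : core.

Lemma cl_refl B P : forall V, cl B V P P.
Proof. induction P; intros V; constructor; auto. Qed.

Lemma cl_sym B V P Q : stable B -> cl B V P Q -> cl B V Q P.
Proof.
  intros HB; induction 1; try (constructor; auto; fail).
  apply cl_base; apply (pg_sym _ HB); auto.
Qed.

Lemma radm_letk V f V' p : radm V f V' -> radm (letk V p) (up (up f)) (letk V' (dren f p)).
Proof.
  intros H; destruct p; simpl.
  - auto using radm_up.
  - intros [|[|n]]; simpl; auto; apply H.
Qed.

Lemma cl_pren B V P Q : stable B -> cl B V P Q ->
  forall f V', plainv V -> plainv V' -> radm V f V' -> cl B V' (pren f P) (pren f Q).
Proof.
  intros HB; induction 1; intros f V' HV HV' Hf; simpl;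
    try (constructor; eauto using radm_up, radm_letk; fail).
  apply cl_base, (pg_pren _ HB V); auto.
Qed.

Lemma adm_letk V r V' : adm V r V' ->
  adm (scons Nam (scons Nam V)) (lup (lup r)) (scons Nam (scons Nam V')).
Proof. intros; do 2 apply adm_lup; auto. Qed.

Lemma cl_link B V P Q : stable B -> cl B V P Q ->
  forall r V', plainv V -> plainv V' -> adm V r V' ->
  (dfd r P <-> dfd r Q) /\ cl B V' (link r P) (link r Q).
Proof.
  intros HB; induction 1; intros r V' HV HV' Hr; simpl.
  - split; [tauto|constructor].
  - destruct (IHcl1 _ _ HV HV' Hr), (IHcl2 _ _ HV HV' Hr). split; [tauto|constructor; auto].
  - destruct (IHcl _ _ HV HV' Hr). split; [tauto|constructor; auto].
  - destruct (IHcl (lup r) (scons Nam V')); auto.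
    { apply adm_lup; auto. }
    split; [tauto|constructor; auto].
  - destruct (IHcl (lup r) (scons Any V')); auto.
    { apply adm_lup; auto. }
    generalize (Hr a); destruct (HV a) as [E|E]; rewrite E; simpl;
      destruct (r a) as [[]| |]; simpl; try tauto; intros _;
      (split; [tauto|constructor; auto]).
  - destruct (IHcl _ _ HV HV' Hr).
    generalize (Hr a); destruct (HV a) as [E|E]; rewrite E; simpl;
      destruct (r a) as [[]| |]; simpl; try tauto; intros _;
      (split; [tauto|]); destruct (pay r p); constructor; auto.
  - destruct p; simpl in *.
    + destruct (IHcl (lup (lup r)) (scons Nam (scons Nam V'))); auto using adm_letk.
      generalize (Hr a); destruct (HV a) as [E|E]; rewrite E; simpl;
        destruct (r a) as [[]| |]; simpl; try tauto; intros Hp;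
        try (split; [tauto|]; constructor; auto; fail).
      apply IHcl; auto. intros [|[|n]]; simpl; try tauto. apply Hr.
    + apply IHcl; auto.
      intros [|[|n]]; simpl; apply Hr.
  - destruct (pg_link _ HB _ _ _ _ _ HV HV' Hr H). auto using cl_base.
Qed.

Lemma clc_cong B V P P' Q Q' : P == P' -> Q == Q' -> clc B V P Q -> clc B V P' Q'.
Proof.
  intros E E' (P1 & Q1 & E1 & H & E2). exists P1, Q1; repeat split; auto.
  - rewrite <- E; auto.
  - rewrite E2; auto.
Qed.

Lemma clc_cl B V P Q : cl B V P Q -> clc B V P Q.
Proof. intros; exists P, Q; repeat split; auto; reflexivity. Qed.

Lemma clc_sym B V P Q : stable B -> clc B V P Q -> clc B V Q P.
Proof.
  intros HB (P1 & Q1 & E1 & C & E2). exists Q1, P1; repeat split; try (symmetry; auto; fail).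
  apply cl_sym; auto.
Qed.

Lemma clc_par B V P P' Q Q' : clc B V P P' -> clc B V Q Q' -> clc B V (Par P Q) (Par P' Q').
Proof.
  intros (P1 & Q1 & E1 & H & E2) (P2 & Q2 & E3 & H' & E4).
  exists (Par P1 P2), (Par Q1 Q2); repeat split.
  - rewrite E1, E3; reflexivity.
  - constructor; auto.
  - rewrite E2, E4; reflexivity.
Qed.

Lemma clc_nu B V P P' : clc B (scons Nam V) P P' -> clc B V (Nu P) (Nu P').
Proof.
  intros (P1 & Q1 & E1 & H & E2).
  exists (Nu P1), (Nu Q1); repeat split.
  - rewrite E1; reflexivity.
  - constructor; auto.
  - rewrite E2; reflexivity.
Qed.

Lemma clc_pren B V P Q f V' : stable B -> plainv V -> plainv V' -> radm V f V' ->
  clc B V P Q -> clc B V' (pren f P) (pren f Q).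
Proof.
  intros HB HV HV' Hf (P1 & Q1 & E1 & H & E2).
  exists (pren f P1), (pren f Q1); repeat split.
  - rewrite E1; reflexivity.
  - eapply cl_pren; eauto.
  - rewrite E2; reflexivity.
Qed.

Lemma repl_weak P Q : wt P Q -> wt (Repl P) (Par Q (Repl P)).
Proof. intros H. rewrite (sc_repl P) at 1. apply wt_parl; auto. Qed.

Lemma cl_inst B V a b P Q : stable B -> plainv V ->
  cl B (letk V (DPair a b)) P Q ->
  cl B V (pren (scons a (scons b idn)) P) (pren (scons a (scons b idn)) Q).
Proof.
  intros HB HV H. eapply cl_pren; eauto.
  intros [|[|n]]; simpl; unfold idn.
  - destruct (HV a) as [->| ->]; auto.
  - destruct (HV b) as [->| ->]; auto.
  - destruct (HV n) as [->| ->]; auto.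
Qed.

Lemma let_weak a b P Q : wt (pren (scons a (scons b idn)) P) Q -> wt (Let (DPair a b) P) Q.
Proof. rewrite sc_let; auto. Qed.

Lemma radm_swap k k' V : radm (scons k (scons k' V)) swap01 (scons k' (scons k V)).
Proof.
  intros [|[|n]]; simpl; [destruct k|destruct k'|destruct (V n)]; auto; discriminate.
Qed.

(** A transition of a contextual pair stems from the context or from a base pair, where
    [progressing] applies. Restrictions preserve [names], and a [Let] on a pair is replaced by its
    instance. *)
Lemma cl_inp_step B P a F : progressing B -> inp P a F -> forall Q, cl B names P Q ->
  exists Q1 F', wt Q Q1 /\ inp Q1 a F' /\ clc B (scons Any names) F F'.
Proof.
  intros HB; induction 1; intros Q0 HC; inversion HC; subst; clear HC;
    try (eapply (pg_inp _ HB); [eassumption|econstructor; eassumption]).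
  - do 2 eexists; repeat split; [apply wt_refl|constructor|apply clc_cl; auto].
  - edestruct IHinp as (Q1 & F' & W & I & R); [eassumption|].
    do 2 eexists; repeat split; [apply wt_parl; eauto|apply inp_parl; eauto|].
    apply clc_par; auto. apply clc_cl. eapply cl_pren; eauto. apply radm_S.
  - edestruct IHinp as (Q1 & F' & W & I & R); [eassumption|].
    do 2 eexists; repeat split; [apply wt_par; [apply wt_refl|eauto]|apply inp_parr; eauto|].
    apply clc_par; auto. apply clc_cl. eapply cl_pren; eauto. apply radm_S.
  - rewrite names_S in *. edestruct IHinp as (Q1 & F' & W & I & R); [eassumption|].
    do 2 eexists; repeat split; [apply wt_nu; eauto|apply inp_nu; eauto|].
    apply clc_nu. eapply clc_pren; [..|exact R]; auto.
    rewrite <- names_S at 1. apply radm_swap.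
  - edestruct IHinp as (Q1 & F' & W & I & R); [eassumption|].
    do 2 eexists; repeat split; [apply repl_weak; eauto|apply inp_parl; eauto|].
    apply clc_par; auto. apply clc_cl. eapply (cl_pren B names (Repl P) (Repl P')); eauto.
    + constructor; auto.
    + apply radm_S.
  - edestruct IHinp as (Q1 & F' & W & I & R); [eapply cl_inst; eassumption || auto|].
    do 2 eexists; repeat split; [apply let_weak; eauto|eauto|auto].
Qed.

Lemma cl_outs_step B P a F R : progressing B -> outs P a F R ->
  forall Q F', cl B names P Q -> cl B (scons Any names) F F' ->
  exists Q1 R', wt Q Q1 /\ outs Q1 a F' R' /\ clc B names R R'.
Proof.
  intros HB; induction 1; intros Q0 F' HC HF; inversion HC; subst; clear HC;
    try (eapply (pg_outs _ HB); [eassumption|econstructor; eassumption|assumption]).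
  - assert (A : adm (scons Any names) (rcv p) names).
    { intros [|n]; simpl; auto. destruct p; simpl; auto. }
    destruct (cl_link _ _ _ _ HB HF _ _ ltac:(auto) plainv_names A) as [D C].
    do 2 eexists; repeat split; [apply wt_refl|constructor; tauto|].
    apply clc_cl; constructor; auto.
  - edestruct IHouts as (Q1 & R' & W & I & RR); [eassumption|exact HF|].
    do 2 eexists; repeat split; [apply wt_parl; eauto|apply outs_parl; eauto|].
    apply clc_par; auto. apply clc_cl; auto.
  - edestruct IHouts as (Q1 & R' & W & I & RR); [eassumption|exact HF|].
    do 2 eexists; repeat split; [apply wt_par; [apply wt_refl|eauto]|apply outs_parr; eauto|].
    apply clc_par; auto. apply clc_cl; auto.
  - rewrite names_S in *.
    edestruct (fun Q => IHouts Q (pren (up S) F')) as (Q1 & R' & W & I & RR); [eassumption| |].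
    { eapply cl_pren; eauto. apply radm_up. rewrite <- names_S at 2. apply radm_S. }
    do 2 eexists; repeat split; [apply wt_nu; eauto|apply outs_nu; eauto|].
    apply clc_nu. rewrite names_S; auto.
  - edestruct IHouts as (Q1 & R' & W & I & RR); [eassumption|exact HF|].
    do 2 eexists; repeat split; [apply repl_weak; eauto|apply outs_parl; eauto|].
    apply clc_par; auto. apply clc_cl; constructor; auto.
  - edestruct IHouts as (Q1 & R' & W & I & RR); [eapply cl_inst; eassumption || auto|exact HF|].
    do 2 eexists; repeat split; [apply let_weak; eauto|eauto|auto].
Qed.

(** The input is answered first; the abstraction found in this way is the second receiver with which
    the output is answered. *)
Lemma cl_comm B P Q P' Q' a F R : progressing B ->
  inp P a F -> outs Q a F R -> cl B names P P' -> cl B names Q Q' ->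
  exists R', wt (Par P' Q') R' /\ clc B names R R'.
Proof.
  intros HB HI HO HP HQ.
  destruct (cl_inp_step _ _ _ _ HB HI _ HP) as (P1 & F' & W1 & I1 & (F1 & F2 & E1 & C & E2)).
  destruct (outs_scong _ _ _ _ HO _ E1) as (R1 & O1 & E3).
  destruct (cl_outs_step _ _ _ _ _ HB O1 _ _ HQ C) as (Q1 & R2 & W2 & O2 & C2).
  destruct (outs_scong _ _ _ _ O2 _ E2) as (R3 & O3 & E4).
  exists R3; split.
  - eapply wt_trans; [apply wt_par; eauto|apply wt_tau; eapply tau_io; eauto].
  - eapply clc_cong; [symmetry; eauto|eauto|auto].
Qed.

Lemma cl_tau_step B P R : progressing B -> tau P R -> forall Q, cl B names P Q ->
  exists R', wt Q R' /\ clc B names R R'.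
Proof.
  intros HB; induction 1; intros Q0 HC; inversion HC; subst; clear HC;
    try (eapply (pg_tau _ HB); [eassumption|econstructor; eassumption]).
  - eapply cl_comm; eauto.
  - edestruct cl_comm as (R' & W & C); try eassumption.
    exists R'; split; [rewrite sc_par_comm|]; eassumption.
  - edestruct IHtau as (Q1 & W & RR); [eassumption|].
    eexists; split; [apply wt_parl; eauto|]. apply clc_par; auto. apply clc_cl; auto.
  - edestruct IHtau as (Q1 & W & RR); [eassumption|].
    eexists; split; [apply wt_par; [apply wt_refl|eauto]|]. apply clc_par; auto. apply clc_cl; auto.
  - rewrite names_S in *. edestruct IHtau as (Q1 & W & RR); [eassumption|].
    eexists; split; [apply wt_nu; eauto|]. apply clc_nu; rewrite names_S; auto.
  - edestruct IHtau as (Q1 & W & RR); [eassumption|].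
    eexists; split; [apply repl_weak; eauto|]. apply clc_par; auto. apply clc_cl; constructor; auto.
  - edestruct (cl_comm B P P P' P') as (R' & W & RR); try eassumption.
    eexists; split.
    + rewrite (sc_repl P'), (sc_repl P'), <- sc_par_assoc. apply wt_parl; eauto.
    + apply clc_par; auto. apply clc_cl; constructor; auto.
  - edestruct IHtau as (Q1 & W & RR); [eapply cl_inst; eassumption || auto|].
    eexists; split; [apply let_weak; eauto|auto].
Qed.

Lemma cl_wt B P R : progressing B -> wt P R -> forall Q, clc B names P Q ->
  exists R', wt Q R' /\ clc B names R R'.
Proof.
  intros HB; induction 1; intros Q0 HC.
  - exists Q0; split; [apply wt_refl|]. eapply clc_cong; [eauto|reflexivity|auto].
  - destruct HC as (P1 & Q1 & E1 & C & E2). destruct (tau_cong _ _ _ E1 H) as (R1 & T1 & E3).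
    destruct (cl_tau_step _ _ _ HB T1 _ C) as (R' & W & C').
    exists R'; split; [rewrite <- E2; auto|]. eapply clc_cong; [symmetry; eauto|reflexivity|auto].
  - destruct (IHwt1 _ HC) as (Q1 & W1 & C1). destruct (IHwt2 _ C1) as (R1 & W2 & C2).
    exists R1; split; auto. eapply wt_trans; eauto.
Qed.

Lemma steps_wt P Q : steps P Q -> wt P Q.
Proof.
  induction 1.
  - destruct (step_tau _ _ H) as (y' & T & E). rewrite E. apply wt_tau; auto.
  - apply wt_refl.
  - eapply wt_trans; eauto.
Qed.

Lemma clc_bisimulation B : progressing B -> barbed_bisimulation (clc B names).
Proof.
  intros HB; split.
  - intros P Q. apply clc_sym, HB.
  - intros P Q HC; repeat split.
    + intros n Hn. destruct (barb_outs _ _ Hn) as [R O].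
      destruct HC as (P1 & Q1 & E1 & C & E2).
      destruct (outs_cong _ _ _ _ _ E1 O) as (R1 & O1 & _).
      (* A barb is observed by the receiver [Nil], which accepts every datum and is related to
         itself. *)
      destruct (cl_outs_step _ _ _ _ _ HB O1 _ Nil C (cl_nil _ _)) as (Q2 & R2 & W & O2 & _).
      rewrite E2 in W. destruct (wt_steps _ _ W) as (Q3 & S3 & E3).
      destruct (outs_cong _ _ _ _ _ (sc_sym E3) O2) as (R3 & O3 & _).
      exists Q3; split; eauto using outs_barb.
    + intros n Hn. destruct (barb_inp _ _ Hn) as [F I].
      destruct HC as (P1 & Q1 & E1 & C & E2).
      destruct (inp_cong _ _ _ _ E1 I) as (F1 & I1 & _).
      destruct (cl_inp_step _ _ _ _ HB I1 _ C) as (Q2 & F2 & W & I2 & _).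
      rewrite E2 in W. destruct (wt_steps _ _ W) as (Q3 & S3 & E3).
      destruct (inp_cong _ _ _ _ (sc_sym E3) I2) as (F3 & I3 & _).
      exists Q3; split; eauto using inp_barb.
    + intros P' HS. destruct (cl_wt _ _ _ HB (steps_wt _ _ HS) _ HC) as (Q' & W & C').
      destruct (wt_steps _ _ W) as (Q3 & S3 & E3).
      exists Q3; split; auto. eapply clc_cong; [reflexivity|symmetry; eauto|auto].
Qed.

Lemma cl_fill B K P Q : (forall V, plainv V -> cl B V P Q) ->
  forall V, plainv V -> cl B V (fill K P) (fill K Q).
Proof.
  intros H; induction K; intros V HV; simpl; auto; constructor; auto using cl_refl.
Qed.

Lemma progressing_equiv B P Q : progressing B ->
  (forall V, plainv V -> B V P Q) -> pi_equiv P Q.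
Proof.
  intros HB H K. exists (clc B names); split; [apply clc_bisimulation; auto|].
  apply clc_cl, cl_fill; auto using cl_base.
Qed.

(** * Barbed congruence as an equivalence and a congruence *)

Lemma scong_steps P Q P' : P == Q -> steps P P' -> exists Q', steps Q Q' /\ P' == Q'.
Proof.
  intros E H. destruct (wt_steps Q P') as (Q' & S' & E').
  - rewrite <- E. apply steps_wt; auto.
  - exists Q'; split; auto; symmetry; auto.
Qed.

Lemma scong_fill P Q K : P == Q -> fill K P == fill K Q.
Proof. intros E; induction K; simpl; rewrite ?IHK; auto; reflexivity. Qed.

Lemma scong_pi_equiv P Q : P == Q -> pi_equiv P Q.
Proof.
  intros E K. exists scong; split; [|apply scong_fill; auto]. clear; split.
  - intros P Q; apply sc_sym.
  - intros P Q E; repeat split.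
    + intros n (k & p & P1 & P2 & E'). exists Q; split; [apply rt_refl|].
      exists k, p, P1, P2. rewrite <- E; auto.
    + intros n (k & P1 & P2 & E'). exists Q; split; [apply rt_refl|].
      exists k, P1, P2. rewrite <- E; auto.
    + intros P' H. apply scong_steps with P; auto.
Qed.

Lemma pi_equiv_sym P Q : pi_equiv P Q -> pi_equiv Q P.
Proof. intros H K. destruct (H K) as (R & [S' B] & HR). exists R; repeat split; auto; apply B;
  auto. Qed.

Lemma weak_barbs_trans (R : relation proc) P Q : barbed_bisimulation R -> R P Q ->
  (forall n, weak_out_barb P n -> weak_out_barb Q n) /\
  (forall n, weak_in_barb P n -> weak_in_barb Q n).
Proof.
  intros [_ B] H; destruct (B _ _ H) as (_ & _ & B3); split.
  - intros n (P' & S' & O). destruct (B3 _ S') as (Q' & S2 & H').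
    destruct (B _ _ H') as (B1 & _ & _). destruct (B1 _ O) as (Q2 & S3 & O').
    exists Q2; split; auto. eapply rt_trans; eauto.
  - intros n (P' & S' & O). destruct (B3 _ S') as (Q' & S2 & H').
    destruct (B _ _ H') as (_ & B1 & _). destruct (B1 _ O) as (Q2 & S3 & O').
    exists Q2; split; auto. eapply rt_trans; eauto.
Qed.

(** The composite of two symmetric relations need not be symmetric, so both orders of composition
    are put into the candidate. *)
Lemma barbed_trans P Q R :
  barbed_bisimilar P Q -> barbed_bisimilar Q R -> barbed_bisimilar P R.
Proof.
  intros (R1 & B1 & H1) (R2 & B2 & H2).
  exists (fun A C => exists B, (R1 A B /\ R2 B C) \/ (R2 A B /\ R1 B C)); split; [|eauto].
  destruct (B1) as [S1 _], (B2) as [S2 _]. split.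
  - intros A C (B & [[HA HC]|[HA HC]]); exists B; [right|left]; split; auto.
  - assert (G : forall X Y A B C, barbed_bisimulation X -> barbed_bisimulation Y ->
      X A B -> Y B C ->
      (forall n, out_barb A n -> weak_out_barb C n) /\
      (forall n, in_barb A n -> weak_in_barb C n) /\
      (forall A', steps A A' -> exists C', steps C C' /\ exists B', X A' B' /\ Y B' C')).
    { intros X Y A B C HX HY HAB HBC.
      destruct (proj2 HX _ _ HAB) as (X1 & X2 & X3).
      destruct (weak_barbs_trans _ _ _ HY HBC) as [Y1 Y2].
      destruct (proj2 HY _ _ HBC) as (_ & _ & Y3).
      repeat split; auto.
      intros A' HA. destruct (X3 _ HA) as (B' & HB & ?). destruct (Y3 _ HB) as (C' & HC & ?).
      eauto. }
    intros A C (B & [[HA HC]|[HA HC]]).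
    + destruct (G _ _ _ _ _ B1 B2 HA HC) as (G1 & G2 & G3); repeat split; auto.
      intros A' HS; destruct (G3 _ HS) as (C' & ? & B' & ? & ?); eauto 6.
    + destruct (G _ _ _ _ _ B2 B1 HA HC) as (G1 & G2 & G3); repeat split; auto.
      intros A' HS; destruct (G3 _ HS) as (C' & ? & B' & ? & ?); eauto 7.
Qed.

#[export] Instance pi_equiv_equiv : Equivalence pi_equiv.
Proof.
  split.
  - intros P; apply scong_pi_equiv; reflexivity.
  - intros P Q; apply pi_equiv_sym.
  - intros P Q R H H' K. eapply barbed_trans; eauto.
Qed.

Fixpoint kcomp (K L : pctx) : pctx :=
  match K with
  | KHole => L
  | KParL K Q => KParL (kcomp K L) Q
  | KParR P K => KParR P (kcomp K L)
  | KRepl K => KRepl (kcomp K L)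
  | KNu K => KNu (kcomp K L)
  | KIn a K => KIn a (kcomp K L)
  | KOut a p K => KOut a p (kcomp K L)
  | KLet p K => KLet p (kcomp K L)
  end.

Lemma fill_kcomp K L P : fill (kcomp K L) P = fill K (fill L P).
Proof. induction K; simpl; congruence. Qed.

Lemma pi_equiv_fill L P Q : pi_equiv P Q -> pi_equiv (fill L P) (fill L Q).
Proof. intros H K. rewrite <- !fill_kcomp. apply H. Qed.

#[export] Instance pi_equiv_scong : subrelation scong pi_equiv.
Proof. intros P Q; apply scong_pi_equiv. Qed.
#[export] Instance Par_pi_equiv : Proper (pi_equiv ==> pi_equiv ==> pi_equiv) Par.
Proof.
  intros P P' H Q Q' H'. etransitivity.
  - apply (pi_equiv_fill (KParL KHole Q)); eauto.
  - apply (pi_equiv_fill (KParR P' KHole)); auto.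
Qed.
#[export] Instance Repl_pi_equiv : Proper (pi_equiv ==> pi_equiv) Repl.
Proof. intros P P' H; apply (pi_equiv_fill (KRepl KHole)); auto. Qed.
#[export] Instance Nu_pi_equiv : Proper (pi_equiv ==> pi_equiv) Nu.
Proof. intros P P' H; apply (pi_equiv_fill (KNu KHole)); auto. Qed.
#[export] Instance Inp_pi_equiv a : Proper (pi_equiv ==> pi_equiv) (Inp a).
Proof. intros P P' H; apply (pi_equiv_fill (KIn a KHole)); auto. Qed.
#[export] Instance Out_pi_equiv a p : Proper (pi_equiv ==> pi_equiv) (Out a p).
Proof. intros P P' H; apply (pi_equiv_fill (KOut a p KHole)); auto. Qed.
#[export] Instance Let_pi_equiv p : Proper (pi_equiv ==> pi_equiv) (Let p).
Proof. intros P P' H; apply (pi_equiv_fill (KLet p KHole)); auto. Qed.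

(** * Eliminating a private server *)

(** The server lives on the private channel 0. The last case is a forwarder whose target has been
    replaced with a pair: the output under its input prefix has become [Nil]. *)
Definition srv (v : lk) : proc :=
  match v with
  | LS N => Repl (Nu (Out 1 (DName 0) (pren (up S) N)))
  | LL X => Repl (Inp 0 (Let (DName 0) (pren (up (up (fun n => S (S n)))) X)))
  | LD (DName a) => Repl (Inp 0 (Out (S (S a)) (DName 0) Nil))
  | LD (DPair _ _) => Repl (Inp 0 Nil)
  end.

Definition server (k : kind) (V : nat -> kind) (v : lk) : Prop :=
  match k, v with
  | Rcv, LS N => ok (scons Nam V) N
  | Snd, LL X => ok (scons Nam (scons Nam V)) X
  | Snd, LD d => okd V d
  | _, _ => False
  end.

Definition law : prel := fun V P Q =>
  exists k v C, server k V v /\ ok (scons k V) C /\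
    P = Nu (Par C (srv v)) /\ Q = link (scons v (lname idn)) C.

(** ** Stability *)

Lemma lcomp_lname k V v f : server k V v -> lcomp (lname f) v = lren f v.
Proof.
  destruct k, v as [[]| |]; simpl; try tauto; auto; rewrite !lup_lname;
    intros H; rewrite (link_lname _ _ _ H); auto.
Qed.

Lemma lcomp_pay r p q : pay r p = Some q -> lcomp r (LD p) = LD q.
Proof.
  destruct p; simpl.
  - destruct (r a) as [d| |]; congruence.
  - destruct (r a) as [[]| |], (r b) as [[]| |]; congruence.
Qed.

Lemma server_lcomp k V v r V' : adm V r V' -> server k V v -> server k V' (lcomp r v).
Proof.
  intros H. destruct k, v as [d| |]; cbn [server]; try tauto.
  - intros Hs; cbn [lcomp]. eapply ok_link; [apply adm_lup|]; eauto.
  - intros Hd. destruct (adm_pay _ _ _ _ H Hd) as (q & Eq & Hq).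
    rewrite (lcomp_pay _ _ _ Eq). auto.
  - intros Hs; cbn [lcomp]. eapply ok_link; [do 2 apply adm_lup|]; eauto.
Qed.

(** A substitution that turns the target of a forwarder into a pair erases the forwarding output;
    the case [DPair] of [srv] exists to make this equation hold. *)
Lemma link_srv k V v r V' : plainv V -> adm V r V' -> server k V v ->
  link (lup r) (srv v) = srv (lcomp r v).
Proof.
  intros HV H. destruct k, v as [d| |]; cbn [server]; try tauto; intros Hs.
  - simpl. rewrite pren_link, link_pren, !lup_post, !lup_pre. reflexivity.
  - destruct (adm_pay _ _ _ _ H Hs) as (q & Eq & Hq).
    rewrite (lcomp_pay _ _ _ Eq). destruct d; simpl in Eq; simpl.
    + destruct (r a) as [[]| |]; simpl; try discriminate; injection Eq as <-; auto.
    + destruct (r a) as [[]| |], (r b) as [[]| |]; try discriminate; injection Eq as <-; auto.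
  - simpl. rewrite pren_link, link_pren. do 4 f_equal.
    extensionality n; destruct n as [|[|n]]; simpl; auto. rewrite !lren_comp. reflexivity.
Qed.

Lemma ok_weaken k V C : ok (scons k V) C -> ok (scons Nam V) C.
Proof.
  intros H. rewrite <- (pren_id C). eapply ok_pren; [|exact H].
  intros [|n]; simpl; [destruct k|destruct (V n)]; unfold plain; auto; discriminate.
Qed.

Lemma ok_srv k V v : plainv V -> server k V v -> ok (scons Nam V) (srv v).
Proof.
  intros HV. destruct k, v as [[]| |]; simpl; try tauto; intros H.
  - repeat split; auto. eapply ok_pren; [|exact H].
    apply radm_up, radm_S.
  - repeat split; auto; discriminate.
  - repeat split; auto; discriminate.
  - repeat split; auto; try discriminate. eapply ok_pren; [|exact H].
    do 2 apply radm_up. intros n; simpl. destruct (V n); unfold plain; auto; discriminate.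
Qed.

Lemma adm_server k V v : plainv V -> server k V v -> adm (scons k V) (scons v (lname idn)) V.
Proof.
  intros HV H [|n]; simpl.
  - destruct k, v as [[]| |]; simpl in *; try tauto.
    destruct H as [E|E]; rewrite E; discriminate.
  - unfold lname, idn. destruct (HV n) as [E|E]; rewrite E; simpl; rewrite ?E; unfold plain; auto.
Qed.

Lemma law_ok V P Q : plainv V -> law V P Q -> ok V P /\ ok V Q.
Proof.
  intros HV (k & v & C & Hs & HC & -> & ->); split.
  - simpl; split; [eapply ok_weaken; eauto|eapply ok_srv; eauto].
  - eapply ok_link; [apply adm_server; eauto|auto].
Qed.

Lemma server_kind k V v : server k V v -> k <> Nam /\ k <> Any.
Proof. destruct k, v as [[]| |]; simpl; try tauto; split; discriminate. Qed.

Lemma adm_nam V r V' n : adm V r V' -> V n = Nam -> exists m, r n = LD (DName m) /\ V' m = Nam.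
Proof.
  intros H E. specialize (H n). rewrite E in H.
  destruct (r n) as [[]| |]; simpl in H; try tauto; eauto.
Qed.

(** Substituting after the elimination is eliminating the substituted server from the substituted
    client: by [link_link] both orders are the same single substitution. *)
Lemma law_link V P Q r V' : plainv V -> plainv V' -> adm V r V' ->
  law V P Q -> law V' (link r P) (link r Q).
Proof.
  intros HV HV' Hr (k & v & C & Hs & HC & -> & ->).
  destruct (server_kind _ _ _ Hs) as [Hk _].
  exists k, (lcomp r v), (link (lup r) C); repeat split.
  - eapply server_lcomp; eauto.
  - eapply ok_link; [apply adm_lup|]; eauto.
  - simpl. rewrite (link_srv k V v r V'); auto.
  - rewrite !(link_link C (scons k V)); auto.
    + f_equal. extensionality n; destruct n as [|n]; simpl; unfold idn; auto.
      generalize (Hr n). destruct (r n) as [d| |]; destruct (HV n) as [-> | ->]; simpl; try tauto;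
        destruct d; auto.
    + intros [|n]; simpl; split; try (intros; tauto || discriminate).
      * intros E. destruct (adm_nam _ _ _ _ Hr E) as (m & -> & _).
        exists (S m); split; auto. eexists; reflexivity.
      * intros a b E. destruct (r n) as [[]| |]; try discriminate. injection E as <- <-.
        split; eexists; reflexivity.
    + intros [|n]; simpl; split; try (intros; tauto || discriminate).
      * intros a b ->. destruct k; simpl in Hs; try tauto. destruct Hs as [Ea Eb].
        destruct (adm_nam _ _ _ _ Hr Ea) as (m & -> & _).
        destruct (adm_nam _ _ _ _ Hr Eb) as (m' & -> & _).
        split; eexists; reflexivity.
      * intros E. destruct (adm_nam _ _ _ _ Hr E) as (m & Em & _).
        exists n; split; auto. eexists; eauto.
Qed.

Lemma adm_lname V f V' : plainv V -> radm V f V' -> adm V (lname f) V'.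
Proof.
  intros HV H n. specialize (H n). destruct (HV n) as [E|E]; rewrite E in *; simpl; auto.
Qed.

Definition lawrel : prel := fun V P Q => law V P Q \/ law V Q P.

Lemma lawrel_ok V P Q : plainv V -> lawrel V P Q -> ok V P /\ ok V Q.
Proof. intros HV [H|H]; apply law_ok in H; tauto. Qed.

(** Both sides of the law are well-kinded, hence defined under every admissible substitution; this
    settles the clause on [dfd]. *)
Lemma lawrel_stable : stable lawrel.
Proof.
  assert (L : forall V P Q r V', plainv V -> plainv V' -> adm V r V' ->
                lawrel V P Q -> lawrel V' (link r P) (link r Q)).
  { intros V P Q r V' HV HV' Hr [H|H]; [left|right]; apply (law_link V); auto. }
  constructor.
  - unfold lawrel; tauto.
  - intros V P Q f V' HV HV' Hf H. destruct (lawrel_ok _ _ _ HV H) as [HP HQ].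
    rewrite <- (link_lname _ _ f HP), <- (link_lname _ _ f HQ).
    apply (L V); auto using adm_lname.
  - intros V P Q r V' HV HV' Hr H. destruct (lawrel_ok _ _ _ HV H) as [HP HQ].
    split; [|apply (L V); auto]. split; intros _; eapply ok_dfd; eauto.
Qed.

(** ** Transitions of a substituted process *)

Definition lups (k : nat) (r : nat -> lk) : nat -> lk := Nat.iter k lup r.
Definition lift (k : nat) (V : nat -> kind) : nat -> kind := Nat.iter k (scons Nam) V.

Lemma lups_S k r : lups (S k) r = lups k (lup r).
Proof. apply Nat.iter_succ_r. Qed.

Lemma lift_S k V : lift (S k) V = lift k (scons Nam V).
Proof. apply Nat.iter_succ_r. Qed.

Lemma lups_lups j k r : lups k (lups j r) = lups (k + j) r.
Proof. symmetry; apply Nat.iter_add. Qed.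

Lemma lift_lift j k V : lift k (lift j V) = lift (k + j) V.
Proof. symmetry; apply Nat.iter_add. Qed.

Lemma lups_add k r n : lups k r (k + n) = lren (Nat.add k) (r n).
Proof.
  induction k; simpl.
  - symmetry; apply lren_id.
  - fold (lups k r). rewrite IHk, lren_comp. reflexivity.
Qed.

Lemma lift_add k V n : lift k V (k + n) = V n.
Proof. induction k; simpl; auto. Qed.

Lemma lift_lt k V n : n < k -> lift k V n = Nam.
Proof.
  revert n; induction k; intros [|n] H; simpl; auto; try lia. apply IHk; lia.
Qed.

Lemma lups_lt k r n : n < k -> lups k r n = LD (DName n).
Proof.
  revert n; induction k; intros [|n] H; simpl; auto; try lia.
  fold (lups k r). rewrite IHk by lia. reflexivity.
Qed.

Lemma link_add k r P : link (lups k r) (pren (Nat.add k) P) = pren (Nat.add k) (link r P).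
Proof. rewrite link_pren, pren_link; f_equal. extensionality n; apply lups_add. Qed.

Lemma adm_lups k V r V' : adm V r V' -> adm (lift k V) (lups k r) (lift k V').
Proof. intros H; induction k; simpl; auto. apply adm_lup; auto. Qed.

Lemma radm_add k V : radm V (Nat.add k) (lift k V).
Proof. intros n; rewrite lift_add; destruct (V n); unfold plain; auto; discriminate. Qed.

Lemma link_nus k r P : link r (nus k P) = nus k (link (lups k r) P).
Proof.
  revert r; induction k; intros r; auto.
  rewrite !nus_S. simpl. f_equal. rewrite IHk, <- lups_S. reflexivity.
Qed.

Lemma ok_nus k V P : ok V (nus k P) <-> ok (lift k V) P.
Proof.
  revert V; induction k; intros V; [reflexivity|]. rewrite nus_S, lift_S. apply IHk.
Qed.

(** The judgement [outs] hides the datum inside the receiver, which is unsuitable for applying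
    [link] to the sender. Here the datum [p], the residual and the number [k] of restrictions
    crossed are explicit; all of them are extruded, whether [p] mentions them or not. *)
Inductive outd : proc -> nat -> nat -> data -> proc -> Prop :=
| outd_out a p P : outd (Out a p P) a 0 p P
| outd_parl P Q a k p P' :
    outd P a k p P' -> outd (Par P Q) a k p (Par P' (pren (Nat.add k) Q))
| outd_parr P Q a k p Q' :
    outd Q a k p Q' -> outd (Par P Q) a k p (Par (pren (Nat.add k) P) Q')
| outd_nu P a k p P' : outd P (S a) k p P' -> outd (Nu P) a (S k) p P'
| outd_repl P a k p P' :
    outd P a k p P' -> outd (Repl P) a k p (Par P' (pren (Nat.add k) (Repl P)))
| outd_let a b P c k p P' :
    outd (pren (scons a (scons b idn)) P) c k p P' -> outd (Let (DPair a b) P) c k p P'.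

Definition rcvk (k : nat) (p : data) : nat -> lk := scons (LD p) (lname (Nat.add k)).

Lemma rcvk_S k p F : link (rcvk k p) (pren (up S) F) = link (rcvk (S k) p) F /\
  (dfd (rcvk k p) (pren (up S) F) <-> dfd (rcvk (S k) p) F).
Proof.
  rewrite link_pren, dfd_pren.
  replace (fun n => rcvk k p (up S n)) with (rcvk (S k) p); [tauto|].
  extensionality n; destruct n; simpl; auto. unfold lname. rewrite Nat.add_succ_r; auto.
Qed.

Definition conc (k : nat) (p : data) (P F : proc) : proc := nus k (Par P (link (rcvk k p) F)).

Lemma conc_par k p P F Q : conc k p (Par P (pren (Nat.add k) Q)) F == Par (conc k p P F) Q.
Proof. unfold conc. rewrite <- nus_par. apply nus_scong; pac. Qed.

Lemma conc_par_l k p P F Q : conc k p (Par (pren (Nat.add k) Q) P) F == Par Q (conc k p P F).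
Proof.
  rewrite (sc_par_comm Q), <- conc_par. unfold conc. apply nus_scong; pac.
Qed.

Lemma conc_S k p P F : conc (S k) p P F = Nu (conc k p P (pren (up S) F)).
Proof. unfold conc. rewrite (proj1 (rcvk_S k p F)). reflexivity. Qed.

Lemma outs_outd P a F R : outs P a F R ->
  exists k p P', outd P a k p P' /\ dfd (rcvk k p) F /\ R == conc k p P' F.
Proof.
  induction 1.
  - exists 0, p, P; repeat split; [constructor|exact H|reflexivity].
  - destruct IHouts as (k & p & P' & O & D & E).
    exists k, p, (Par P' (pren (Nat.add k) Q)); repeat split; [constructor; auto|auto|].
    rewrite conc_par, E; reflexivity.
  - destruct IHouts as (k & p & P' & O & D & E).
    exists k, p, (Par (pren (Nat.add k) P) P'); repeat split; [apply outd_parr; auto|auto|].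
    rewrite conc_par_l, E; reflexivity.
  - destruct IHouts as (k & p & P' & O & D & E).
    exists (S k), p, P'; repeat split; [constructor; auto|apply rcvk_S; auto|].
    rewrite conc_S, E; reflexivity.
  - destruct IHouts as (k & p & P' & O & D & E).
    exists k, p, (Par P' (pren (Nat.add k) (Repl P))); repeat split; [constructor; auto|auto|].
    rewrite conc_par, E; reflexivity.
  - destruct IHouts as (k & p & P' & O & D & E).
    exists k, p, P'; repeat split; auto; constructor; auto.
Qed.

Lemma outd_outs P a k p P' : outd P a k p P' ->
  forall F, dfd (rcvk k p) F -> exists R, outs P a F R /\ R == conc k p P' F.
Proof.
  induction 1; intros F D.
  - eexists; split; [constructor; exact D|reflexivity].
  - destruct (IHoutd _ D) as (R & O & E). eexists; split; [apply outs_parl; eauto|].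
    rewrite conc_par, E; reflexivity.
  - destruct (IHoutd _ D) as (R & O & E). eexists; split; [apply outs_parr; eauto|].
    rewrite conc_par_l, E; reflexivity.
  - destruct (IHoutd (pren (up S) F)) as (R & O & E); [apply rcvk_S; auto|].
    eexists; split; [apply outs_nu; eauto|]. rewrite conc_S, E; reflexivity.
  - destruct (IHoutd _ D) as (R & O & E). eexists; split; [apply outs_repl; eauto|].
    rewrite conc_par, E; reflexivity.
  - destruct (IHoutd _ D) as (R & O & E). eexists; split; [apply outs_let; eauto|auto].
Qed.

Lemma link_inst r a b P :
  link r (pren (scons a (scons b idn)) P) = link r (Let (DPair a b) P).
Proof. simpl. rewrite link_pren; f_equal; fext. Qed.

Lemma inp_link P a F : inp P a F -> forall r b, r a = LD (DName b) ->
  inp (link r P) b (link (lup r) F).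
Proof.
  induction 1; intros r b' E; rewrite <- ?link_inst; cbn [link]; rewrite ?link_psh; auto.
  - rewrite E. constructor.
  - constructor; auto.
  - constructor; auto.
  - rewrite link_swap. constructor. apply IHinp. simpl. rewrite E; auto.
  - apply (inp_repl (link r P)); auto.
Qed.

(** [link] has already performed the input; it remains to move the restriction of [w] and the copy
    of [N] out to the top. *)
Lemma inp_absorb P a F : inp P a F -> forall r N, r a = LS N ->
  link r P == Nu (Par N (link (lup r) F)).
Proof.
  induction 1; intros r N E; rewrite <- ?link_inst; cbn [link]; rewrite ?link_psh; auto.
  - rewrite E. reflexivity.
  - rewrite (IHinp r N E), <- nu_par_r, sc_par_assoc; reflexivity.
  - rewrite (IHinp r N E), <- sc_nu_par.
    apply Nu_scong; pac.
  - rewrite (IHinp (lup r) (pren (up S) N)) by (simpl; rewrite E; auto).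
    rewrite link_swap, sc_nu_nu. simpl.
    replace (pren swap01 (pren (up S) N)) with (psh N) by (symmetry; apply swap_up_S).
    rewrite (sc_nu_par N). reflexivity.
  - rewrite sc_repl, (IHinp r N E) at 1. rewrite <- nu_par_r, sc_par_assoc; reflexivity.
Qed.

Lemma outd_link P a k p P' : outd P a k p P' -> forall r b q, r a = LD (DName b) ->
  pay (lups k r) p = Some q -> outd (link r P) b k q (link (lups k r) P').
Proof.
  induction 1; intros r b' q Ea Ep; rewrite <- ?link_inst; cbn [link]; rewrite ?link_add; auto.
  - simpl in Ep. rewrite Ea, Ep. constructor.
  - constructor; auto.
  - constructor; auto.
  - rewrite lups_S in *. constructor. apply IHoutd; auto. simpl; rewrite Ea; auto.
  - apply (outd_repl (link r P)); auto.
Qed.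

Lemma inp_ok P a F : inp P a F -> forall V, ok V P -> V a <> Snd /\ ok (scons Any V) F.
Proof.
  induction 1; intros V H'; simpl in H'; try tauto.
  - destruct H' as [HP HQ]. destruct (IHinp _ HP). split; auto. simpl; split; auto.
    eapply ok_pren; eauto using radm_S.
  - destruct H' as [HP HQ]. destruct (IHinp _ HQ). split; auto. simpl; split; auto.
    eapply ok_pren; eauto using radm_S.
  - destruct (IHinp _ H') as [E HF]. split; auto. simpl.
    eapply ok_pren; [apply radm_swap|auto].
  - destruct (IHinp _ H'). split; auto. simpl; split; auto.
    eapply ok_pren; eauto using radm_S.
Qed.

(** The last conjunct exploits that outputs on a [Snd] channel have no continuation: the residual is
    just the rest of the process, and the message can be put back beside it. *)
Lemma outd_ok P a k p P' : outd P a k p P' -> forall V, ok V P ->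
  V a <> Rcv /\ okd (lift k V) p /\ ok (lift k V) P' /\
  (V a = Snd -> P == nus k (Par P' (Out (k + a) p Nil))).
Proof.
  induction 1; intros V H'; simpl in H'; try tauto.
  - destruct H' as ([H1|[H1 ->]] & H2 & H3); repeat split; auto.
    + destruct H1; congruence.
    + intros E; destruct H1; congruence.
    + congruence.
    + intros _. simpl. rewrite sc_par_comm. symmetry; apply sc_par_nil.
  - destruct H' as [HP HQ]. destruct (IHoutd _ HP) as (A & B & C & D); repeat split; auto.
    + eapply ok_pren; [apply radm_add|auto].
    + intros E. rewrite (D E), <- nus_par. apply nus_scong; pac.
  - destruct H' as [HP HQ]. destruct (IHoutd _ HQ) as (A & B & C & D); repeat split; auto.
    + eapply ok_pren; [apply radm_add|auto].
    + intros E. rewrite (D E), (sc_par_comm P), <- nus_par. apply nus_scong; pac.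
  - destruct (IHoutd _ H') as (A & B & C & D). rewrite lift_S; repeat split; auto.
    intros E. rewrite nus_S, (D E), Nat.add_succ_r. reflexivity.
  - destruct (IHoutd _ H') as (A & B & C & D); repeat split; auto.
    + change (ok (lift k V) (pren (Nat.add k) (Repl P))). eapply ok_pren; [apply radm_add|auto].
    + intros E. transitivity (Par P (Repl P)); [apply sc_repl|].
      rewrite (D E) at 1. rewrite <- nus_par. apply nus_scong.
      change (pren (Nat.add k) (Repl P)) with (Repl (pren (Nat.add k) P)). pac.
Qed.

(** ** The server below [j] restrictions *)

Definition rho (v : lk) (j : nat) : nat -> lk := lups j (scons v (lname idn)).
Definition kinds (k : kind) (j : nat) : nat -> kind := lift j (scons k names).
Definition srvj (v : lk) (j : nat) : proc := pren (Nat.add j) (srv v).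

Lemma rho_S v j : rho v (S j) = lup (rho v j).
Proof. reflexivity. Qed.

Lemma rho_self v j : rho v j j = lren (Nat.add j) v.
Proof. unfold rho. rewrite <- (Nat.add_0_r j) at 2. rewrite lups_add. reflexivity. Qed.

Lemma rho_skip v j n : rho v j (S j + n) = LD (DName (j + n)).
Proof. unfold rho. replace (S j + n) with (j + S n) by lia. rewrite lups_add. reflexivity. Qed.

Lemma rho_lt v j n : n < j -> rho v j n = LD (DName n).
Proof. apply lups_lt. Qed.

Lemma chan_cases j n : n < j \/ n = j \/ exists m, n = S j + m.
Proof.
  destruct (lt_eq_lt_dec n j) as [[H|H]|H]; auto.
  right; right; exists (n - S j); lia.
Qed.

Lemma rho_other v j n : n <> j -> exists m, rho v j n = LD (DName m).
Proof.
  intros H; destruct (chan_cases j n) as [H'|[H'|[m ->]]]; [|tauto|].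
  - exists n; apply rho_lt; auto.
  - eexists; apply rho_skip.
Qed.

(** Apart from [j], [rho v j] is the injective renaming that closes the gap left by [j]; so
    elimination creates no new meeting of channels. *)
Lemma rho_inj v j n n' m : n <> j -> n' <> j ->
  rho v j n = LD (DName m) -> rho v j n' = LD (DName m) -> n = n'.
Proof.
  intros H H'.
  destruct (chan_cases j n) as [L|[L|[i ->]]]; [|tauto|];
  (destruct (chan_cases j n') as [L'|[L'|[i' ->]]]; [|tauto|]);
    rewrite ?rho_skip, ?rho_lt by auto; intros [= E] [= E']; lia.
Qed.

Lemma kinds_self k j : kinds k j j = k.
Proof. unfold kinds. rewrite <- (Nat.add_0_r j) at 2. rewrite lift_add. reflexivity. Qed.

Lemma kinds_other k j n : n <> j -> kinds k j n = Nam.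
Proof.
  intros H; destruct (chan_cases j n) as [H'|[H'|[m ->]]]; [|tauto|].
  - apply lift_lt; auto.
  - unfold kinds. replace (S j + m) with (j + S m) by lia. rewrite lift_add. reflexivity.
Qed.

Lemma lift_names j : lift j names = names.
Proof. induction j; auto. simpl. fold (lift j names). rewrite IHj; apply names_S. Qed.

Lemma adm_rho k v j : server k names v -> adm (kinds k j) (rho v j) names.
Proof.
  intros H. rewrite <- (lift_names j) at 1. apply adm_lups, adm_server; auto.
Qed.

Lemma kinds_plain k v j n : server k names v -> plain (kinds k j n) -> n <> j.
Proof.
  intros H E ->. rewrite kinds_self in E. apply server_kind in H. destruct E; tauto.
Qed.

Lemma psh_srvj v j : psh (srvj v j) = srvj v (S j).
Proof. unfold psh, srvj; rewrite pren_comp; reflexivity. Qed.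

(** Weak moves of [C] in the presence of the server. As the server is replicated and kept, such
    moves compose and can be made inside one component or below a restriction. *)
Definition fires (v : lk) (j : nat) (C C' : proc) : Prop :=
  wt (Par C (srvj v j)) (Par C' (srvj v j)).

Lemma fires_cong v j C C' : C == C' -> fires v j C C'.
Proof. intros E; apply wt_cong; rewrite E; reflexivity. Qed.

Lemma fires_trans v j A B C : fires v j A B -> fires v j B C -> fires v j A C.
Proof. apply wt_trans. Qed.

#[export] Instance fires_scong v j : Proper (scong ==> scong ==> iff) (fires v j).
Proof. intros P P' E Q Q' E'; unfold fires. rewrite E, E'. reflexivity. Qed.

Lemma fires_parl v j P P' Q : fires v j P P' -> fires v j (Par P Q) (Par P' Q).
Proof.
  intros H. unfold fires in *.
  assert (A : forall X, Par (Par X Q) (srvj v j) == Par (Par X (srvj v j)) Q) by (intros; pac).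
  rewrite !A. apply wt_parl; auto.
Qed.

Lemma fires_par v j P P' Q Q' :
  fires v j P P' -> fires v j Q Q' -> fires v j (Par P Q) (Par P' Q').
Proof.
  intros H H'. eapply fires_trans; [apply fires_parl; eauto|].
  rewrite (sc_par_comm P' Q), (sc_par_comm P' Q'). apply fires_parl; auto.
Qed.

Lemma fires_nu v j P P' : fires v (S j) P P' -> fires v j (Nu P) (Nu P').
Proof.
  unfold fires; intros H. rewrite <- !nu_par_r, psh_srvj. apply wt_nu; auto.
Qed.

Lemma fires_tau v j P P' : tau P P' -> fires v j P P'.
Proof. intros; apply wt_tau, tau_parl; auto. Qed.

Lemma srv_lren v f : srv (lren f v) = pren (up f) (srv v).
Proof.
  destruct v as [[]| |]; simpl; rewrite ?pren_comp; auto.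
  all: repeat f_equal; fext.
Qed.

Lemma server_lren k V v f V' : radm V f V' -> server k V v -> server k V' (lren f v).
Proof.
  intros Hf. destruct k, v as [d| |]; cbn [server lren]; try tauto; intros H.
  - eapply ok_pren; [|exact H]. apply radm_up; auto.
  - eapply radm_okd; eauto.
  - eapply ok_pren; [|exact H]. do 2 apply radm_up; auto.
Qed.

(** Meant for input servers, before ([sbody]) and after ([body]) reception; on [LS] the value [Nil]
    is a default, while for a pair it is the erased output, as in [srv]. *)
Definition sbody (v : lk) : proc :=
  match v with
  | LL X => Let (DName 0) (pren (up (up (fun n => S (S n)))) X)
  | LD (DName a) => Out (S (S a)) (DName 0) Nil
  | _ => Nil
  end.

Definition body (v : lk) (p : data) : proc :=
  match v with
  | LL X => letx p X
  | LD (DName a) => Out a p Nil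
  | _ => Nil
  end.

Lemma srv_snd V v : server Snd V v -> srv v = Repl (Inp 0 (sbody v)).
Proof. destruct v as [[]| |]; simpl; tauto. Qed.

Lemma srv_rcv V v : server Rcv V v -> exists N, v = LS N.
Proof. destruct v as [[]| |]; simpl; try tauto; eauto. Qed.

Lemma link_sbody v k p : server Snd names v ->
  link (rcvk k p) (sbody v) = body (lren (Nat.add (S k)) v) p.
Proof.
  intros H. destruct v as [[]| |]; cbn [server] in H; try tauto.
  - simpl. unfold lname. rewrite Nat.add_succ_r. reflexivity.
  - destruct p; cbn [sbody link rcvk scons body lren letx]; rewrite link_pren.
    + change (scons (LD (DName a)) (lname (Nat.add k))) with (rcvk k (DName a)).
      rewrite <- (link_lname _ _ _ H). do 2 f_equal.
      extensionality n; destruct n as [|[|n]]; simpl; auto. rewrite Nat.add_succ_r; auto.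
    + rewrite pren_comp, <- (link_lname _ _ _ H). f_equal.
      extensionality n; destruct n as [|[|n]]; simpl; auto.
      unfold lname; rewrite Nat.add_succ_r; auto.
Qed.

Lemma ok_names V F : ok (scons Any V) F -> ok (scons Any names) F.
Proof.
  intros H. rewrite <- (pren_id F). eapply ok_pren; [|exact H].
  intros [|n]; simpl; unfold names, plain; auto. destruct (V n); auto; discriminate.
Qed.

Lemma adm_rcvk k p : adm (scons Any names) (rcvk k p) names.
Proof. intros [|n]; simpl; auto. destruct p; simpl; unfold plain; auto. Qed.

Lemma ok_dfd_rcvk V k p F : ok (scons Any V) F -> dfd (rcvk k p) F.
Proof. intros H; apply ok_names in H. eapply ok_dfd; eauto using adm_rcvk. Qed.

Lemma ok_sbody v : server Snd names v -> ok (scons Any names) (sbody v).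
Proof.
  intros H. apply (ok_names (scons Nam names)).
  pose proof (ok_srv Snd names v plainv_names H) as H'.
  rewrite (srv_snd _ _ H) in H'. apply H'.
Qed.

Lemma fires_snd v j p : server Snd names v ->
  fires v j (Out j p Nil) (body (lren (Nat.add (S j)) v) p).
Proof.
  intros H. unfold fires, srvj. rewrite (srv_snd _ _ H).
  change (pren (Nat.add j) (Repl (Inp 0 (sbody v))))
    with (Repl (Inp (j + 0) (pren (up (Nat.add j)) (sbody v)))).
  rewrite Nat.add_0_r. set (F := pren (up (Nat.add j)) (sbody v)).
  assert (E : link (rcv p) F = body (lren (Nat.add (S j)) v) p).
  { rewrite <- (link_sbody v j p H). unfold F; rewrite link_pren. f_equal. fext. }
  assert (D : dfd (rcv p) F).
  { unfold F; rewrite dfd_pren.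
    replace (fun n => rcv p (up (Nat.add j) n)) with (rcvk j p) by fext.
    eapply ok_dfd_rcvk, ok_sbody; auto. }
  rewrite (sc_repl (Inp j F)) at 1. rewrite <- sc_par_assoc. apply wt_parl.
  eapply wt_trans; [apply wt_tau; eapply tau_oi; [apply outs_out; exact D|constructor]|].
  rewrite E. apply wt_cong; pac.
Qed.

Lemma srvj_LS N j : srvj (LS N) j =
  Repl (Nu (Out (S j) (DName 0) (pren (up (Nat.add (S j))) N))).
Proof.
  unfold srvj; simpl. rewrite pren_comp, Nat.add_0_r. do 4 f_equal. fext; lia.
Qed.

Lemma outs_server_gen N j F R c :
  outs (Repl (Nu (Out (S j) (DName 0) N))) c F R ->
  c = j /\ R == Par (Nu (Par N F)) (Repl (Nu (Out (S j) (DName 0) N))).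
Proof.
  intros H. do 2 inve. match goal with H : outs (Out _ _ _) _ _ _ |- _ => inv H end. split; auto.
  rewrite link_pren.
  replace (fun n => rcv (DName 0) (up S n)) with (lname (fun n => n)) by fext.
  rewrite link_names_scong, pren_id; reflexivity.
Qed.

Lemma outs_server N j F :
  exists R, outs (Repl (Nu (Out (S j) (DName 0) N))) j F R /\
            R == Par (Nu (Par N F)) (Repl (Nu (Out (S j) (DName 0) N))).
Proof.
  eexists; split.
  - apply outs_repl, outs_nu, outs_out. rewrite dfd_pren.
    replace (fun n => rcv (DName 0) (up S n)) with (lname (fun n => n)) by fext.
    apply dfd_names.
  - rewrite link_pren.
    replace (fun n => rcv (DName 0) (up S n)) with (lname (fun n => n)) by fext.
    rewrite link_names_scong, pren_id; reflexivity.
Qed.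

Lemma fires_rcv N j C F : inp C j F ->
  fires (LS N) j C (Nu (Par (pren (up (Nat.add (S j))) N) F)).
Proof.
  intros H. unfold fires. rewrite srvj_LS.
  destruct (outs_server (pren (up (Nat.add (S j))) N) j F) as (R & O & E).
  rewrite <- E. apply wt_tau. eapply tau_io; eauto.
Qed.

(** ** Saturation *)

(** Pairs of a client and its linked form with the same head constructor. Absorbed heads are missing
    on purpose: on this view, inverting a transition of the linked process determines the head of
    the client. *)
Inductive lview (v : lk) (j : nat) : proc -> proc -> Prop :=
| lv_nil : lview v j Nil Nil
| lv_par P Q : lview v j (Par P Q) (Par (link (rho v j) P) (link (rho v j) Q))
| lv_repl P : lview v j (Repl P) (Repl (link (rho v j) P))
| lv_nu P : lview v j (Nu P) (Nu (link (rho v (S j)) P))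
| lv_inp c m P : c <> j -> rho v j c = LD (DName m) ->
    lview v j (Inp c P) (Inp m (link (lup (rho v j)) P))
| lv_out c m p q P : c <> j -> rho v j c = LD (DName m) -> pay (rho v j) p = Some q ->
    lview v j (Out c p P) (Out m q (link (rho v j) P))
| lv_let c m P : rho v j c = LD (DName m) ->
    lview v j (Let (DName c) P) (Let (DName m) (link (lup (lup (rho v j))) P)).

Lemma lview_intro k v j C : server k names v -> ok (kinds k j) C ->
  match C with Inp a _ => a <> j | Out a _ _ => a <> j | _ => True end ->
  lview v j C (link (rho v j) C).
Proof.
  intros Hs HC Ht. destruct C; simpl in *; try constructor.
  - destruct (rho_other v j a Ht) as [m E]. rewrite E. constructor; auto.
  - destruct (rho_other v j a Ht) as [m E]. rewrite E.
    destruct HC as (_ & Hp & _).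
    destruct (adm_pay _ _ _ _ (adm_rho k v j Hs) Hp) as (q & Eq & _). rewrite Eq.
    constructor; auto.
  - destruct p; [|tauto]. destruct HC as [Hp _].
    destruct (rho_other v j a (kinds_plain _ _ _ _ Hs Hp)) as [m E]. rewrite E.
    constructor; auto.
Qed.

Lemma rho_add v j : (fun n => rho v j (S j + n)) = lname (Nat.add j).
Proof. extensionality n; apply rho_skip. Qed.

Lemma lup_rho_add v j : (fun n => lup (rho v j) (up (Nat.add (S j)) n)) = lname (up (Nat.add j)).
Proof. rewrite lup_pre, rho_add. apply lup_lname. Qed.

Lemma radm_kinds k j : radm names (Nat.add (S j)) (kinds k j).
Proof. intros n; unfold names at 1. apply kinds_other. lia. Qed.

Lemma server_lift k v j : server k names v -> server k (kinds k j) (lren (Nat.add (S j)) v).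
Proof. apply server_lren, radm_kinds. Qed.

Lemma link_body v j p : server Snd names v -> okd (kinds Snd j) p ->
  link (rho v j) (body (lren (Nat.add (S j)) v) p) = link (rho v j) (Out j p Nil).
Proof.
  intros H Hp. destruct (adm_pay _ _ _ _ (adm_rho Snd v j H) Hp) as (q & Eq & _).
  simpl link at 2. rewrite rho_self, Eq.
  destruct v as [[]| |]; cbn [server] in H; try tauto; cbn [lren dren body].
  - cbn [link]. rewrite rho_skip, Eq. reflexivity.
  - rewrite link_letx, Eq.
    + f_equal. rewrite link_pren, !lup_pre, rho_add, !lup_lname.
      eapply link_lname; eauto.
    + intros a b ->. destruct Hp as [Ha Hb]. split; apply rho_other;
      intros ->; rewrite kinds_self in *; discriminate.
Qed.

Lemma ok_body v V p : okd V p -> server Snd V v -> ok V (body v p).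
Proof.
  intros Hp H. destruct v as [[]| |]; simpl in *; try tauto.
  apply ok_letx; auto.
Qed.

(** One firing is enough: the server does not use its own channel, and the datum cannot contain it
    because a [Snd] channel is never sent. *)
Lemma body_head v j p : okd (kinds Snd j) p ->
  match body (lren (Nat.add (S j)) v) p with
  | Inp a _ => a <> j | Out a _ _ => a <> j | _ => True end.
Proof.
  intros Hp. destruct v as [[]| |]; simpl; auto; [lia|].
  destruct p; simpl; auto. destruct Hp as [Ha Hb].
  assert (Ea : a <> j) by (intros ->; rewrite kinds_self in *; discriminate).
  assert (Eb : b <> j) by (intros ->; rewrite kinds_self in *; discriminate).
  destruct X; simpl; auto; destruct a0 as [|[|n]]; simpl; unfold idn; auto; lia.
Qed.

(** Firing the interaction with the server at the head of [C], if there is one, leaves a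
    head that [link] merely renames. *)
Lemma saturate k v j C : server k names v -> ok (kinds k j) C ->
  exists C0, fires v j C C0 /\ ok (kinds k j) C0 /\ lview v j C0 (link (rho v j) C).
Proof.
  intros Hs HC.
  assert (D : (exists F, C = Inp j F) \/ (exists p F, C = Out j p F) \/
    match C with Inp a _ => a <> j | Out a _ _ => a <> j | _ => True end).
  { destruct C; auto; destruct (Nat.eq_dec a j) as [->|]; eauto. }
  destruct D as [[F ->]|[(p & F & ->)|D]].
  - destruct HC as [H1 H2]. rewrite kinds_self in H1.
    destruct k; simpl in Hs; try tauto.
    destruct (srv_rcv _ _ Hs) as [N ->].
    exists (Nu (Par (pren (up (Nat.add (S j))) N) F)); repeat split.
    + apply fires_rcv; constructor.
    + apply (server_lift Rcv (LS N) j Hs).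
    + rewrite <- (pren_id F). eapply ok_pren; [|exact H2].
      intros [|n]; simpl; unfold plain; auto. destruct (kinds Rcv j n); auto; discriminate.
    + simpl link. rewrite rho_self. simpl lren.
      replace (pren (up (Nat.add j)) N)
        with (link (rho (LS N) (S j)) (pren (up (Nat.add (S j))) N)).
      * apply (lv_nu (LS N) j (Par _ F)).
      * rewrite rho_S, link_pren, lup_rho_add. eapply link_lname; eauto.
  - destruct HC as (H1 & H2 & H3). rewrite kinds_self in H1.
    destruct (server_kind _ _ _ Hs) as [K1 K2].
    destruct H1 as [[]|[-> ->]]; try tauto.
    exists (body (lren (Nat.add (S j)) v) p); repeat split.
    + apply fires_snd; auto.
    + apply ok_body; auto using server_lift.
    + rewrite <- link_body by auto. apply (lview_intro Snd); auto.
      * apply ok_body; auto using server_lift.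
      * apply body_head; auto.
  - exists C; repeat split; auto.
    + apply fires_cong; reflexivity.
    + eapply lview_intro; eauto.
Qed.

(** ** Communications *)

Lemma rho_isname k v j n : server k names v -> kinds k j n = Nam -> isname (rho v j n).
Proof.
  intros Hs E. apply rho_other. intros ->. rewrite kinds_self in E.
  apply server_kind in Hs; tauto.
Qed.

Lemma lups_rho v k j : lups k (rho v j) = rho v (k + j).
Proof. apply lups_lups. Qed.

Lemma lift_kinds k kd j : lift k (kinds kd j) = kinds kd (k + j).
Proof. apply lift_lift. Qed.

(** Reception commutes with elimination. By [link_link] both sides are single substitutions, and the
    server meets only the renaming by [k], which merely shifts it. *)
Lemma link_rcvk kd v j k p q F : server kd names v -> ok (scons Any (kinds kd j)) F ->
  okd (kinds kd (k + j)) p -> pay (rho v (k + j)) p = Some q ->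
  link (rho v (k + j)) (link (rcvk k p) F) = link (rcvk k q) (link (lup (rho v j)) F).
Proof.
  intros Hs HF Hp Eq.
  rewrite !(link_link F (scons Any (kinds kd j))); auto.
  - f_equal. extensionality n; destruct n as [|n]; simpl.
    + apply (lcomp_pay _ _ _ Eq).
    + rewrite <- lups_rho, lups_add.
      destruct (Nat.eq_dec n j) as [->|H].
      * rewrite rho_self, !lren_comp. rewrite lcomp_lren.
        -- symmetry; apply (lcomp_lname _ _ _ (fun n => k + (j + n)) Hs).
        -- intros a b _; split; eexists; reflexivity.
      * destruct (rho_other v j n H) as [m ->]. reflexivity.
  - intros [|n]; simpl; split; try discriminate.
    + intros E. destruct (rho_isname _ _ _ _ Hs E) as [m ->].
      exists (S m); split; auto. eexists; reflexivity.
    + intros a b E. destruct (rho v j n) as [[]| |]; try discriminate.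
      injection E as <- <-. split; eexists; reflexivity.
  - intros [|n]; simpl; split; try discriminate.
    + intros a b [= ->]. destruct Hp; split; eapply rho_isname; eauto.
    + intros E. exists (k + n); split; auto.
      eapply rho_isname; eauto. rewrite <- lift_kinds, lift_add; auto.
Qed.

Lemma ok_conc kd v j k p P F : server kd names v -> ok (scons Any (kinds kd j)) F ->
  okd (kinds kd (k + j)) p -> ok (kinds kd (k + j)) P -> ok (kinds kd j) (conc k p P F).
Proof.
  intros Hs HF Hp HP. unfold conc. rewrite ok_nus, lift_kinds. split; auto.
  eapply ok_link; [|exact HF]. intros [|n]; simpl; auto.
  rewrite <- lift_kinds. destruct (server_kind _ _ _ Hs).
  destruct (kinds kd j n) eqn:E; simpl; rewrite lift_add, E; unfold plain; auto; discriminate.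
Qed.

Lemma link_conc kd v j k p q P F : server kd names v -> ok (scons Any (kinds kd j)) F ->
  okd (kinds kd (k + j)) p -> pay (rho v (k + j)) p = Some q ->
  link (rho v j) (conc k p P F) = conc k q (link (rho v (k + j)) P) (link (lup (rho v j)) F).
Proof.
  intros Hs HF Hp Eq. unfold conc. rewrite link_nus, lups_rho. simpl.
  erewrite link_rcvk; eauto.
Qed.

Lemma ok_link_abs kd v j F : server kd names v -> ok (scons Any (kinds kd j)) F ->
  ok (scons Any names) (link (lup (rho v j)) F).
Proof. intros; eapply ok_link; [apply adm_lup, adm_rho|]; eauto. Qed.

Lemma comm_link kd v j P Q a F R : server kd names v ->
  ok (kinds kd j) P -> ok (kinds kd j) Q -> inp P a F -> outs Q a F R ->
  exists R' X b G, R == R' /\ ok (kinds kd j) R' /\ X == link (rho v j) R' /\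
    inp (link (rho v j) P) b G /\ outs (link (rho v j) Q) b G X.
Proof.
  intros Hs HP HQ HI HO. destruct (inp_ok _ _ _ HI _ HP) as [Ha HF].
  destruct (outs_outd _ _ _ _ HO) as (k & p & Q' & O & D & E).
  destruct (outd_ok _ _ _ _ _ O _ HQ) as (Ha' & Hp & HQ' & _). rewrite lift_kinds in *.
  (* Two clients cannot communicate on the server channel: all of them receive on it, or all of them
     send. *)
  assert (Hj : a <> j).
  { intros ->. rewrite kinds_self in *. destruct kd; simpl in Hs; tauto || congruence. }
  destruct (rho_other v j a Hj) as [b Eb].
  destruct (adm_pay _ _ _ _ (adm_rho kd v (k + j) Hs) Hp) as (q & Eq & _).
  pose proof (inp_link _ _ _ HI _ _ Eb) as HI'.
  rewrite <- lups_rho in Eq. pose proof (outd_link _ _ _ _ _ O _ _ _ Eb Eq) as O'.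
  rewrite lups_rho in *.
  destruct (outd_outs _ _ _ _ _ O' (link (lup (rho v j)) F)) as (X & HX & EX).
  { eapply ok_dfd_rcvk, ok_link_abs; eauto. }
  exists (conc k p Q' F), X, b, (link (lup (rho v j)) F); repeat split; auto.
  - eapply ok_conc; eauto.
  - rewrite EX. erewrite link_conc; eauto. reflexivity.
Qed.

Lemma tau_link kd v C C' : server kd names v -> tau C C' -> forall j, ok (kinds kd j) C ->
  exists R X, C' == R /\ ok (kinds kd j) R /\ X == link (rho v j) R /\ tau (link (rho v j) C) X.
Proof.
  intros Hs; induction 1; intros j HC; simpl in HC; try tauto.
  - destruct HC as [HP HQ].
    destruct (comm_link _ _ _ _ _ _ _ _ Hs HP HQ H H0) as (R' & X & b & G & E & HR & EX & I & O).
    exists R', X; repeat split; auto. eapply tau_io; eauto.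
  - destruct HC as [HP HQ].
    destruct (comm_link _ _ _ _ _ _ _ _ Hs HQ HP H0 H) as (R' & X & b & G & E & HR & EX & I & O).
    exists R', X; repeat split; auto. eapply tau_oi; eauto.
  - destruct HC as [HP HQ]. destruct (IHtau _ HP) as (R' & X & E & HR & EX & T).
    exists (Par R' Q), (Par X (link (rho v j) Q)); repeat split; auto.
    + rewrite E; reflexivity.
    + simpl; rewrite EX; reflexivity.
    + apply tau_parl; auto.
  - destruct HC as [HP HQ]. destruct (IHtau _ HQ) as (R' & X & E & HR & EX & T).
    exists (Par P R'), (Par (link (rho v j) P) X); repeat split; auto.
    + rewrite E; reflexivity.
    + simpl; rewrite EX; reflexivity.
    + apply tau_parr; auto.
  - destruct (IHtau (S j) HC) as (R' & X & E & HR & EX & T).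
    exists (Nu R'), (Nu X); repeat split; auto.
    + rewrite E; reflexivity.
    + simpl; rewrite EX; reflexivity.
    + apply tau_nu; auto.
  - destruct (IHtau _ HC) as (R' & X & E & HR & EX & T).
    exists (Par R' (Repl P)), (Par X (Repl (link (rho v j) P))); repeat split; auto.
    + rewrite E; reflexivity.
    + simpl; rewrite EX; reflexivity.
    + apply tau_repl; auto.
  - destruct (comm_link _ _ _ _ _ _ _ _ Hs HC HC H H0) as (R' & X & b & G & E & HR & EX & I & O).
    exists (Par R' (Repl P)), (Par X (Repl (link (rho v j) P))); repeat split; auto.
    + rewrite E; reflexivity.
    + simpl; rewrite EX; reflexivity.
    + eapply tau_repl_io; eauto.
Qed.

(** ** Transitions of [link], backwards *)

Ltac view C Hs HC :=
  let C0 := fresh "C0" in let W := fresh "W" in let HC0 := fresh "HC0" in let L := fresh "L" in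
  destruct (saturate _ _ _ C Hs HC) as (C0 & W & HC0 & L).

(** Along the derivation of the transition, the client is saturated before each inversion. The
    answer is thus a series of firings followed by an input on a channel other than that of the
    server. *)
Lemma inp_link_inv kd v X b G : server kd names v -> inp X b G ->
  forall j C, X = link (rho v j) C -> ok (kinds kd j) C ->
  exists C1 c F, fires v j C C1 /\ ok (kinds kd j) C1 /\ inp C1 c F /\ c <> j /\
    rho v j c = LD (DName b) /\ G = link (lup (rho v j)) F.
Proof.
  intros Hs; induction 1; intros j C EX HC; view C Hs HC; rewrite <- EX in L; inv L;
    simpl in HC0; try tauto.
  - exists (Inp c P0), c, P0.
    refine (conj W (conj HC0 (conj (inp_in _ _) (conj _ (conj _ _))))); auto.
  - destruct HC0 as [HP HQ].
    destruct (IHinp _ _ eq_refl HP) as (C1 & c & F0 & W1 & H1 & I & Hc & E & ->).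
    exists (Par C1 Q0), c, (Par F0 (psh Q0)). repeat split; auto.
    + eapply fires_trans; [exact W|apply fires_parl; auto].
    + apply inp_parl; auto.
    + simpl; rewrite link_psh; auto.
  - destruct HC0 as [HP HQ].
    destruct (IHinp _ _ eq_refl HQ) as (C1 & c & F0 & W1 & H1 & I & Hc & E & ->).
    exists (Par P0 C1), c, (Par (psh P0) F0). repeat split; auto.
    + eapply fires_trans; [exact W|apply fires_par; auto; apply fires_cong; reflexivity].
    + apply inp_parr; auto.
    + simpl; rewrite link_psh; auto.
  - destruct (IHinp (S j) _ eq_refl HC0) as (C1 & c & F0 & W1 & H1 & I & Hc & E & ->).
    destruct c as [|c]; [discriminate|]. rewrite rho_S in *.
    exists (Nu C1), c, (Nu (pren swap01 F0)). repeat split; auto.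
    + eapply fires_trans; [exact W|apply fires_nu; auto].
    + apply inp_nu; auto.
    + simpl in E. destruct (rho_other v j c) as [m Em]; [auto|].
      rewrite Em in *. simpl in E. congruence.
    + simpl. rewrite link_swap; auto.
  - destruct (IHinp _ _ eq_refl HC0) as (C1 & c & F0 & W1 & H1 & I & Hc & E & ->).
    exists (Par C1 (Repl P0)), c, (Par F0 (psh (Repl P0))). repeat split; auto.
    + eapply fires_trans; [exact W|]. rewrite (sc_repl P0) at 1. apply fires_parl; auto.
    + apply inp_parl; auto.
    + simpl; rewrite psh_repl; simpl; rewrite link_psh; auto.
Qed.

Lemma outd_link_inv kd v X b k q X' : server kd names v -> outd X b k q X' ->
  forall j C, X = link (rho v j) C -> ok (kinds kd j) C ->
  exists C1 c p C', fires v j C C1 /\ ok (kinds kd j) C1 /\ outd C1 c k p C' /\ c <> j /\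
    rho v j c = LD (DName b) /\ pay (rho v (k + j)) p = Some q /\ X' = link (rho v (k + j)) C'.
Proof.
  intros Hs; induction 1; intros j C EX HC; view C Hs HC; rewrite <- EX in L; inv L;
    simpl in HC0; try tauto.
  - exists (Out c p0 P0), c, p0, P0.
    refine (conj W (conj HC0 (conj (outd_out _ _ _) (conj _ (conj _ (conj _ _)))))); auto.
  - destruct HC0 as [HP HQ].
    destruct (IHoutd _ _ eq_refl HP) as (C1 & c & p' & C' & W1 & H1 & O & Hc & E & Ep & ->).
    exists (Par C1 Q0), c, p', (Par C' (pren (Nat.add k) Q0)). repeat split; auto.
    + eapply fires_trans; [exact W|apply fires_parl; auto].
    + apply outd_parl; auto.
    + simpl; rewrite <- lups_rho, link_add; auto.
  - destruct HC0 as [HP HQ].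
    destruct (IHoutd _ _ eq_refl HQ) as (C1 & c & p' & C' & W1 & H1 & O & Hc & E & Ep & ->).
    exists (Par P0 C1), c, p', (Par (pren (Nat.add k) P0) C'). repeat split; auto.
    + eapply fires_trans; [exact W|apply fires_par; auto; apply fires_cong; reflexivity].
    + apply outd_parr; auto.
    + simpl; rewrite <- lups_rho, link_add; auto.
  - destruct (IHoutd (S j) _ eq_refl HC0) as (C1 & c & p' & C' & W1 & H1 & O & Hc & E & Ep & ->).
    destruct c as [|c]; [discriminate|]. rewrite Nat.add_succ_r, rho_S in *.
    exists (Nu C1), c, p', C'. repeat split; auto.
    + eapply fires_trans; [exact W|apply fires_nu; auto].
    + apply outd_nu; auto.
    + simpl in E. destruct (rho_other v j c) as [m Em]; [auto|].
      rewrite Em in *. simpl in E. congruence.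
  - destruct (IHoutd _ _ eq_refl HC0) as (C1 & c & p' & C' & W1 & H1 & O & Hc & E & Ep & ->).
    exists (Par C1 (Repl P0)), c, p', (Par C' (pren (Nat.add k) (Repl P0))). repeat split; auto.
    + eapply fires_trans; [exact W|]. rewrite (sc_repl P0) at 1. apply fires_parl; auto.
    + apply outd_parl; auto.
    + cbn [link]. f_equal. rewrite <- lups_rho, link_add. reflexivity.
Qed.

Lemma comm_link_inv kd v j P Q b G R : server kd names v ->
  ok (kinds kd j) P -> ok (kinds kd j) Q ->
  inp (link (rho v j) P) b G -> outs (link (rho v j) Q) b G R ->
  exists C', fires v j (Par P Q) C' /\ ok (kinds kd j) C' /\ R == link (rho v j) C'.
Proof.
  intros Hs HP HQ HI HO.
  destruct (inp_link_inv _ _ _ _ _ Hs HI _ _ eq_refl HP)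
    as (P1 & c & F & W & HP1 & I & Hc & E & ->).
  destruct (outs_outd _ _ _ _ HO) as (k & q & Q' & O & D & ER).
  destruct (outd_link_inv _ _ _ _ _ _ _ Hs O _ _ eq_refl HQ)
    as (Q1 & c' & p & C' & W' & HQ1 & O' & Hc' & E' & Ep & ->).
  (* Both prefixes became prefixes on [b]; away from [j] this forces them to have had the same
     subject. *)
  assert (c' = c) as -> by (eapply rho_inj; eauto).
  destruct (inp_ok _ _ _ I _ HP1) as [_ HF].
  destruct (outd_ok _ _ _ _ _ O' _ HQ1) as (_ & Hp & HC' & _). rewrite lift_kinds in *.
  destruct (outd_outs _ _ _ _ _ O' F) as (R1 & O1 & E1); [eapply ok_dfd_rcvk; eauto|].
  exists (conc k p C' F); repeat split.
  - eapply fires_trans; [apply fires_par; eauto|]. rewrite <- E1.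
    apply fires_tau. eapply tau_io; eauto.
  - eapply ok_conc; eauto.
  - rewrite ER. erewrite link_conc; eauto. reflexivity.
Qed.

Lemma tau_link_inv kd v X R : server kd names v -> tau X R ->
  forall j C, X = link (rho v j) C -> ok (kinds kd j) C ->
  exists C', fires v j C C' /\ ok (kinds kd j) C' /\ R == link (rho v j) C'.
Proof.
  intros Hs; induction 1; intros j C EX HC; view C Hs HC; rewrite <- EX in L; inv L;
    simpl in HC0; try tauto.
  - destruct HC0 as [HP HQ].
    destruct (comm_link_inv _ _ _ _ _ _ _ _ Hs HP HQ H H0) as (C' & W' & HC' & E).
    exists C'; repeat split; auto. eapply fires_trans; eauto.
  - destruct HC0 as [HP HQ].
    destruct (comm_link_inv _ _ _ _ _ _ _ _ Hs HQ HP H0 H) as (C' & W' & HC' & E).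
    exists C'; repeat split; auto. eapply fires_trans; [exact W|].
    rewrite sc_par_comm; auto.
  - destruct HC0 as [HP HQ]. destruct (IHtau _ _ eq_refl HP) as (C' & W' & HC' & E).
    exists (Par C' Q0); repeat split; auto.
    + eapply fires_trans; [exact W|apply fires_parl; auto].
    + simpl; rewrite E; reflexivity.
  - destruct HC0 as [HP HQ]. destruct (IHtau _ _ eq_refl HQ) as (C' & W' & HC' & E).
    exists (Par P0 C'); repeat split; auto.
    + eapply fires_trans; [exact W|apply fires_par; auto; apply fires_cong; reflexivity].
    + simpl; rewrite E; reflexivity.
  - destruct (IHtau (S j) _ eq_refl HC0) as (C' & W' & HC' & E).
    exists (Nu C'); repeat split; auto.
    + eapply fires_trans; [exact W|apply fires_nu; auto].
    + simpl; rewrite E; reflexivity.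
  - destruct (IHtau _ _ eq_refl HC0) as (C' & W' & HC' & E).
    exists (Par C' (Repl P0)); repeat split; auto.
    + eapply fires_trans; [exact W|]. rewrite (sc_repl P0) at 1. apply fires_parl; auto.
    + simpl; rewrite E; reflexivity.
  - destruct (comm_link_inv _ _ _ _ _ _ _ _ Hs HC0 HC0 H H0) as (C' & W' & HC' & E).
    exists (Par C' (Repl P0)); repeat split; auto.
    + eapply fires_trans; [exact W|]. rewrite (sc_repl P0), (sc_repl P0), <- sc_par_assoc at 1.
      apply fires_parl; auto.
    + simpl; rewrite E; reflexivity.
Qed.

(** ** The law *)

(** The cycle for moving the outermost of [k + 1] restrictions to the innermost place: channel [k]
    becomes 0 and those below it move up. It brings the server's restriction inside extruded
    ones. *)
Definition rot (k n : nat) : nat := if n <? k then S n else if n =? k then 0 else n.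

Lemma iter_up k f n : Nat.iter k up f n = if n <? k then n else k + f (n - k).
Proof.
  revert n; induction k; intros n; simpl.
  - rewrite Nat.sub_0_r; auto.
  - destruct n; simpl; auto. rewrite IHk.
    change (S n <? S k) with (n <? k). destruct (n <? k); auto.
Qed.

Lemma pren_nus k : forall f P, pren f (nus k P) = nus k (pren (Nat.iter k up f) P).
Proof.
  induction k; intros f P; auto. rewrite !nus_S. simpl pren. rewrite IHk, <- Nat.iter_succ_r.
  reflexivity.
Qed.

Lemma rot_S k : (fun n => rot k (Nat.iter k up swap01 n)) = rot (S k).
Proof.
  extensionality n. rewrite iter_up. unfold rot.
  destruct (Nat.ltb_spec n k); [rewrite (proj2 (Nat.ltb_lt n k)) by auto|].
  - destruct (Nat.ltb_spec n (S k)); auto; lia.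
  - destruct (Nat.eq_dec n k) as [->|]; [|destruct (Nat.eq_dec n (S k)) as [->|]].
    + rewrite Nat.sub_diag. simpl swap01.
      destruct (Nat.ltb_spec (k + 1) k), (Nat.eqb_spec (k + 1) k), (Nat.ltb_spec k (S k)); lia.
    + replace (S k - k) with 1 by lia. simpl swap01. rewrite Nat.add_0_r.
      rewrite Nat.ltb_irrefl, !Nat.eqb_refl, Nat.ltb_irrefl; auto.
    + replace (n - k) with (S (S (n - k - 2))) by lia. simpl swap01.
      replace (k + S (S (n - k - 2))) with n by lia.
      destruct (Nat.ltb_spec n k), (Nat.eqb_spec n k), (Nat.ltb_spec n (S k)), (Nat.eqb_spec n (S k)); lia.
Qed.

Lemma nu_nus k : forall P, Nu (nus k P) == nus k (Nu (pren (rot k) P)).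
Proof.
  induction k; intros P.
  - simpl. replace (rot 0) with (fun n : nat => n); [rewrite pren_id; reflexivity|].
    extensionality n; destruct n; reflexivity.
  - rewrite !nus_S, sc_nu_nu, pren_nus, IHk, pren_comp, rot_S. reflexivity.
Qed.

Lemma rot_add k n : rot k (k + S n) = k + S n.
Proof.
  unfold rot. destruct (Nat.ltb_spec (k + S n) k), (Nat.eqb_spec (k + S n) k); lia.
Qed.

Lemma rot_self k : rot k k = 0.
Proof. unfold rot. rewrite Nat.ltb_irrefl, Nat.eqb_refl; auto. Qed.

Lemma rot_rho v k n m : n <> k -> rho v k n = LD (DName m) -> rot k n = S m.
Proof.
  intros H. unfold rot. destruct (chan_cases k n) as [L|[L|[i ->]]]; [|tauto|].
  - rewrite rho_lt by auto. intros [= <-]. rewrite (proj2 (Nat.ltb_lt n k)); auto.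
  - rewrite rho_skip. intros [= <-].
    destruct (Nat.ltb_spec (S k + i) k), (Nat.eqb_spec (S k + i) k); lia.
Qed.

Lemma rho_rot v k : (fun n => scons (lren (Nat.add k) v) (lname idn) (rot k n)) = rho v k.
Proof.
  extensionality n. destruct (Nat.eq_dec n k) as [->|H].
  - rewrite rho_self, rot_self. reflexivity.
  - destruct (rho_other v k n H) as [m E]. rewrite E, (rot_rho v k n m H E). reflexivity.
Qed.

Lemma clc_nus B k P Q : clc B names P Q -> clc B names (nus k P) (nus k Q).
Proof.
  intros H; induction k; auto. rewrite !nus_S. apply clc_nu. rewrite names_S; auto.
Qed.

Lemma pay_rot kd v k p q : server kd names v -> okd (kinds kd k) p ->
  pay (rho v k) p = Some q -> dren (rot k) p = dren S q.
Proof.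
  intros Hs. destruct p as [a|a b]; simpl.
  - intros Hp. pose proof (kinds_plain _ _ _ _ Hs Hp) as Ha.
    destruct (rho_other v k a Ha) as [m E]. rewrite E. intros [= <-].
    rewrite (rot_rho v k a m Ha E); auto.
  - intros [Ha Hb].
    assert (Ha' : a <> k) by (eapply kinds_plain; eauto; rewrite Ha; auto).
    assert (Hb' : b <> k) by (eapply kinds_plain; eauto; rewrite Hb; auto).
    destruct (rho_other v k a Ha') as [m E], (rho_other v k b Hb') as [m' E'].
    rewrite E, E'. intros [= <-]. simpl.
    rewrite (rot_rho v k a m Ha' E), (rot_rho v k b m' Hb' E'); auto.
Qed.

(** After an input of the client the abstractions are again an instance of the law, with the pending
    datum as an additional [Any] channel. *)
Lemma law_abs kd v F : server kd names v -> ok (scons Any (kinds kd 0)) F ->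
  law (scons Any names) (Nu (pren swap01 (Par F (psh (srv v))))) (link (lup (rho v 0)) F).
Proof.
  intros Hs HF. exists kd, (lren S v), (pren swap01 F); repeat split.
  - eapply server_lren; eauto. apply radm_S.
  - eapply ok_pren; [|exact HF]. apply radm_swap.
  - simpl. do 2 f_equal. rewrite srv_lren. unfold psh; rewrite pren_comp.
    replace (up S) with (fun n => swap01 (S n)) by fext. reflexivity.
  - rewrite link_pren. f_equal. extensionality n; destruct n as [|[|n]]; reflexivity.
Qed.

Lemma rcvk_rot k p q F : dren (rot k) p = dren S q ->
  pren (rot k) (link (rcvk k p) (pren (up S) F)) = psh (link (rcvk k q) F) /\
  (dfd (rcvk k p) (pren (up S) F) <-> dfd (rcvk k q) F).
Proof.
  intros E.
  assert (E' : (fun n => lren (rot k) (rcvk k p (up S n))) = fun n => lren S (rcvk k q n)).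
  { extensionality n; destruct n; simpl; [rewrite E; auto|].
    rewrite rot_add, Nat.add_succ_r. auto. }
  split.
  - unfold psh. rewrite link_pren, !pren_link, E'; auto.
  - rewrite dfd_pren, <- (dfd_post F (rot k)), E'. apply dfd_post.
Qed.

(** After an output of the client, the restriction of the server is moved inside the [k] extruded
    ones, and the receiver, which does not know the server, out of its scope. What is left is the
    law for the residual, in a context made of [k] restrictions and the receiver; hence the need for
    bisimulation up to contexts. *)
Lemma law_conc kd v k p q C F F' : server kd names v -> ok (kinds kd k) C ->
  okd (kinds kd k) p -> pay (rho v k) p = Some q ->
  cl lawrel (scons Any names) F F' ->
  clc lawrel names (Nu (Par (conc k p C (pren (up S) F)) (srv v)))
                   (conc k q (link (rho v k) C) F').
Proof.
  intros Hs HC Hp Eq HF.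
  pose proof (pay_rot _ _ _ _ _ Hs Hp Eq) as Er.
  apply clc_cong with
    (P := nus k (Par (Nu (Par (pren (rot k) C) (srv (lren (Nat.add k) v)))) (link (rcvk k q) F)))
    (Q := conc k q (link (rho v k) C) F').
  - symmetry. rewrite <- conc_par. unfold conc. rewrite nu_nus. apply nus_scong.
    cbn [pren]. rewrite (proj1 (rcvk_rot k p q F Er)).
    rewrite <- nu_par_r. apply Nu_scong.
    rewrite srv_lren, pren_comp.
    replace (fun n => rot k (k + n)) with (up (Nat.add k)); [pac|].
    extensionality n; destruct n; [rewrite Nat.add_0_r, rot_self; auto|].
    rewrite rot_add. simpl. lia.
  - reflexivity.
  - apply clc_nus, clc_par; apply clc_cl.
    + apply cl_base. left. exists kd, (lren (Nat.add k) v), (pren (rot k) C); repeat split.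
      * eapply server_lren; eauto. intros n; reflexivity.
      * eapply ok_pren; [|exact HC]. intros n. destruct (Nat.eq_dec n k) as [->|H].
        -- rewrite kinds_self, rot_self. destruct (server_kind _ _ _ Hs).
           simpl. destruct kd; try tauto; discriminate.
        -- rewrite kinds_other by auto. destruct (rho_other v k n H) as [m E].
           rewrite (rot_rho v k n m H E). reflexivity.
      * rewrite link_pren, rho_rot; auto.
    + apply (cl_link _ _ _ _ lawrel_stable HF); auto using adm_rcvk.
Qed.

Lemma srv_inp k V v c F : server k V v -> inp (srv v) c F ->
  k = Snd /\ c = 0 /\ F = Par (sbody v) (psh (srv v)).
Proof.
  intros Hs H. destruct k, v as [[]| |]; simpl in Hs; try tauto; simpl in H; inve; try inve;
    match goal with H : inp _ _ _ |- _ => inv H end; auto.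
Qed.

Lemma srv_outs k V v c F R : server k V v -> outs (srv v) c F R ->
  exists N, v = LS N /\ c = 0 /\ R == Par (Nu (Par (pren (up S) N) F)) (srv v).
Proof.
  intros Hs H. destruct k, v as [[]| |]; simpl in Hs; try tauto;
    try (simpl in H; inve; match goal with H : outs (Inp _ _) _ _ _ |- _ => inv H end; fail).
  exists N. destruct (outs_server_gen _ _ _ _ _ H) as [-> E]. auto.
Qed.

Lemma srv_tau k V v R : server k V v -> tau (srv v) R -> False.
Proof.
  intros Hs H. destruct k, v as [[]| |]; simpl in Hs; try tauto; simpl in H; inve;
    repeat match goal with
    | H : tau (Inp _ _) _ |- _ => inv H
    | H : tau (Out _ _ _) _ |- _ => inv H
    | H : outs (Inp _ _) _ _ _ |- _ => inv H
    | H : inp (Out _ _ _) _ _ |- _ => inv H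
    | _ => inve
    end.
Qed.

Lemma srvj_0 v : srvj v 0 = srv v.
Proof. exact (pren_id (srv v)). Qed.

Lemma law_intro kd v C : server kd names v -> ok (kinds kd 0) C ->
  law names (Nu (Par C (srv v))) (link (rho v 0) C).
Proof. intros Hs HC. exists kd, v, C; auto. Qed.

(** For an interaction between client and server: its effect was anticipated by [link], so the
    linked process stays where it is. *)
Lemma law_absorbed kd v C C' R : server kd names v -> ok (kinds kd 0) C' ->
  R == Par C' (srv v) -> link (rho v 0) C == link (rho v 0) C' ->
  clc lawrel names (Nu R) (link (rho v 0) C).
Proof.
  intros Hs HC' ER E. eapply clc_cong; [rewrite ER; reflexivity|symmetry; exact E|].
  apply clc_cl, cl_base. left. eapply law_intro; eauto.
Qed.

Lemma law_inp P Q a F : law names P Q -> inp P a F ->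
  exists Q1 F', wt Q Q1 /\ inp Q1 a F' /\ clc lawrel (scons Any names) F F'.
Proof.
  intros (kd & v & C & Hs & HC & -> & ->) H.
  change (scons kd names) with (kinds kd 0) in HC. do 2 inve.
  - match goal with H : inp C _ _ |- _ => rename H into I end.
    destruct (inp_ok _ _ _ I _ HC) as [_ HF].
    eexists _, _; repeat split; [apply wt_refl|apply (inp_link _ _ _ I (rho v 0)); reflexivity|].
    apply clc_cl, cl_base. left. eapply (law_abs kd); eauto.
  - match goal with H : inp (srv _) _ _ |- _ =>
      destruct (srv_inp _ _ _ _ _ Hs H) as (_ & E & _); discriminate E end.
Qed.

Lemma outd_link_rho kd v C a k p C' : server kd names v -> ok (kinds kd 0) C ->
  outd C (S a) k p C' ->
  ok (kinds kd k) C' /\ okd (kinds kd k) p /\ exists q, pay (rho v k) p = Some q /\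
    outd (link (rho v 0) C) a k q (link (rho v k) C').
Proof.
  intros Hs HC O. destruct (outd_ok _ _ _ _ _ O _ HC) as (_ & Hp & HC' & _).
  rewrite lift_kinds, Nat.add_0_r in *. repeat split; auto.
  destruct (adm_pay _ _ _ _ (adm_rho kd v k Hs) Hp) as (q & Eq & _).
  exists q; split; auto. exact (outd_link _ _ _ _ _ O (rho v 0) a q eq_refl Eq).
Qed.

Lemma law_outs P Q a F F' R : law names P Q -> outs P a F R ->
  cl lawrel (scons Any names) F F' ->
  exists Q1 R', wt Q Q1 /\ outs Q1 a F' R' /\ clc lawrel names R R'.
Proof.
  intros (kd & v & C & Hs & HC & -> & ->) H HF.
  change (scons kd names) with (kinds kd 0) in HC. do 2 inve.
  - match goal with H : outs C _ _ _ |- _ => destruct (outs_outd _ _ _ _ H)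
      as (k & p & C' & O & D & E) end.
    destruct (outd_link_rho _ _ _ _ _ _ _ Hs HC O) as (HC' & Hp & q & Eq & O').
    destruct (rcvk_rot k p q F (pay_rot _ _ _ _ _ Hs Hp Eq)) as [_ D1].
    destruct (cl_link _ _ _ _ lawrel_stable HF (rcvk k q) names) as [D2 _]; auto using adm_rcvk.
    destruct (outd_outs _ _ _ _ _ O' F') as (R' & O2 & E2); [tauto|].
    exists (link (rho v 0) C), R'; repeat split; [apply wt_refl|auto|].
    eapply clc_cong; [rewrite E; reflexivity|symmetry; exact E2|].
    eapply law_conc; eauto.
  - match goal with H : outs (srv _) _ _ _ |- _ =>
      destruct (srv_outs _ _ _ _ _ _ Hs H) as (N & _ & E & _); discriminate E end.
Qed.

Lemma law_tau P Q R : law names P Q -> tau P R ->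
  exists R', wt Q R' /\ clc lawrel names R R'.
Proof.
  intros (kd & v & C & Hs & HC & -> & ->) H.
  change (scons kd names) with (kinds kd 0) in HC. do 2 inve.
  (* The client receives a fresh name from an output server. *)
  - match goal with H : outs (srv _) _ _ _ |- _ =>
      destruct (srv_outs _ _ _ _ _ _ Hs H) as (N & -> & -> & E) end.
    destruct kd; simpl in Hs; try tauto.
    match goal with H : inp C _ _ |- _ => rename H into I end.
    destruct (inp_ok _ _ _ I _ HC) as [_ HF].
    eexists; split; [apply wt_refl|].
    apply (law_absorbed Rcv (LS N) C (Nu (Par (pren (up S) N) F))); auto.
    + split.
      * eapply ok_pren; [|exact Hs]. apply radm_up, (radm_S Rcv).
      * rewrite <- (pren_id F). eapply ok_pren; [|exact HF].
        intros [|[|n]]; simpl; unfold plain; auto; discriminate.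
    + rewrite (inp_absorb _ _ _ I _ N) by reflexivity. cbn [link]. rewrite link_pren.
      change (fun n => lup (rho (LS N) 0) (up S n)) with (fun n =>
        lup (rho (LS N) 0) (up (Nat.add 1) n)).
      rewrite (lup_rho_add (LS N) 0), (link_lname _ _ _ Hs).
      change (up (Nat.add 0)) with (up (fun n => n)). rewrite up_id, pren_id. reflexivity.
  (* The client sends to an input server. *)
  - match goal with H : inp (srv _) _ _ |- _ =>
      destruct (srv_inp _ _ _ _ _ Hs H) as (-> & -> & ->) end.
    match goal with H : outs C _ _ _ |- _ => destruct (outs_unframe_r _ _ _ _ _ H)
      as (R1 & O1 & E1) end.
    destruct (outs_outd _ _ _ _ O1) as (k & p & C' & O & D & E).
    destruct (outd_ok _ _ _ _ _ O _ HC) as (_ & Hp & HC' & HA).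
    rewrite lift_kinds, Nat.add_0_r in *.
    unfold conc in E. rewrite link_sbody in E by auto.
    eexists; split; [apply wt_refl|].
    apply (law_absorbed Snd v C (nus k (Par C' (body (lren (Nat.add (S k)) v) p)))); auto.
    + rewrite ok_nus, lift_kinds, Nat.add_0_r. split; auto.
      apply ok_body; auto. apply server_lift; auto.
    + rewrite E1, E; reflexivity.
    (* Without a continuation, the client is congruent to its residual beside the message, and
       [link] maps the message to the server body that the interaction released. *)
    + rewrite (HA eq_refl) at 1. rewrite !link_nus, lups_rho, Nat.add_0_r.
      cbn [link]. rewrite link_body by auto. reflexivity.
  - match goal with H : tau C _ |- _ => destruct (tau_link _ _ _ _ Hs H 0 HC)
      as (R' & X & E & HR & EX & T) end.
    exists X; split; [apply wt_tau; auto|].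
    eapply clc_cong; [rewrite E; reflexivity|symmetry; exact EX|].
    apply clc_cl, cl_base. left. eapply law_intro; eauto.
  - exfalso; eapply srv_tau; eauto.
Qed.

Lemma fires_law v C C' : fires v 0 C C' -> wt (Nu (Par C (srv v))) (Nu (Par C' (srv v))).
Proof. unfold fires. rewrite srvj_0. apply wt_nu. Qed.

Lemma law_inp_inv P Q a F : law names Q P -> inp P a F ->
  exists Q1 F', wt Q Q1 /\ inp Q1 a F' /\ clc lawrel (scons Any names) F F'.
Proof.
  intros (kd & v & C & Hs & HC & -> & ->) H.
  change (scons kd names) with (kinds kd 0) in HC.
  destruct (inp_link_inv _ _ _ _ _ Hs H 0 C eq_refl HC)
    as (C1 & c & F0 & W & HC1 & I & Hc & E & ->).
  destruct c as [|c]; [tauto|]. assert (a = c) as -> by (injection E; intros <-; reflexivity).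
  destruct (inp_ok _ _ _ I _ HC1) as [_ HF].
  eexists _, _; repeat split; [apply fires_law, W|apply inp_nu, inp_parl, I|].
  apply clc_cl, cl_base. right. eapply (law_abs kd); eauto.
Qed.

Lemma law_outs_inv P Q a F F' R : law names Q P -> outs P a F R ->
  cl lawrel (scons Any names) F F' ->
  exists Q1 R', wt Q Q1 /\ outs Q1 a F' R' /\ clc lawrel names R R'.
Proof.
  intros (kd & v & C & Hs & HC & -> & ->) H HF.
  change (scons kd names) with (kinds kd 0) in HC.
  destruct (outs_outd _ _ _ _ H) as (k & q & X & O & D & E).
  destruct (outd_link_inv _ _ _ _ _ _ _ Hs O 0 C eq_refl HC)
    as (C1 & c & p & C' & W & HC1 & O1 & Hc & Ec & Eq & ->).
  destruct c as [|c]; [tauto|]. assert (a = c) as -> by (injection Ec; intros <-; reflexivity).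
  destruct (outd_ok _ _ _ _ _ O1 _ HC1) as (_ & Hp & HC' & _).
  rewrite lift_kinds, Nat.add_0_r in *.
  destruct (rcvk_rot k p q F' (pay_rot _ _ _ _ _ Hs Hp Eq)) as [_ D1].
  destruct (cl_link _ _ _ _ lawrel_stable HF (rcvk k q) names) as [D2 _]; auto using adm_rcvk.
  destruct (outd_outs _ _ _ _ _ O1 (pren (up S) F')) as (R' & O2 & E2); [tauto|].
  eexists _, _; repeat split; [apply fires_law, W|apply outs_nu, outs_parl, O2|].
  apply clc_sym; [apply lawrel_stable|].
  eapply clc_cong; [rewrite E2; reflexivity|symmetry; exact E|].
  eapply law_conc; eauto. apply cl_sym; auto using lawrel_stable.
Qed.

Lemma law_tau_inv P Q R : law names Q P -> tau P R ->
  exists R', wt Q R' /\ clc lawrel names R R'.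
Proof.
  intros (kd & v & C & Hs & HC & -> & ->) H.
  change (scons kd names) with (kinds kd 0) in HC.
  destruct (tau_link_inv _ _ _ _ Hs H 0 C eq_refl HC) as (C' & W & HC' & E).
  eexists; split; [apply fires_law, W|].
  eapply clc_cong; [symmetry; exact E|reflexivity|].
  apply clc_cl, cl_base. right. eapply law_intro; eauto.
Qed.

Lemma lawrel_progressing : progressing lawrel.
Proof.
  constructor.
  - apply lawrel_stable.
  - intros P Q a F [H|H]; [apply law_inp|apply law_inp_inv]; auto.
  - intros P Q a F F' R [H|H]; [apply law_outs|apply law_outs_inv]; auto.
  - intros P Q R [H|H]; [apply law_tau|apply law_tau_inv]; auto.
Qed.

(** The hypotheses range over all plain kinds because the hole of a context may lie below any
    binders. *)
Theorem server_elim k v C : (forall V, plainv V -> server k V v) ->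
  (forall V, plainv V -> ok (scons k V) C) ->
  pi_equiv (Nu (Par C (srv v))) (link (scons v (lname idn)) C).
Proof.
  intros Hs HC. apply (progressing_equiv lawrel); [apply lawrel_progressing|].
  intros V HV. left. exists k, v, C; auto.
Qed.

(** * The interpretation *)

(** [Inp2] renames the process that it guards, so that only the equivalences closed under
    renaming are preserved by [stack_server]. *)
Definition peq (P Q : proc) : Prop := forall f, pi_equiv (pren f P) (pren f Q).

#[export] Instance peq_equiv : Equivalence peq.
Proof.
  split.
  - intros P f; reflexivity.
  - intros P Q H f; symmetry; auto.
  - intros P Q R H H' f; etransitivity; eauto.
Qed.

#[export] Instance scong_peq : subrelation scong peq.
Proof. intros P Q H f. apply scong_pi_equiv, scong_pren; auto. Qed.

#[export] Instance pren_peq f : Proper (peq ==> peq) (pren f).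
Proof. intros P Q H g. rewrite !pren_comp. apply H. Qed.
#[export] Instance Par_peq : Proper (peq ==> peq ==> peq) Par.
Proof. intros P P' H Q Q' H' f. simpl. rewrite (H f), (H' f). reflexivity. Qed.
#[export] Instance Repl_peq : Proper (peq ==> peq) Repl.
Proof. intros P P' H f. simpl. rewrite (H f). reflexivity. Qed.
#[export] Instance Nu_peq : Proper (peq ==> peq) Nu.
Proof. intros P P' H f. simpl. rewrite (H (up f)). reflexivity. Qed.
#[export] Instance Inp_peq a : Proper (peq ==> peq) (Inp a).
Proof. intros P P' H f. simpl. rewrite (H (up f)). reflexivity. Qed.
#[export] Instance Out_peq a p : Proper (peq ==> peq) (Out a p).
Proof. intros P P' H f. simpl. rewrite (H f). reflexivity. Qed.
#[export] Instance Let_peq p : Proper (peq ==> peq) (Let p).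
Proof. intros P P' H f. simpl. rewrite (H (up (up f))). reflexivity. Qed.
#[export] Instance subst_server_peq x : Proper (peq ==> peq) (subst_server x).
Proof. intros P P' H. unfold subst_server. rewrite H. reflexivity. Qed.
#[export] Instance stack_server_peq c a : Proper (peq ==> peq) (stack_server c a).
Proof. intros P P' H. unfold stack_server, Inp2. rewrite H. reflexivity. Qed.

Lemma peq_pi_equiv P Q : peq P Q -> pi_equiv P Q.
Proof. intros H. rewrite <- (pren_id P), <- (pren_id Q). apply H. Qed.

Lemma server_elim_peq k v C : (forall V, plainv V -> server k V v) ->
  (forall V, plainv V -> ok (scons k V) C) ->
  peq (Nu (Par C (srv v))) (link (scons v (lname idn)) C).
Proof.
  intros Hs HC f. simpl. rewrite <- srv_lren, server_elim with (k := k).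
  - rewrite link_pren, pren_link.
    match goal with |- pi_equiv (link ?f _) (link ?g _) => replace f with g; [reflexivity|] end.
    fext.
  (* From the constant assignment [Any], every renaming into plain kinds is admissible; so this one
     instance of each hypothesis yields all renamed ones. *)
  - intros V HV. apply (server_lren k (fun _ => Any)).
    + intros n. apply HV.
    + apply Hs. intros n; auto.
  - intros V HV. apply ok_pren with (V := scons k (fun _ => Any)).
    + apply radm_up. intros n; apply HV.
    + apply HC. intros n; auto.
Qed.

(* Renaming and channel usage of interpretations *)
Scheme term_cmd_ind := Induction for term Sort Prop
  with cmd_term_ind := Induction for cmd Sort Prop.
Combined Scheme term_cmd_mut from term_cmd_ind, cmd_term_ind.

Lemma pren_subst_server f x N : pren f (subst_server x N) = subst_server (f x) (pren (up f) N).
Proof. reflexivity. Qed.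

Lemma pren_stack_server f c a N :
  pren f (stack_server c a N) = stack_server (f c) (f a) (pren (up (up (up f))) N).
Proof.
  unfold stack_server, Inp2, subst_server, fwd; simpl. rewrite !pren_comp.
  repeat f_equal; fext.
Qed.

Lemma scons_shift f e :
  (fun n => up f (scons 0 (shift_env 1 e) n)) = scons 0 (shift_env 1 (fun n => f (e n))).
Proof. fext. Qed.

Lemma interp_ren_mut :
  (forall M e h a f, pren f (interp e h M a) =
     interp (fun n => f (e n)) (fun n => f (h n)) M (f a)) /\
  (forall C e h f, pren f (cinterp e h C) = cinterp (fun n => f (e n)) (fun n => f (h n)) C).
Proof.
  apply term_cmd_mut; intros; cbn [interp cinterp pren];
    rewrite ?pren_subst_server, ?pren_stack_server; auto.
  - rewrite H. repeat f_equal. fext.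
  - rewrite H, H0. repeat f_equal.
  - rewrite H, H0, scons_shift. repeat f_equal.
  - rewrite pren_comp, !H. f_equal; fext.
  - rewrite H, H0, scons_shift. repeat f_equal.
  - rewrite H, H0, scons_shift. repeat f_equal.
  - rewrite H, H0, scons_shift. repeat f_equal.
Qed.

Lemma interp_ren M e h a f :
  pren f (interp e h M a) = interp (fun n => f (e n)) (fun n => f (h n)) M (f a).
Proof. apply interp_ren_mut. Qed.

Lemma cinterp_ren C e h f :
  pren f (cinterp e h C) = cinterp (fun n => f (e n)) (fun n => f (h n)) C.
Proof. apply interp_ren_mut. Qed.

Lemma interp_Mu e h C a : interp e h (Mu C) a = cinterp e (scons a h) C.
Proof. simpl. rewrite cinterp_ren. f_equal. fext. Qed.

Lemma shift_scons_up f e : (fun n => scons 0 (shift_env 1 e) (up f n)) =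
  scons 0 (shift_env 1 (fun n => e (f n))).
Proof. fext. Qed.

Lemma interp_tren_mut :
  (forall M e h a f g, interp e h (tren f g M) a =
     interp (fun n => e (f n)) (fun n => h (g n)) M a) /\
  (forall C e h f g, cinterp e h (cren f g C) = cinterp (fun n => e (f n)) (fun n => h (g n)) C).
Proof.
  apply term_cmd_mut; intros; cbn [interp cinterp tren cren]; auto;
    rewrite ?H, ?H0, ?shift_scons_up; auto.
  repeat f_equal. fext.
Qed.

Lemma interp_tren M e h a f g :
  interp e h (tren f g M) a = interp (fun n => e (f n)) (fun n => h (g n)) M a.
Proof. apply interp_tren_mut. Qed.

Lemma cinterp_cren C e h f g :
  cinterp e h (cren f g C) = cinterp (fun n => e (f n)) (fun n => h (g n)) C.
Proof. apply interp_tren_mut. Qed.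

Lemma ok_subst_server V x N : plain (V x) -> ok (scons Nam V) N -> ok V (subst_server x N).
Proof. intros H H'. simpl. repeat split; auto. Qed.

Lemma ok_fwd V a b : V a <> Snd -> V b <> Rcv -> ok V (Repl (fwd a b)).
Proof.
  intros H H'. simpl. repeat split; auto.
  destruct (V b); unfold plain; auto; congruence.
Qed.

Lemma ok_stack_server V c a N : V c <> Snd -> V a <> Rcv ->
  ok (scons Nam (scons Nam (scons Nam V))) N -> ok V (stack_server c a N).
Proof.
  intros H H1 H2. unfold stack_server, Inp2.
  assert (A : ok (scons Nam (scons Nam (scons Any V)))
    (pren (up (up S)) (Par (subst_server 0 N) (Repl (fwd 1 (2 + a)))))).
  { apply ok_pren with (V := scons Nam (scons Nam V)).
    - exact (radm_up _ _ _ Nam (radm_up _ _ _ Nam (radm_S Any V))).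
    - split; [apply ok_subst_server; simpl; auto|apply ok_fwd; simpl; auto; discriminate]. }
  exact (conj H (conj plain_Any A)).
Qed.

(** The discipline behind everything: a term only receives on its variables, and only sends on its
    mu-names and on its result channel. So a variable may be [Rcv] and a name or result [Snd]. *)
Lemma ok_interp_mut :
  (forall M e h a V, (forall n, V (e n) <> Snd) -> (forall n, V (h n) <> Rcv) ->
     V a <> Rcv -> ok V (interp e h M a)) /\
  (forall C e h V, (forall n, V (e n) <> Snd) -> (forall n, V (h n) <> Rcv) ->
     ok V (cinterp e h C)).
Proof.
  apply term_cmd_mut; intros; cbn [interp cinterp].
  - split; auto. apply ok_fwd; simpl; auto; discriminate.
  - cbn [ok]. split.
    + apply H; try (intros [|n]); simpl; auto; try discriminate.
    + simpl. repeat split; auto. destruct (V a); unfold plain; auto; congruence.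
  - split; [apply H|apply ok_stack_server; [| |apply H0]]; simpl; auto; discriminate.
  - split; [apply H; try (intros [|n])|apply ok_subst_server; [|apply H0]];
      simpl; auto; discriminate.
  - apply ok_pren with (V := scons (V a) V).
    + intros [|n]; simpl; unfold idn; [destruct (V a)|destruct (V n)]; unfold plain; auto;
        discriminate.
    + apply H; try (intros [|n]); simpl; auto.
  - split; [apply H; try (intros [|n])|apply ok_stack_server; [| |apply H0]]; simpl; auto;
      discriminate.
  - apply H; auto.
  - split; [apply H; try (intros [|n])|apply ok_subst_server; [|apply H0]];
      simpl; auto; discriminate.
  - split; [apply H; try (intros [|n])|apply ok_stack_server; [| |apply H0]]; simpl; auto;
      discriminate.
Qed.

Lemma ok_interp M e h a V : (forall n, V (e n) <> Snd) -> (forall n, V (h n) <> Rcv) ->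
  V a <> Rcv -> ok V (interp e h M a).
Proof. apply ok_interp_mut. Qed.

Lemma plain_Snd k : plain k -> k <> Snd.
Proof. intros [-> | ->]; discriminate. Qed.

Lemma plain_Rcv k : plain k -> k <> Rcv.
Proof. intros [-> | ->]; discriminate. Qed.

#[export] Hint Resolve plain_Snd plain_Rcv : core.

Lemma ok_interp_names M e h a : ok names (interp e h M a).
Proof. apply ok_interp; intros; discriminate. Qed.

(** Every interpretation is a renaming of the one whose free channels are pairwise
    distinct. *)
Lemma link_interp r r' M e h a e' h' a' :
  (forall n, r (e n) = r' (e' n)) -> (forall n, r (h n) = r' (h' n)) -> r a = r' a' ->
  link r (interp e h M a) = link r' (interp e' h' M a').
Proof.
  intros He Hh Ha.
  (* In the generic interpretation the result is channel 0, variables are the odd channels and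
     mu-names the positive even ones; [phi] decodes this from the predecessor of the channel. *)
  set (phi := fun (e h : nat -> nat) (a n : nat) =>
    match n with 0 => a | S m => if Nat.even m then e (Nat.div2 m) else h (Nat.div2 m) end).
  assert (E : forall e h a, interp e h M a =
    pren (phi e h a) (interp (fun n => S (2 * n)) (fun n => S (2 * n + 1)) M 0)).
  { intros e0 h0 a0. rewrite interp_ren. unfold phi.
    f_equal; extensionality n.
    - rewrite Nat.even_even, Nat.div2_double; auto.
    - rewrite Nat.even_odd, Nat.add_1_r, Nat.div2_succ_double; auto. }
  rewrite (E e h a), (E e' h' a'), !link_pren. f_equal.
  extensionality n. unfold phi. destruct n; auto.
  destruct (Nat.even n); auto.
Qed.

Lemma link_interp_names r M e h a e' h' a' :
  (forall n, r (e n) = lname e' n) -> (forall n, r (h n) = lname h' n) -> r a = LD (DName a') ->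
  link r (interp e h M a) = interp e' h' M a'.
Proof.
  intros. rewrite (link_interp r (lname (fun n => n)) M e h a e' h' a'); auto.
  rewrite (link_lname _ names); [apply pren_id|]. apply ok_interp_names.
Qed.

(** * Servers occurring in interpretations *)

Definition stk (e h : nat -> nat) (N : term) (b : nat) : proc :=
  Par (subst_server 0 (interp (shift_env 3 e) (shift_env 3 h) N 0)) (Repl (fwd 1 (2 + b))).

Lemma stack_server_srv e h N b :
  stack_server 0 (1 + b) (interp (shift_env 4 e) (shift_env 4 h) N 0) = srv (LL (stk e h N b)).
Proof.
  unfold stk, stack_server, Inp2, subst_server, fwd; simpl. rewrite !interp_ren. reflexivity.
Qed.

Lemma subst_server_srv e h N :
  subst_server 0 (interp (shift_env 2 e) (shift_env 2 h) N 0) =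
  srv (LS (interp (shift_env 1 e) (shift_env 1 h) N 0)).
Proof. unfold subst_server; simpl. rewrite interp_ren. reflexivity. Qed.

Lemma fwd_srv a : Repl (fwd 0 (1 + a)) = srv (LD (DName a)).
Proof. reflexivity. Qed.

Lemma server_stk e h N b V : plainv V -> server Snd V (LL (stk e h N b)).
Proof.
  intros HV. simpl. repeat split; auto.
  apply ok_interp; simpl; auto; discriminate.
Qed.

Lemma server_interp e h N V : plainv V ->
  server Rcv V (LS (interp (shift_env 1 e) (shift_env 1 h) N 0)).
Proof. intros HV. apply ok_interp; simpl; auto; discriminate. Qed.

Lemma pren_stk f e h N b :
  pren (up (up f)) (stk e h N b) = stk (fun n => f (e n)) (fun n => f (h n)) N (f b).
Proof. unfold stk, subst_server, fwd; simpl. rewrite interp_ren. reflexivity. Qed.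

Lemma interp_Sub e h M N a :
  peq (interp e h (Sub M N) a)
      (link (scons (LS (interp (shift_env 1 e) (shift_env 1 h) N 0)) (lname idn))
            (interp (scons 0 (shift_env 1 e)) (shift_env 1 h) M (1 + a))).
Proof.
  cbn [interp]. rewrite subst_server_srv. apply server_elim_peq with (k := Rcv).
  - intros; apply server_interp; auto.
  - intros V HV; apply ok_interp; try (intros [|n]); simpl; auto; discriminate.
Qed.

Lemma interp_MSub e h M N g a :
  peq (interp e h (MSub M N g) a)
      (link (scons (LL (stk e h N (h g))) (lname idn))
            (interp (shift_env 1 e) (scons 0 (shift_env 1 h)) M (1 + a))).
Proof.
  cbn [interp]. rewrite stack_server_srv. apply server_elim_peq with (k := Snd).
  - intros; apply server_stk; auto.
  - intros V HV; apply ok_interp; try (intros [|n]); simpl; auto; discriminate.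
Qed.

(** Eliminating a forwarder replaces its source with its target, here the result channel of [M]. *)
Lemma forward a e h M :
  peq (Nu (Par (interp (shift_env 1 e) (shift_env 1 h) M 0) (Repl (fwd 0 (1 + a)))))
      (interp e h M a).
Proof.
  rewrite fwd_srv, server_elim_peq with (k := Snd).
  - rewrite (link_interp_names _ M _ _ _ e h a); auto; reflexivity.
  - intros V HV; apply HV.
  - intros V HV; apply ok_interp; simpl; auto; discriminate.
Qed.

Lemma link_stack_server r c c' a a' N : r c = LD (DName c') -> r a = LD (DName a') ->
  link r (stack_server c a N) = stack_server c' a' (link (lup (lup (lup r))) N).
Proof.
  intros Ec Ea. unfold stack_server, Inp2, subst_server, fwd; simpl.
  rewrite Ec, Ea; simpl. rewrite link_pren, pren_link. repeat f_equal.
  extensionality n; destruct n as [|[|[|n]]]; simpl; auto. rewrite !lren_comp; reflexivity.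
Qed.

Lemma gc k v P : (forall V, plainv V -> server k V v) -> (forall V, plainv V -> ok V P) ->
  peq (Nu (Par (psh P) (srv v))) P.
Proof.
  intros Hs HP. rewrite (server_elim_peq k); auto.
  - unfold psh. rewrite link_pren.
    change (fun n => scons v (lname idn) (S n)) with (lname (fun n => n)).
    rewrite (link_lname _ names), pren_id; auto. reflexivity.
  - intros V HV. eapply ok_pren; [apply radm_S|auto].
Qed.

Lemma ok_interp_plain M e h a V : plainv V -> ok V (interp e h M a).
Proof. intros HV; apply ok_interp; auto. Qed.

(** * Soundness of the reduction rules *)

(** The application server has a single client, the output of the abstraction. Eliminating it
    releases a server for the variable and a forwarder from the result of the body to [a], and
    [forward] accounts for the latter. *)
Lemma interp_beta e h M N a :
  peq (interp e h (App (Lam M) N) a) (interp e h (Sub M N) a).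
Proof.
  cbn [interp]. rewrite stack_server_srv, (server_elim_peq Snd).
  2: intros; apply server_stk; auto.
  2: { intros V HV. cbn [ok]. split.
       - apply ok_interp; try (intros [|n]); simpl; auto; discriminate.
       - simpl. auto 7. }
  match goal with |- peq (link ?r (Nu (Nu (Par ?A ?B)))) _ =>
    change (link r (Nu (Nu (Par A B))))
      with (Nu (Nu (Par (link (lup (lup r)) A) (link (lup (lup r)) B)))) end.
  set (r := lup (lup (scons (LL (stk e h N a)) (lname idn)))).
  rewrite (link_interp_names r M _ _ _ (scons 1 (shift_env 2 e)) (shift_env 2 h) 0); auto.
  2: intros [|n]; reflexivity.
  change (link r (Out (2 + 0) (DPair 1 0) Nil))
    with (letx (DPair 1 0) (pren (up (up S)) (pren (up (up S)) (stk e h N a)))).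
  rewrite !pren_stk.
  assert (E : letx (DPair 1 0) (stk (fun n => S (S (e n))) (fun n => S (S (h n))) N (S (S a))) =
    Par (psh (subst_server 0 (interp (shift_env 2 e) (shift_env 2 h) N 0))) (Repl (fwd 0 (1 + S a)))).
  { unfold letx, stk, psh, subst_server, fwd; simpl. rewrite !interp_ren. reflexivity. }
  rewrite E.
  rewrite <- (forward (S a) (scons 0 (shift_env 1 e)) (shift_env 1 h) M).
  apply scong_peq. rewrite <- nu_par_r. apply Nu_scong, Nu_scong.
  replace (shift_env 1 (scons 0 (shift_env 1 e))) with (scons 1 (shift_env 2 e)) by fext.
  change (shift_env 1 (shift_env 1 h)) with (shift_env 2 h). pac.
Qed.

(** The absorbed input of the variable turns into a private copy of [N] followed by a forwarder to
    [a]. *)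
Lemma interp_sub_var e h N a : peq (interp e h (Sub (Var 0) N) a) (interp e h N a).
Proof.
  rewrite interp_Sub. cbn [interp link]. rewrite <- (forward a e h N). reflexivity.
Qed.

Lemma nu_nu_nu P : Nu (Nu (Nu P)) == Nu (Nu (Nu (pren swap01 (pren (up swap01) P)))).
Proof. rewrite (sc_nu_nu (Nu P)). simpl. rewrite (sc_nu_nu (pren (up swap01) P)). reflexivity. Qed.

(** The output of an abstraction does not mention the server channel, so scope extrusion alone
    pushes a server [Q] of either kind under the two restrictions. The two swaps move its channel
    below [x] and [b]. *)
Lemma nu_lam A Q a : Nu (Par (Nu (Nu (Par A (Out (3 + a) (DPair 1 0) Nil)))) Q) ==
  Nu (Nu (Par (Nu (Par (pren swap01 (pren (up swap01) A))
                       (pren swap01 (pren (up swap01) (psh (psh Q))))))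
              (Out (2 + a) (DPair 1 0) Nil))).
Proof.
  set (O := Out (2 + a) (DPair 1 0) Nil). set (s := fun P => pren swap01 (pren (up swap01) P)).
  change (Nu (Par (Nu (Nu (Par A (Out (3 + a) (DPair 1 0) Nil)))) Q) ==
          Nu (Nu (Par (Nu (Par (s A) (s (psh (psh Q))))) O))).
  rewrite <- (nu_par_r (Nu _) Q), <- (nu_par_r _ (psh Q)), nu_nu_nu, <- (nu_par_r _ O).
  apply Nu_scong, Nu_scong, Nu_scong.
  change (Par (Par (s A) (psh O)) (s (psh (psh Q))) == Par (Par (s A) (s (psh (psh Q)))) (psh O)).
  pac.
Qed.

Lemma interp_sub_lam e h M N a :
  peq (interp e h (Sub (Lam M) N) a)
      (interp e h (Lam (Sub (tren swap01 idn M) (shv N))) a).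
Proof.
  apply scong_peq. cbn [interp]. etransitivity; [apply (nu_lam _ _ a)|]. unfold shv, psh.
  rewrite !pren_subst_server, !interp_ren, !interp_tren.
  match goal with |- ?A == ?B => replace A with B; [reflexivity|] end.
  repeat f_equal; fext.
Qed.

Lemma interp_msub_lam e h M N g a :
  peq (interp e h (MSub (Lam M) N g) a) (interp e h (Lam (MSub M (shv N) g)) a).
Proof.
  apply scong_peq. cbn [interp]. etransitivity; [apply (nu_lam _ _ a)|]. unfold shv, psh.
  rewrite !pren_stack_server, !interp_ren, !interp_tren.
  match goal with |- ?A == ?B => replace A with B; [reflexivity|] end.
  repeat f_equal; fext.
Qed.

(** Eliminating one shared server substitutes it in both components, as does eliminating a separate
    one in each. The argument lies below a replicated input, so the elimination is needed under
    prefixes. *)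
Lemma interp_sub_app e h P Q N a :
  peq (interp e h (Sub (App P Q) N) a) (interp e h (App (Sub P N) (Sub Q N)) a).
Proof.
  rewrite interp_Sub. cbn [interp link].
  rewrite (link_stack_server _ 0 0 (1 + (1 + a)) (1 + a)) by reflexivity.
  change (Nu (Par (interp (scons 0 (shift_env 1 (shift_env 1 e))) (shift_env 1 (shift_env 1 h)) P (1 + 0))
     (subst_server 0 (interp (shift_env 2 (shift_env 1 e)) (shift_env 2 (shift_env 1 h)) N 0))))
    with (interp (shift_env 1 e) (shift_env 1 h) (Sub P N) 0).
  change (Nu (Par (interp (scons 0 (shift_env 1 (shift_env 4 e))) (shift_env 1 (shift_env 4 h)) Q (1 + 0))
     (subst_server 0 (interp (shift_env 2 (shift_env 4 e)) (shift_env 2 (shift_env 4 h)) N 0))))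
    with (interp (shift_env 4 e) (shift_env 4 h) (Sub Q N) 0).
  rewrite !interp_Sub.
  match goal with |- peq (Nu (Par ?A (stack_server _ _ ?B))) (Nu (Par ?C (stack_server _ _ ?D))) =>
    assert (EA : A = C); [|assert (EB : B = D); [|rewrite EA, EB; reflexivity]] end.
  - apply link_interp; try (intros [|n]); simpl; rewrite ?interp_ren; reflexivity.
  - apply link_interp; try (intros [|n]); simpl; rewrite ?interp_ren; reflexivity.
Qed.

Lemma interp_msub_app e h P Q N g a :
  peq (interp e h (MSub (App P Q) N g) a) (interp e h (App (MSub P N g) (MSub Q N g)) a).
Proof.
  rewrite interp_MSub. cbn [interp link].
  rewrite (link_stack_server _ 0 0 (1 + (1 + a)) (1 + a)) by reflexivity.
  change (Nu (Par (interp (shift_env 1 (shift_env 1 e)) (scons 0 (shift_env 1 (shift_env 1 h))) P (1 + 0))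
     (stack_server 0 (1 + shift_env 1 h g)
        (interp (shift_env 4 (shift_env 1 e)) (shift_env 4 (shift_env 1 h)) N 0))))
    with (interp (shift_env 1 e) (shift_env 1 h) (MSub P N g) 0).
  change (Nu (Par (interp (shift_env 1 (shift_env 4 e)) (scons 0 (shift_env 1 (shift_env 4 h))) Q (1 + 0))
     (stack_server 0 (1 + shift_env 4 h g)
        (interp (shift_env 4 (shift_env 4 e)) (shift_env 4 (shift_env 4 h)) N 0))))
    with (interp (shift_env 4 e) (shift_env 4 h) (MSub Q N g) 0).
  rewrite !interp_MSub.
  match goal with |- peq (Nu (Par ?A (stack_server _ _ ?B))) (Nu (Par ?C (stack_server _ _ ?D))) =>
    assert (EA : A = C); [|assert (EB : B = D); [|rewrite EA, EB; reflexivity]] end.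
  - apply link_interp; try (intros [|n]); try reflexivity.
    exact (f_equal LL (pren_stk S e h N (h g))).
  - apply link_interp; try (intros [|n]); try reflexivity.
    change (lren S (lren S (lren S (lren S (LL (stk e h N (h g)))))) =
            LL (stk (shift_env 4 e) (shift_env 4 h) N (shift_env 4 h g))).
    rewrite !lren_comp. exact (f_equal LL (pren_stk (fun n => S (S (S (S n)))) e h N (h g))).
Qed.

(** Two servers with the same body: sending to one of them or to the other is the same. *)
Lemma interp_msub_same e h M N g :
  peq (cinterp e h (CMSub (Named 0 M) N g)) (cinterp e h (Named g (App (MSub M N g) N))).
Proof.
  change (cinterp e h (CMSub (Named 0 M) N g)) with
    (Nu (Par (interp (shift_env 1 e) (scons 0 (shift_env 1 h)) M 0)
             (stack_server 0 (1 + h g) (interp (shift_env 4 e) (shift_env 4 h) N 0)))).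
  change (cinterp e h (Named g (App (MSub M N g) N))) with
    (Nu (Par (interp (shift_env 1 e) (shift_env 1 h) (MSub M N g) 0)
             (stack_server 0 (1 + h g) (interp (shift_env 4 e) (shift_env 4 h) N 0)))).
  rewrite interp_MSub, stack_server_srv.
  set (X := stk e h N (h g)).
  assert (EX : stk (shift_env 1 e) (shift_env 1 h) N (shift_env 1 h g) = pren (up (up S)) X).
  { unfold X; rewrite pren_stk. reflexivity. }
  rewrite EX.
  assert (HX : forall V, plainv V -> server Snd V (LL X)) by (intros; apply server_stk; auto).
  rewrite !(server_elim_peq Snd); auto.
  - set (I := interp (shift_env 1 (shift_env 1 e)) (scons 0 (shift_env 1 (shift_env 1 h))) M (1 + 0)).
    (* The nested eliminations become one substitution that sends both channels to [X]; hence it is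
       the same to use the replaced name or the application channel as result. *)
    rewrite (link_link I (scons Snd (scons Snd names))).
    + unfold I. apply scong_peq.
      match goal with |- ?A == ?B => replace A with B; [reflexivity|] end.
      assert (EX' : link (lup (lup (scons (LL X) (lname idn)))) (pren (up (up S)) X) = X).
      { rewrite link_pren, !lup_pre.
      change (fun n => scons (LL X) (lname idn) (S n)) with (lname (fun n => n)).
        rewrite !lup_lname, !up_id, (link_lname X (scons Nam (scons Nam names))); [apply pren_id|].
        apply (HX names); auto. }
      apply link_interp; try (intros [|n]); cbn [scons shift_env lname Nat.add lcomp];
        rewrite ?EX'; reflexivity.
    + apply ok_interp; try (intros [|n]); simpl; unfold names; discriminate.
    + intros [|[|n]]; simpl; split; try discriminate.
      intros _. exists (S n); split; auto. eexists; reflexivity.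
  - intros V HV. apply ok_link with (V := scons Snd (scons Snd V)).
    + intros [|[|n]].
      * exact (server_lren Snd V (LL X) S (scons Snd V) (radm_S Snd V) (HX V HV)).
      * simpl; discriminate.
      * simpl; unfold idn; destruct (HV n) as [E|E]; rewrite E; simpl; unfold plain; auto.
    + apply ok_interp; try (intros [|n]); simpl; auto; discriminate.
  - intros V HV. apply ok_interp; try (intros [|n]); simpl; auto; discriminate.
Qed.

(* Induction on reductions *)
Scheme red_credu_ind := Minimality for red Sort Prop
  with credu_red_ind := Minimality for credu Sort Prop.
Combined Scheme red_credu_mut from red_credu_ind, credu_red_ind.

(** Rules that only move, rename or remove a mu-binder hold up to syntactic equality, and those for
    [Lam] under a substitution up to structural congruence; the others use elimination. Environments
    are quantified because the context rules interpret subterms in shifted ones. *)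
Lemma red_interp_mut :
  (forall M N, red M N -> forall e h a, peq (interp e h M a) (interp e h N a)) /\
  (forall C D, credu C D -> forall e h, peq (cinterp e h C) (cinterp e h D)).
Proof.
  assert (eqp : forall P Q : proc, P = Q -> peq P Q) by (intros P Q ->; reflexivity).
  apply red_credu_mut; intros.
  - apply interp_beta.
  - apply eqp. rewrite interp_Mu.
    change (interp e h (App (Mu C) N) a) with
      (Nu (Par (interp (shift_env 1 e) (shift_env 1 h) (Mu C) 0)
               (stack_server 0 (1 + a) (interp (shift_env 4 e) (shift_env 4 h) N 0)))).
    cbn [cinterp]. unfold shn. rewrite interp_Mu, cinterp_cren, interp_tren.
    repeat f_equal; fext.
  - apply eqp. rewrite interp_Mu. unfold shn. cbn [cinterp]. rewrite interp_tren. reflexivity.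
  - apply interp_sub_var.
  - cbn [interp]. rewrite subst_server_srv. unfold shv. rewrite interp_tren.
    match goal with |- peq (Nu (Par ?P _)) _ =>
      change P with (interp (fun n => S (e n)) (fun n => S (h n)) M (S a)) end.
    rewrite <- (interp_ren M e h a S).
    apply (gc Rcv); auto using server_interp, ok_interp_plain.
  - apply interp_sub_lam.
  - apply interp_sub_app.
  - apply eqp. rewrite interp_Mu.
    change (interp e h (Sub (Mu (Named b M)) N) a) with
      (Nu (Par (interp (scons 0 (shift_env 1 e)) (shift_env 1 h) (Mu (Named b M)) (1 + a))
               (subst_server 0 (interp (shift_env 2 e) (shift_env 2 h) N 0)))).
    rewrite interp_Mu. cbn [cinterp interp]. unfold shn. rewrite interp_tren.
    replace (shift_env 1 (scons a h)) with (scons (1 + a) (shift_env 1 h)) by fext.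
    do 2 f_equal. f_equal. destruct b; reflexivity.
  - apply eqp. rewrite interp_Mu.
    change (interp e h (MSub (Mu C) N g) a) with
      (Nu (Par (interp (shift_env 1 e) (scons 0 (shift_env 1 h)) (Mu C) (1 + a))
               (stack_server 0 (1 + h g) (interp (shift_env 4 e) (shift_env 4 h) N 0)))).
    cbn [cinterp]. unfold shn. rewrite interp_Mu, cinterp_cren, interp_tren.
    repeat f_equal; fext.
  - cbn [interp]. rewrite stack_server_srv. unfold shn. rewrite interp_tren.
    match goal with |- peq (Nu (Par ?P _)) _ =>
      change P with (interp (fun n => S (e n)) (fun n => S (h n)) M (S a)) end.
    rewrite <- (interp_ren M e h a S).
    apply (gc Snd); auto using server_stk, ok_interp_plain.
  - apply interp_msub_lam.
  - apply interp_msub_app.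
  - cbn [interp]. rewrite H0. reflexivity.
  - cbn [interp]. rewrite H0. reflexivity.
  - cbn [interp]. rewrite H0. reflexivity.
  - cbn [interp]. rewrite H0. reflexivity.
  - cbn [interp]. rewrite H0. reflexivity.
  - cbn [interp]. rewrite H0. reflexivity.
  - cbn [interp]. rewrite H0. reflexivity.
  - cbn [interp]. rewrite H0. reflexivity.
  - apply eqp. cbn [cinterp]. rewrite interp_Mu, cinterp_cren. f_equal; fext.
  - apply interp_msub_same.
  - reflexivity.
  - cbn [cinterp]. rewrite H0. reflexivity.
  - cbn [cinterp]. rewrite H0. reflexivity.
  - cbn [cinterp]. rewrite H0. reflexivity.
  - cbn [cinterp]. rewrite H0. reflexivity.
  - cbn [cinterp]. rewrite H0. reflexivity.
Qed.

Theorem theorem4p3 (M N : term) (a : nat) :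
  eqx M N -> pi_equiv (interpretation M a) (interpretation N a).
Proof.
  intros H. apply peq_pi_equiv. unfold interpretation. induction H.
  - apply red_interp_mut; auto.
  - reflexivity.
  - symmetry; auto.
  - etransitivity; eauto.
Qed.
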